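(* Let $K$ be an infinite field and $\lambda=(\lambda_1\ge\cdots\ge\lambda_n)$ a partition with positive parts. Then the reduction number of the Ferrers ideal $I_\lambda$ is $$r(I_\lambda)=\min\{n-1,\ \lambda_i+i-3\ :\ 2\le i\le n\},$$ and this also equals $r_{J_\lambda}(I_\lambda)$, where $J_\lambda$ is the minimal reduction generated by the diagonals $\sum_{i\ge1,\,k+i\le\lambda_i}x_iy_{k+i}$ ($k=0,\dots,\lambda_1-1$) and $\sum_{i\ge1,\,k+i\le n,\,i\le\lambda_{k+i}}x_{k+i}y_i$ ($k=1,\dots,n-1$).
   Context: The Ferrers ideal is $I_\lambda=(x_iy_j:1\le i\le n,\ 1\le j\le\lambda_i)\subset K[x_1,\dots,x_n,y_1,\dots,y_{\lambda_1}]$. An ideal $J\subset I$ is a reduction of $I$ if $I^{r+1}=JI^r$ for some $r\ge0$; the least such $r$ is $r_J(I)$. A reduction is minimal if no strictly smaller ideal is a reduction of $I$. The reduction number is $r(I)=\min\{r_J(I): J\text{ a minimal reduction of }I\}$. *)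

(* Defs.v *)
From HB Require Import structures.
From mathcomp Require Import all_boot all_order all_algebra.
Set Implicit Arguments. Unset Strict Implicit. Unset Printing Implicit Defensive.
Import Order.TTheory GRing.Theory.
Local Open Scope ring_scope.

Fixpoint mpoly (K : comNzRingType) (k : nat) : comNzRingType :=
  if k is k'.+1 then ({poly mpoly K k'} : comNzRingType) else K.

(* The variable t_i of mpoly K k (0 <= i < k); t_{k-1} is the outermost 'X. *)
Fixpoint mvar (K : comNzRingType) (k : nat) (i : nat) : mpoly K k :=
  match k return mpoly K k with
  | 0 => 0
  | k'.+1 => if i == k' then 'X else (mvar K k' i)%:P
  end.

Section Ideals.
Variable R : comNzRingType.

Definition is_ideal (I : R -> Prop) : Prop :=
  [/\ I 0, (forall a b, I a -> I b -> I (a + b)) & (forall r a, I a -> I (r * a))].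

Definition ideal_sub (I J : R -> Prop) : Prop := forall f, I f -> J f.
Definition ideal_eq (I J : R -> Prop) : Prop := forall f, I f <-> J f.

Definition gen_ideal (gs : seq R) : R -> Prop :=
  fun f => exists cs : seq R, f = \sum_(i < size gs) cs`_i * gs`_i.

Definition ideal_mul (I J : R -> Prop) : R -> Prop :=
  fun f => exists s : seq (R * R),
    (forall p, p \in s -> I p.1 /\ J p.2) /\ f = \sum_(p <- s) p.1 * p.2.

Fixpoint ideal_pow (I : R -> Prop) (r : nat) : R -> Prop :=
  if r is r'.+1 then ideal_mul (ideal_pow I r') I else (fun _ => True).

Definition reduction_at (J I : R -> Prop) (r : nat) : Prop :=
  ideal_eq (ideal_pow I r.+1) (ideal_mul J (ideal_pow I r)).

Definition is_reduction (J I : R -> Prop) : Prop :=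
  is_ideal J /\ ideal_sub J I /\ exists r, reduction_at J I r.

Definition is_minimal_reduction (J I : R -> Prop) : Prop :=
  is_reduction J I /\
  forall J', is_ideal J' -> ideal_sub J' J -> is_reduction J' I -> ideal_sub J J'.

Definition reduction_number_wrt (J I : R -> Prop) (r : nat) : Prop :=
  reduction_at J I r /\ forall r', reduction_at J I r' -> (r <= r')%N.

Definition reduction_number (I : R -> Prop) (r : nat) : Prop :=
  (exists J, is_minimal_reduction J I /\ reduction_number_wrt J I r) /\
  (forall J r', is_minimal_reduction J I -> reduction_number_wrt J I r' -> (r <= r')%N).

End Ideals.

(* Ferrers setting. The partition lam = [:: lambda_1; ...; lambda_n] (0-indexed
   in Rocq: lambda_{i+1} = nth 0 lam i).  Ring: K[x_1..x_n, y_1..y_{lambda_1}],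
   with x_{i+1} = t_i (i < n) and y_{j+1} = t_{n+j} (j < lambda_1). *)
Section Ferrers.
Variables (K : comNzRingType) (lam : seq nat).

Definition nF := size lam.
Definition lam1 := nth 0%N lam 0.
Definition FRing := mpoly K (nF + lam1).
Definition xv (i : nat) : FRing := mvar K (nF + lam1) i.
Definition yv (j : nat) : FRing := mvar K (nF + lam1) (nF + j).

Definition ferrers_ideal : FRing -> Prop :=
  gen_ideal [seq xv i * yv j | i <- iota 0 nF, j <- iota 0 (nth 0%N lam i)].

Definition diagD (k : nat) : FRing :=
  \sum_(i < nF | (k + i < nth 0%N lam i)%N) xv i * yv (k + i).

Definition diagE (k : nat) : FRing :=
  \sum_(i < nF | (k + i < nF)%N && (i < nth 0%N lam (k + i))%N) xv (k + i) * yv i.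

Definition J_lambda : FRing -> Prop :=
  gen_ideal ([seq diagD k | k <- iota 0 lam1] ++ [seq diagE k | k <- iota 1 nF.-1]).

End Ferrers.
Arguments ferrers_ideal : clear implicits.
Arguments J_lambda : clear implicits.
Arguments diagD : clear implicits.
Arguments diagE : clear implicits.
Arguments xv : clear implicits.
Arguments yv : clear implicits.
Arguments FRing : clear implicits.

(* min{ n-1, lambda_i + i - 3 : 2 <= i <= n }  (1-indexed i; here i0 = i-1) *)
Definition ferrers_rn (lam : seq nat) : nat :=
  (\big[minn/(size lam).-1]_(1 <= i0 < size lam) (nth 0 lam i0 + i0.+1 - 3)%N)%N.

Definition infinite_field (K : fieldType) : Prop :=
  forall s : seq K, exists x : K, x \notin s.

(* Main.v *)
From HB Require Import structures.
Require Import Defs.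
From mathcomp Require Import all_boot all_order all_algebra.
From mathcomp Require boolp classical_sets.
From mathcomp Require Import mpoly.
From mathcomp Require Import zify ring.
Set Implicit Arguments. Unset Strict Implicit. Unset Printing Implicit Defensive.
Import Order.TTheory GRing.Theory.
Local Open Scope ring_scope.

(* Write F = sum_d F_d for the fibre ring: F_d is spanned by the products of d cells x_i y_j
   of the diagram.  Modulo the diagonals, straightening reduces every product to a strict
   chain, i.e. a set of cells off the first row and column whose rows increase while their
   columns decrease; the longest strict chain has ferrers_rn lam cells, which bounds the
   reduction number of J_lambda from above.  Counting monomials through lattice paths shows
   that the products (monomial in the diagonals) * (strict chain) are as many as the
   monomials of F_d, so strict chains are really needed; perturbing any other l = n + lam_1 - 1
   generators towards the diagonals extends this lower bound to all of them, and every minimal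
   reduction has at most l generators modulo the irrelevant ideal.  Since the ring is not
   local, minimality of J_lambda must be checked at every maximal ideal: a proper subreduction
   yields a linear functional on J_lambda at a residue field, killing the subreduction; by
   Cayley-Hamilton its values satisfy an integral equation, and algebraic independence of
   suitable initial forms of the diagonals forces them to vanish. *)

(** * Spans *)

Section Span.
Variables (K : fieldType) (V : lmodType K).

(** Two obstacles shape the argument. Reductions need not be homogeneous, so an ideal enters the
    fibre ring only through leading forms: the components of degree [2d] of its elements in [I^d].
    They see the origin only, which suffices for the lower bound but not for minimality, where every
    maximal ideal counts. At another residue field the functional [c] is not given as the value of
    the diagonals at a point, so the integral equation cannot simply be evaluated. The bridge is
    linear: [c] and the initial forms of weight two both respect every linear relation among the
    diagonals, read in the residue field. Hence both are expressed, with the same coefficients,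
    through the diagonals that carry a lead cell, and the initial forms of these are algebraically
    independent. The equation thus becomes an identity of polynomials, into which [c] may be
    substituted. *)

Inductive span (G : V -> Prop) : V -> Prop :=
| span0 : span G 0
| spanZD a x y : G x -> span G y -> span G (a *: x + y).

Definition fam (I : finType) (A : {set I}) (g : I -> V) : V -> Prop :=
  fun p => exists2 i, i \in A & p = g i.

Lemma span_mem (G : V -> Prop) x : G x -> span G x.
Proof. by move=> Gx; rewrite -[x]scale1r -[_ *: _]addr0; apply: spanZD=> //; exact: span0. Qed.

Lemma spanD (G : V -> Prop) x y : span G x -> span G y -> span G (x + y).
Proof.
move=> Gx Gy; elim: Gx => [|a u v Gu _ IH]; first by rewrite add0r.
by rewrite -addrA; apply: spanZD.
Qed.

Lemma spanZ (G : V -> Prop) a x : span G x -> span G (a *: x).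
Proof.
elim=> [|b u v Gu _ IH]; first by rewrite scaler0; exact: span0.
by rewrite scalerDr scalerA; apply: spanZD.
Qed.

Lemma spanN (G : V -> Prop) x : span G x -> span G (- x).
Proof. by rewrite -scaleN1r; exact: spanZ. Qed.

Lemma spanB (G : V -> Prop) x y : span G x -> span G y -> span G (x - y).
Proof. by move=> Gx Gy; apply: spanD=> //; apply: spanN. Qed.

Lemma span_sum (G : V -> Prop) (I : Type) (r : seq I) (P : pred I) (F : I -> V) :
  (forall i, P i -> span G (F i)) -> span G (\sum_(i <- r | P i) F i).
Proof. by move=> GF; elim/big_rec: _ => [|i x Pi Gx]; [exact: span0 | apply: spanD; auto]. Qed.

Lemma span_sum_mem (G : V -> Prop) (I : eqType) (r : seq I) (F : I -> V) :
  (forall i, i \in r -> span G (F i)) -> span G (\sum_(i <- r) F i).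
Proof.
by move=> GF; rewrite big_seq; apply: span_sum.
Qed.

Lemma span_sub (G H : V -> Prop) x : (forall y, G y -> span H y) -> span G x -> span H x.
Proof. by move=> GH; elim=> [|a u v Gu _ IH]; [exact: span0 | apply: spanD=> //; apply/spanZ/GH]. Qed.

Lemma span_fam (I : finType) (A : {set I}) (g : I -> V) x :
  span (fam A g) x -> exists a : I -> K, x = \sum_(i in A) a i *: g i.
Proof.
elim=> [|b _ v [i iA ->] _ [a ->]].
  by exists (fun _ => 0); rewrite big1 // => i _; rewrite scale0r.
exists (fun j => (if j == i then b else 0) + a j).
under [RHS]eq_bigr => j _ do rewrite scalerDl.
rewrite big_split /=; congr (_ + _); rewrite (bigD1 i iA) /= eqxx big1 ?addr0 // => j /andP[_ /negbTE ->].
by rewrite scale0r.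
Qed.

(** The coefficient matrix of the [g t] over the [h i] has more rows than columns, so its left
    kernel contains a nonzero row. *)
Lemma span_dependent (T I : finType) (A : {set T}) (B : {set I}) (g : T -> V) (h : I -> V) :
  (forall t, t \in A -> span (fam B h) (g t)) -> (#|B| < #|A|)%N ->
  exists2 a : T -> K, exists2 t, t \in A & a t != 0 & \sum_(t in A) a t *: g t = 0.
Proof.
move=> gB ltBA.
have [c cE] : exists c : T -> I -> K, forall t, t \in A -> g t = \sum_(i in B) c t i *: h i.
  suff /boolp.choice[c cP] : forall t, exists a : I -> K, t \in A -> g t = \sum_(i in B) a i *: h i.
    by exists c.
  move=> t; case: (boolP (t \in A)) => [/gB/span_fam [a ->]|_]; first by exists a.
  by exists (fun=> 0).
pose M : 'M[K]_(#|A|, #|B|) := \matrix_(i, j) c (enum_val i) (enum_val j).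
have : kermx M != 0.
  rewrite kermx_eq0; apply: contraTN ltBA => /eqP rM.
  by rewrite -leqNgt -rM rank_leq_col.
case/rowV0Pn => u /sub_kermxP uM uN0.
have [k uk] : exists k, u 0 k != 0 by apply/rV0Pn.
case: (pickP (fun t : T => t \in A)) => [t0 t0A|A0]; last first.
  by have := enum_valP k; rewrite A0.
exists (fun t => u 0 (enum_rank_in t0A t)).
  by exists (enum_val k); rewrite ?enum_valP // enum_valK_in.
transitivity (\sum_(t in A) \sum_(i in B) (u 0 (enum_rank_in t0A t) * c t i) *: h i).
  apply: eq_bigr => t tA; rewrite (cE t tA) scaler_sumr.
  by apply: eq_bigr => i _; rewrite scalerA.
rewrite exchange_big /= big1 // => i iB; rewrite -scaler_suml.
rewrite (_ : \sum_(t in A) _ = (u *m M) 0 (enum_rank_in iB i)); first by rewrite uM mxE scale0r.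
rewrite [LHS](reindex_onto (enum_val : 'I_#|A| -> T) (enum_rank_in t0A)) /=; last first.
  by move=> t tA; rewrite enum_rankK_in.
rewrite mxE; apply: eq_big => [j|j _]; first by rewrite enum_valP enum_valK_in eqxx.
by rewrite mxE enum_valK_in enum_rankK_in.
Qed.

(* If [b = A g0] and [h = C b] then [A (g0 + t h) = (1 + t A C) b], and det (1 + t A C) is 1 at t = 0. *)
Lemma span_open (J T : finType) (b : J -> V) (g0 h : T -> V) :
  (forall j, span (fam setT g0) (b j)) -> (forall i, span (fam setT b) (h i)) ->
  exists2 p : {poly K}, p.[0] != 0 &
    forall t, p.[t] != 0 -> forall j, span (fam setT (fun i => g0 i + t *: h i)) (b j).
Proof.
move=> bg hb.
have [A AE] : exists A : J -> T -> K, forall j, b j = \sum_i A j i *: g0 i.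
  suff /boolp.choice[A AP] : forall j, exists a : T -> K, b j = \sum_i a i *: g0 i by exists A.
  by move=> j; have /span_fam[a ->] := bg j; exists a; apply: eq_bigl => i; rewrite inE.
have [C CE] : exists C : T -> J -> K, forall i, h i = \sum_j C i j *: b j.
  suff /boolp.choice[C CP] : forall i, exists a : J -> K, h i = \sum_j a j *: b j by exists C.
  by move=> i; have /span_fam[a ->] := hb i; exists a; apply: eq_bigl => j; rewrite inE.
pose X : 'M[K]_#|J| := \matrix_(j, k) \sum_i A (enum_val j) i * C i (enum_val k).
pose P : 'M[{poly K}]_#|J| := 1%:M + 'X *: map_mx polyC X.
have PE t : map_mx (horner_eval t) P = 1%:M + t *: X.
  apply/matrixP=> i j; rewrite !mxE /horner_eval !hornerE.
  by rewrite -polyC_natr hornerC.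
have dE t : (\det P).[t] = \det (1%:M + t *: X).
  by rewrite -PE; rewrite [RHS](det_map_mx (horner_eval t)).
exists (\det P); first by rewrite dE scale0r addr0 det1 oner_neq0.
move=> t; rewrite dE => dN0 j.
have Yu : 1%:M + t *: X \in unitmx by rewrite unitmxE unitfE.
set Y := 1%:M + t *: X in Yu.
have key j' : \sum_i A j' i *: (g0 i + t *: h i) = \sum_k Y (enum_rank j') (enum_rank k) *: b k.
  under eq_bigr do rewrite scalerDr.
  rewrite big_split /= -AE.
  under [RHS]eq_bigr do rewrite !mxE scalerDl -scalerA.
  rewrite big_split /=; congr (_ + _).
    rewrite (bigD1 j') //= eqxx scale1r big1 ?addr0 // => k kj.
    by rewrite (inj_eq enum_rank_inj) eq_sym (negbTE kj) scale0r.
  rewrite -scaler_sumr; under eq_bigr do rewrite scalerA mulrC -scalerA.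
  rewrite -scaler_sumr; congr (_ *: _).
  under eq_bigr do rewrite CE scaler_sumr.
  rewrite exchange_big /=; apply: eq_bigr => k _.
  rewrite !enum_rankK scaler_suml; apply: eq_bigr => i _.
  by rewrite scalerA.
have -> : b j = \sum_j' (invmx Y) (enum_rank j) (enum_rank j') *:
    \sum_i A j' i *: (g0 i + t *: h i).
  under eq_bigr do rewrite key scaler_sumr.
  rewrite exchange_big /=; under eq_bigr do under eq_bigr do rewrite scalerA.
  under eq_bigr do rewrite -scaler_suml.
  rewrite (bigD1 j) //= [X in b j = _ + X]big1 ?addr0.
    rewrite (_ : \sum_i _ = (invmx Y *m Y) (enum_rank j) (enum_rank j)).
      by rewrite mulVmx // mxE eqxx scale1r.
    by rewrite mxE (reindex_onto (enum_rank : J -> _) enum_val) /= => [|i _];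
       rewrite ?enum_valK //; apply: eq_bigl => i; rewrite enum_rankK eqxx.
  move=> k kj; rewrite (_ : \sum_i _ = (invmx Y *m Y) (enum_rank j) (enum_rank k)).
    by rewrite mulVmx // mxE (inj_eq enum_rank_inj) eq_sym (negbTE kj) scale0r.
  by rewrite mxE (reindex_onto (enum_rank : J -> _) enum_val) /= => [|i _];
     rewrite ?enum_valK //; apply: eq_bigl => i; rewrite enum_rankK eqxx.
apply: span_sum => j' _; apply: spanZ; apply: span_sum => i _; apply/spanZ/span_mem.
by exists i.
Qed.

End Span.

(** A relation from [span_dependent] is refuted by the coefficient of any monomial occurring in it;
    this is the dimension count behind the lower bound. *)
Lemma mpolyX_span_card (K : fieldType) (n : nat) (T I : finType) (A : {set T}) (B : {set I})
    (m : T -> 'X_{1.. n}) (g : I -> {mpoly K[n]}) :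
  {in A &, injective m} -> (forall t, t \in A -> span (fam B g) 'X_[m t]) -> (#|A| <= #|B|)%N.
Proof.
move=> m_inj mB; rewrite leqNgt; apply/negP => /(span_dependent mB)[a [t tA atN0]].
move/(congr1 (mcoeff (m t))); rewrite mcoeff0 raddf_sum /= (bigD1 t) //=.
rewrite mcoeffZ mcoeffX eqxx mulr1 big1 ?addr0 => [/eqP|t' /andP[t'A t't]].
  by rewrite (negbTE atN0).
rewrite mcoeffZ mcoeffX (inj_in_eq m_inj) // (negbTE t't) mulr0 //.
Qed.

Lemma span_mul (K : fieldType) (V : comAlgType K) (G H T : V -> Prop) x y :
  (forall g h, G g -> H h -> span T (g * h)) -> span G x -> span H y -> span T (x * y).
Proof.
move=> GHT; elim=> [|a u v Gu _ IH] Hy; first by rewrite mul0r; exact: span0.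
rewrite mulrDl; apply: spanD; last exact: IH.
rewrite -scalerAl; apply: spanZ; elim: Hy => [|b w z Hw _ IHy]; first by rewrite mulr0; exact: span0.
by rewrite mulrDr -scalerAr; apply: spanD=> //; apply/spanZ/GHT.
Qed.

Lemma infinite_uniq (K : fieldType) : infinite_field K ->
  forall n, exists2 s : seq K, uniq s & size s = n.
Proof.
move=> Kinf; elim=> [|n [s us sz]]; first by exists [::].
by have [x xs] := Kinf s; exists (x :: s); rewrite /= ?xs ?sz.
Qed.

Lemma infinite_nonroot (K : fieldType) (p : {poly K}) :
  infinite_field K -> p != 0 -> exists t, p.[t] != 0.
Proof.
move=> Kinf pN0; have [s us sz] := infinite_uniq Kinf (size p).
have : ~~ all (root p) s by apply/negP => /(max_poly_roots pN0) /(_ us); rewrite sz ltnn.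
by rewrite -has_predC => /hasP[t _ /= rt]; exists t.
Qed.

(** * Cells and straightening *)

Section Cells.
Variable lam : seq nat.
Local Notation n := (nF lam).
Local Notation m := (lam1 lam).

Definition cell : finType := ('I_n * 'I_m)%type.
Definition row (c : cell) : nat := c.1.
Definition col (c : cell) : nat := c.2.

Lemma row_lt c : (row c < n)%N. Proof. exact: ltn_ord. Qed.
Lemma col_lt c : (col c < m)%N. Proof. exact: ltn_ord. Qed.
Lemma row_pair (c d : cell) : row (c.1, d.2) = row c. Proof. by []. Qed.
Lemma col_pair (c d : cell) : col (c.1, d.2) = col d. Proof. by []. Qed.

Definition in_lam (c : cell) := (col c < nth 0 lam (row c))%N.
(** The content [col - row], shifted by [n - 1] to stay a natural number: [diagD k] and [diagE k]
    get the colours [n - 1 + k] and [n - 1 - k]. *)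
Definition color (c : cell) := (col c + (n.-1 - row c))%N.
Definition ncolors := (n + m).-1.
Definition nw (c d : cell) := (row c < row d)%N && (col c < col d)%N.
Definition ne_sw (c d : cell) := (row c < row d)%N && (col d < col c)%N.

Definition strict_chain (S : {set cell}) :=
  [forall c in S, [&& in_lam c, 0 < row c & 0 < col c]%N] &&
  [forall c in S, forall d in S, (c != d) ==> (ne_sw c d || ne_sw d c)].

Lemma color_lt (c : cell) : (color c < ncolors)%N.
Proof. by rewrite /color /ncolors; have := row_lt c; have := col_lt c; lia. Qed.

Lemma cell_color_eq (c d : cell) : color c = color d -> row c = row d -> c = d.
Proof.
case: c d => [i j] [i' j']; rewrite /color /row /col /= => H ii'; congr (_, _); apply: val_inj => //=; lia.
Qed.

Lemma strict_chainP (S : {set cell}) :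
  reflect ((forall c, c \in S -> [/\ in_lam c, 0 < row c & 0 < col c]%N) /\
           (forall c d, c \in S -> d \in S -> c != d -> ne_sw c d || ne_sw d c))
          (strict_chain S).
Proof.
apply: (iffP andP) => [[/forall_inP H1 /forall_inP H2]|[H1 H2]]; split.
- by move=> c /H1 /and3P.
- by move=> c d /H2/forall_inP + dS cd => /(_ d dS)/implyP; apply.
- by apply/forall_inP => c /H1[*]; apply/and3P.
- apply/forall_inP => c cS; apply/forall_inP => d dS; apply/implyP; exact: H2.
Qed.

Hypothesis lam_sorted : sorted geq lam.

Lemma nth_lam_anti i j : (i <= j)%N -> (nth 0 lam j <= nth 0 lam i)%N.
Proof.
move=> ij; case: (ltnP j (size lam)) => [jn|nj]; last by rewrite nth_default.
have geqT : transitive geq by move=> x y z /=; lia.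
exact: (sorted_leq_nth geqT leqnn 0%N lam_sorted i j (leq_ltn_trans ij jn) jn ij).
Qed.

Lemma in_lamW (c d : cell) : (row c <= row d)%N -> (col c <= col d)%N -> in_lam d -> in_lam c.
Proof. by move=> /nth_lam_anti; rewrite /in_lam; lia. Qed.

Definition phi (s : seq cell) := (\sum_(c <- s) color c ^ 2)%N.
(** Secondary measure, for moves to the south-east along one diagonal, where [phi] is constant. *)
Definition coord_sum (s : seq cell) := (\sum_(c <- s) (row c + col c))%N.

(** For words of fixed length both measures are bounded, so induction may run upward in the
    lexicographic order of [phi] and [coord_sum]. *)
Lemma chain_ind (k : nat) (P : seq cell -> Prop) :
  (forall s, size s = k ->
     (forall s', size s' = k ->
       (phi s < phi s')%N \/ phi s = phi s' /\ (coord_sum s < coord_sum s')%N -> P s') -> P s) ->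
  forall s, size s = k -> P s.
Proof.
move=> step.
have phi_le s : (phi s <= size s * ncolors ^ 2)%N.
  rewrite /phi; elim: s => [|c s IH]; first by rewrite big_nil.
  by rewrite big_cons /= mulSn leq_add // leq_exp2r // ltnW // color_lt.
have cs_le s : (coord_sum s <= size s * (n + m))%N.
  rewrite /coord_sum; elim: s => [|c s IH]; first by rewrite big_nil.
  by rewrite big_cons /= mulSn leq_add // leq_add // ltnW ?row_lt ?col_lt.
move=> s; have [a] := ubnP (k * ncolors ^ 2 - phi s)%N.
elim: a s => // a IHa s; have [b] := ubnP (k * (n + m) - coord_sum s)%N.
elim: b s => // b IHb s ltb lta sk; apply: step => // s' s'k [lt|[eq lt]].
  by apply: IHa => //; have := phi_le s'; rewrite s'k; lia.
by apply: IHb => //; [have := cs_le s'; rewrite s'k; lia|lia].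
Qed.

(** The swap keeps the sum of the two colours and pushes them further apart, so the sum of squares
    grows by convexity. *)
Lemma phi_swap (c d : cell) (t : seq cell) : nw c d ->
  (phi [:: c, d & t] < phi [:: (c.1, d.2), (d.1, c.2) & t])%N.
Proof.
case/andP => H1 H2; rewrite /phi !big_cons !addnA ltn_add2r /color !row_pair !col_pair.
have := row_lt d; have := row_lt c.
move: (row c) (row d) (col c) (col d) H1 H2.
move=> i i' j j' ii' jj' lti lti'.
have : (n.-1 - i' < n.-1 - i)%N by lia.
move: (n.-1 - i')%N (n.-1 - i)%N => u' u; nia.
Qed.

Section Ring.
Variables (K : fieldType) (A : comAlgType K) (x : 'I_n -> A) (y : 'I_m -> A).

Definition cellv (c : cell) : A := x c.1 * y c.2.
Definition diag (e : nat) : A := \sum_(c | in_lam c && (color c == e)) cellv c.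
Definition Fgen (d : nat) (p : A) : Prop :=
  exists s : seq cell, [/\ size s = d, all in_lam s & p = \prod_(c <- s) cellv c].
Definition mulgen (I : Type) (v : I -> A) (d : nat) (p : A) : Prop :=
  exists e b, Fgen d b /\ p = v e * b.
Definition chaingen (k : nat) (p : A) : Prop :=
  exists S, [/\ strict_chain S, #|S| = k & p = \prod_(c in S) cellv c].

(** Exactly what makes it progress to trade [c] for the other cells of its diagonal: a cell
    north-west of [c] either does not exist (first row or column) or is strictly north-west of the
    factor [f], which permits a swap. The same condition later describes the cells of a lattice
    path. *)
Definition loose (c : cell) (t : seq cell) :=
  [|| row c == 0%N , col c == 0%N  |
      has (fun f : cell => (row f == row c) && (col c <= col f)%N || (col f == col c) && (row c <= row f)%N) t].

(** A repeated cell is loose through its other copy, and of two cells in one row or column the one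
    nearer the border is loose; what remains for two distinct cells is [ne_sw]. *)
Lemma tight_strict (s : seq cell) : all in_lam s ->
  (forall c d, c \in s -> d \in s -> ~~ nw c d) ->
  (forall c, c \in s -> ~~ loose c (rem c s)) ->
  uniq s /\ strict_chain [set c in s].
Proof.
move=> sl snw sloose; have us : uniq s.
  elim: s sl snw sloose => //= c s IH /andP[cl sl] snw sloose.
  have := sloose c (mem_head _ _); rewrite eqxx => nl.
  apply/andP; split.
    apply: contra nl => cs; apply/or3P/Or33/hasP; exists c => //.
    by rewrite eqxx leqnn.
  apply: IH => // [a b aS bS|a aS].
    by apply: snw; rewrite in_cons ?aS ?bS orbT.
  have := sloose a; rewrite in_cons aS orbT => /(_ isT); apply: contra.
  case/or3P => [H|H|/hasP[f fs H]]; [by apply/or3P/Or31|by apply/or3P/Or32|].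
  apply/or3P/Or33/hasP; exists f => //; case: eqP => _; last by rewrite in_cons fs orbT.
  exact: mem_rem fs.
split=> //; apply/strict_chainP; split=> [c|c d]; rewrite !inE.
  move=> cs; have := sloose c cs; rewrite /loose !negb_or => /and3P[c1 c2 _].
  by rewrite (allP sl) // !lt0n.
move=> cs ds cd.
have dc : d \in rem c s by rewrite (rem_filter _ us) mem_filter /= eq_sym cd.
have cd' : c \in rem d s by rewrite (rem_filter _ us) mem_filter /= cd.
have := sloose c cs; rewrite /loose !negb_or => /and3P[_ _ /hasPn /(_ d dc)].
have := sloose d ds; rewrite /loose !negb_or => /and3P[_ _ /hasPn /(_ c cd')].
have := snw c d cs ds; have := snw d c ds cs.
rewrite /nw /ne_sw; lia.
Qed.

(* The diagonal relations eliminate every factor that is loose; ordering products by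
   [phi], which is constant along diagonals and grows under NW/SE swaps, this terminates. *)
Lemma straightening (s : seq cell) : all in_lam s ->
  span (fun p => (0 < size s)%N /\ mulgen (fun e : 'I_ncolors => diag e) (size s).-1 p
                 \/ chaingen (size s) p) (\prod_(c <- s) cellv c).
Proof.
move: {2}(size s) (erefl (size s)) => k sk.
pose P (s : seq cell) := all in_lam s ->
  span (fun p => (0 < k)%N /\ mulgen (fun e : 'I_ncolors => diag e) k.-1 p \/ chaingen k p)
   (\prod_(c <- s) cellv c).
rewrite sk; move: s sk; apply: (@chain_ind k P) => {}s sk IH sl.
(* The second alternative serves words obtained from [s] by moving one cell along its diagonal:
   [phi] is unchanged, and the swap then raises it. *)
have swap c d t : perm_eq s [:: c, d & t] \/ (phi s = phi [:: c, d & t] /\ size s = (size t).+2) ->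
   nw c d -> all in_lam [:: c, d & t] ->
    span (fun p => (0 < k)%N /\ mulgen (fun e : 'I_ncolors => diag e) k.-1 p \/ chaingen k p)
      (\prod_(c <- [:: c, d & t]) cellv c).
  move=> pst cd /= /and3P[cl dl tl].
  have [phiE szE] : phi s = phi [:: c, d & t] /\ size s = (size t).+2.
    by case: pst => // pst; rewrite /phi (perm_big _ pst) (perm_size pst).
  rewrite (_ : \prod_(c <- _) _ = \prod_(c <- [:: (c.1, d.2), (d.1, c.2) & t]) cellv c); last first.
    by rewrite !big_cons /cellv /=; ring.
  apply: IH => /=; [by rewrite -szE| by left; rewrite phiE phi_swap |].
  case/andP: cd => cd1 cd2; rewrite tl (@in_lamW (c.1, d.2) d) ?(@in_lamW (d.1, c.2) d) ?row_pair ?col_pair //= ltnW //.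
case: (boolP (has (fun c => has (nw c) s) s)) => [/hasP[c cs /hasP[d ds cd]]|].
  have ds' : d \in rem c s.
    have : d \in c :: rem c s by rewrite -(perm_mem (perm_to_rem cs)).
    by rewrite in_cons => /orP[/eqP dc|//]; move: cd; rewrite dc /nw ltnn.
  have pst : perm_eq s [:: c, d & rem d (rem c s)].
    by apply: (perm_trans (perm_to_rem cs)); rewrite perm_cons perm_to_rem.
  rewrite (perm_big _ pst); apply: swap => //; first by left.
  by rewrite -(perm_all _ pst).
move=> /hasPn snw.
case: (boolP (has (fun c => loose c (rem c s)) s)) => [/hasP[c cs cloose]|/hasPn sloose]; last first.
  have [us ss] : uniq s /\ strict_chain [set c in s].
    apply: tight_strict => // c d cs ds; by have /hasPn := snw c cs; apply.
  apply: span_mem; right; exists [set c in s]; split=> //.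
    by rewrite cardsE (card_uniqP us).
  by rewrite big_uniq //=; apply: eq_bigl => c; rewrite inE.
set t := rem c s in cloose.
have pst : perm_eq s (c :: t) by exact: perm_to_rem.
have /= /andP[cl tl] : all in_lam (c :: t) by rewrite -(perm_all in_lam pst).
have szt : size t = k.-1 by rewrite -sk (perm_size pst).
have k0 : (0 < k)%N by rewrite -sk (perm_size pst).
rewrite (perm_big _ pst) /= big_cons.
have -> : cellv c = diag (color c) - \sum_(d | (in_lam d && (color d == color c)) && (d != c)) cellv d.
  by rewrite /diag (bigD1 c) /= ?cl ?eqxx // addrK.
rewrite mulrBl; apply: spanB.
  apply: span_mem; left; split=> //; exists (Ordinal (color_lt c)), (\prod_(j <- t) cellv j).
  by split=> //; exists t.
rewrite mulr_suml; apply: span_sum => d /andP[/andP[dl /eqP dc] dNc].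
rewrite -(big_cons 1 *%R d t xpredT cellv).
have phiE : phi s = phi (d :: t) by rewrite /phi (perm_big _ pst) !big_cons dc.
have szE : size s = (size t).+1 by rewrite (perm_size pst).
have csE : coord_sum s = (row c + col c + coord_sum t)%N.
  by rewrite /coord_sum (perm_big _ pst) big_cons.
case: (ltngtP (row c) (row d)) => [cd1|cd1|cd1]; last first.
- by case/eqP: dNc; apply: cell_color_eq.
(* Here [d] is north-west of [c] and [coord_sum] drops; looseness of [c] supplies a factor [f]
   south-east of [d], and swapping the two raises [phi]. *)
- have cd2 : (col d < col c)%N by move: dc; rewrite /color; have := row_lt c; lia.
  case/or3P: cloose => [/eqP H|/eqP H|/hasP[f ft ff]]; [lia|lia|].
  have df : nw d f.
    by rewrite /nw; case/orP: ff => /andP[/eqP E H]; rewrite E; lia.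
  have ptf : perm_eq (d :: t) [:: d, f & rem f t] by rewrite perm_cons perm_to_rem.
  rewrite (perm_big _ ptf); apply: swap => //.
    by right; rewrite phiE /phi (perm_big _ ptf); split=> //; rewrite szE; case: (perm_size ptf) => ->.
  by rewrite -(perm_all _ ptf) /= dl.
- apply: IH => /=; [by rewrite -szE| |by rewrite dl].
  right; split=> //; rewrite csE /coord_sum big_cons ltn_add2r.
  by move: dc; rewrite /color; have := row_lt d; lia.
Qed.

End Ring.
End Cells.

(** * Strict chains and lattice paths *)

Lemma bigmin_leq_id (I : Type) (r : seq I) (F : I -> nat) (a : nat) :
  (\big[minn/a]_(i <- r) F i <= a)%N.
Proof. by elim/big_rec: _ => // i x _ xa; rewrite geq_min xa orbT. Qed.

Lemma bigmin_leq (I : eqType) (r : seq I) (F : I -> nat) (a : nat) i :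
  i \in r -> (\big[minn/a]_(i <- r) F i <= F i)%N.
Proof.
elim: r => // j r IH; rewrite in_cons big_cons geq_min => /orP[/eqP->|/IH ->].
  by rewrite leqnn.
by rewrite orbT.
Qed.

Section PathWords.
Variable lam : seq nat.
Local Notation n := (nF lam).
Local Notation m := (lam1 lam).
Local Notation cell := (cell lam).

Definition antichain (s : seq cell) := forall c d, c \in s -> d \in s -> ~~ nw c d.

(** Without north-west pairs, the number of cells in a corner rectangle is determined by the row and
    column counts, and these numbers determine the multiset. *)
Lemma antichain_perm (s s' : seq cell) : antichain s -> antichain s' ->
  (forall i, count (fun c : cell => row c == i) s = count (fun c : cell => row c == i) s') ->
  (forall j, count (fun c : cell => col c == j) s = count (fun c : cell => col c == j) s') ->
  perm_eq s s'.
Proof.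
move=> as_ as' rows cols.
have threshold (f : cell -> nat) :
    (forall i, count (fun c => f c == i) s = count (fun c => f c == i) s') ->
    forall p, count (fun c => f c < p)%N s = count (fun c => f c < p)%N s'.
  move=> fE; elim=> [|p IH]; first by rewrite !(eq_count (a2 := pred0)) ?count_pred0.
  have step t : count (fun c => f c < p.+1)%N t =
      (count (fun c => f c < p)%N t + count (fun c => f c == p) t)%N.
    elim: t => //= c t ->; rewrite ltnS leq_eqVlt.
    by case: ltngtP; lia.
  by rewrite !step IH fE.
have sizeE : size s = size s'.
  have H (t : seq cell) : size t = count (fun c : cell => row c < n)%N t.
    by rewrite -count_predT; apply: eq_count => c; rewrite row_lt.
  by rewrite !H; exact: threshold.
(* Once the rectangle contains a cell, every cell has row below [p] or column below [q], so
   inclusion-exclusion gives the formula; for an empty rectangle the truncated difference is 0. *)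
have rect (t : seq cell) p q : antichain t -> count (fun c : cell => (row c < p) && (col c < q))%N t =
    (count (fun c : cell => row c < p)%N t + count (fun c : cell => col c < q)%N t - size t)%N.
  move=> at_.
  have := count_predUI (fun c : cell => row c < p)%N (fun c : cell => col c < q)%N t.
  have -> : count (predI (fun c : cell => row c < p)%N (fun c : cell => col c < q)%N) t =
    count (fun c : cell => (row c < p) && (col c < q))%N t by [].
  have := count_size (predU (fun c : cell => row c < p)%N (fun c : cell => col c < q)%N) t.
  case: (posnP (count (fun c : cell => (row c < p) && (col c < q))%N t)) => [->|]; first by lia.
  rewrite -has_count => /hasP[c ct /andP[c1 c2]].
  suff : all (predU (fun c : cell => row c < p)%N (fun c : cell => col c < q)%N) t.
    by rewrite all_count => /eqP ->; lia.
  apply/allP => d dt /=; have := at_ c d ct dt; rewrite /nw; lia.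
have rectE p q : count (fun c : cell => (row c < p) && (col c < q))%N s =
    count (fun c : cell => (row c < p) && (col c < q))%N s'.
  by rewrite !rect // (threshold _ rows) (threshold _ cols) sizeE.
(* The multiplicity of [c] is the alternating sum over four corner rectangles, written without
   subtraction. *)
have pointE (c : cell) (t : seq cell) :
    (count_mem c t + (count (fun d : cell => (row d < row c) && (col d < (col c).+1))%N t
                   + count (fun d : cell => (row d < (row c).+1) && (col d < col c))%N t))%N =
    (count (fun d : cell => (row d < (row c).+1) && (col d < (col c).+1))%N t
     + count (fun d : cell => (row d < row c) && (col d < col c))%N t)%N.
  elim: t => //= d t IH.
  have : ((d == c) + (((row d < row c) && (col d < (col c).+1)) +
              ((row d < (row c).+1) && (col d < col c))))%N =
         (((row d < (row c).+1) && (col d < (col c).+1)) +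
              ((row d < row c) && (col d < col c)))%N :> nat.
    case: c d {IH} => [i j] [i' j']; rewrite xpair_eqE -!(inj_eq val_inj) /row /col /=.
    by case: (ltngtP i' i) => H1; case: (ltngtP j' j) => H2 /=; lia.
  move=> H; rewrite [X in (_ + X)%N]addnACA addnACA H.
  by rewrite [RHS]addnACA; congr addn; exact: IH.
apply/allP => c _; apply/eqP => /=.
have := pointE c s; rewrite !rectE -(pointE c s') => /eqP; rewrite eqn_add2r => /eqP //.
Qed.

Section Counting.
Variable pc : {set cell} -> 'I_(ncolors lam) -> cell.
Hypothesis pcP : forall S e, strict_chain S ->
   [/\ in_lam (pc S e), color (pc S e) = e, loose (pc S e) (enum S) &
       forall f, f \in S -> ~~ nw (pc S e) f /\ ~~ nw f (pc S e)].

(** The path passes through [S], so this word lies on the path: [S] marks its forced corners and [a]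
    adds multiplicities, one diagonal at a time. *)
Definition path_word (S : {set cell}) (a : 'I_(ncolors lam) -> nat) : seq cell :=
  enum S ++ flatten [seq nseq (a e) (pc S e) | e <- enum 'I_(ncolors lam)].

Lemma mem_path_word S a c : c \in path_word S a -> c \in S \/ exists e, c = pc S e.
Proof.
rewrite mem_cat mem_enum => /orP[|/flattenP[s /mapP[e _ ->]]]; first by left.
by rewrite mem_nseq => /andP[_ /eqP ->]; right; exists e.
Qed.

Lemma count_path_word S a c : strict_chain S ->
  count_mem c (path_word S a) =
  ((c \in S) + (if pc S (Ordinal (color_lt c)) == c then a (Ordinal (color_lt c)) else 0))%N.
Proof.
move=> Sc; rewrite count_cat count_uniq_mem ?enum_uniq // mem_enum; congr (_ + _)%N.
rewrite count_flatten -map_comp sumnE big_map big_enum /=.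
rewrite (bigD1 (Ordinal (color_lt c))) //= big1 ?addn0 => [|e ec].
  by rewrite count_nseq /=; case: eqP => _; rewrite ?mul1n.
rewrite count_nseq /=; case: eqP => [E|]; last by rewrite mul0n.
by case/eqP: ec; apply: val_inj; have [_ ce _ _] := pcP e Sc; rewrite /= -ce E.
Qed.

Lemma path_word_antichain S a : strict_chain S -> antichain (path_word S a).
Proof.
move=> Sc c d /mem_path_word [cS|[e ->]] /mem_path_word [dS|[e' ->]].
- case/strict_chainP: (Sc) => _ S2; case: (eqVneq c d) => [->|cd]; first by rewrite /nw ltnn.
  by have := S2 c d cS dS cd; rewrite /nw /ne_sw; lia.
- by have [_ _ _ /(_ c cS)[]] := pcP e' Sc.
- by have [_ _ _ /(_ d dS)[]] := pcP e Sc.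
(* For two path cells: anything north-west of [pc S e'] is also north-west of the cell of [S] that
   makes [pc S e'] loose. *)
have [_ _ ce' _] := pcP e' Sc; have [_ _ _ ce] := pcP e Sc.
apply/negP; case/or3P: ce' => [/eqP H|/eqP H|/hasP[f]]; rewrite /nw ?H ?ltn0 ?andbF //.
rewrite mem_enum => /ce[+ _]; rewrite /nw => + /orP[]/andP[/eqP E];
  rewrite E; lia.
Qed.

(** The chain can be read off the support. A cell [c] of [S'] outside [S] would be loose through
    some [f] in [S]; this [f] is a path cell of [S'], hence loose through some [g] in [S']. Then [g]
    lies weakly south-east of [c], which is impossible for distinct cells of a strict chain. *)
Lemma path_word_sub (S S' : {set cell}) a a' : strict_chain S -> strict_chain S' ->
  path_word S a =i path_word S' a' -> S' \subset S.
Proof.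
move=> Sc Sc' E; apply/subsetP => c cS'; apply: contraT => cNS.
have /strict_chainP[S1' S2'] := Sc'.
have [_ c1 c2] := S1' c cS'.
have : c \in path_word S a by rewrite E mem_cat mem_enum cS'.
case/mem_path_word => [cS|[e ce]]; first by rewrite cS in cNS.
have [_ _ + _] := pcP e Sc; rewrite -ce => /or3P[/eqP H|/eqP H|/hasP[f]]; [lia|lia|].
rewrite mem_enum => fS ff.
have fc : f != c by apply: contraNneq cNS => <-.
have : f \in path_word S' a' by rewrite -E mem_cat mem_enum fS.
have fNS' : f \notin S'.
  apply/negP => fS'; have := S2' f c fS' cS' fc; rewrite /ne_sw.
  by case/orP: ff => /andP[/eqP H H']; rewrite H; lia.
case/mem_path_word => [fS'|[e' fe']]; first by rewrite fS' in fNS'.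
have [_ _ + _] := pcP e' Sc'; rewrite -fe' => fl.
have fcle : (row c <= row f)%N /\ (col c <= col f)%N.
  by move: ff => /orP[]/andP[/eqP]; lia.
case/or3P: fl => [/eqP H|/eqP H|/hasP[g]]; [lia|lia|rewrite mem_enum => gS' gg].
have gc : g != c.
  apply: contraNneq fc => gc; rewrite gc in gg.
  have [H H'] : row f = row c /\ col f = col c by lia.
  by apply/eqP/cell_color_eq; rewrite /color ?H ?H'.
have := S2' g c gS' cS' gc; rewrite /ne_sw.
by lia.
Qed.

End Counting.
End PathWords.

(** * Maximal length of strict chains, and the cells of their lattice paths *)

Section Chains.
Variable lam : seq nat.
Local Notation n := (nF lam).
Local Notation m := (lam1 lam).
Local Notation cell := (cell lam).
Hypothesis lam_n0 : (0 < size lam)%N.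
Hypothesis lam_sorted : sorted geq lam.
Hypothesis lam_pos : all (fun l => 0 < l)%N lam.

Lemma nth_lam_gt0 i : (i < n)%N -> (0 < nth 0 lam i)%N.
Proof. by move=> iN; apply: (allP lam_pos); apply: mem_nth. Qed.

(** Each row and each column holds at most one cell. Above row [i0] only the rows [1 .. i0 - 1] are
    available, from there on only the columns [1 .. nth 0 lam i0 - 1]; the sum is the term of the
    minimum at [i0]. *)
Lemma strict_chain_card (S : {set cell}) : strict_chain S -> (#|S| <= ferrers_rn lam)%N.
Proof.
move=> /strict_chainP[S1 S2].
have rows (p q : nat) (a : pred cell) :
    (forall c, c \in S -> a c -> p <= row c < p + q)%N -> (count a (enum S) <= q)%N.
  move=> H; rewrite -size_filter -(size_iota p q) -(size_map (fun c : cell => row c)).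
  apply: uniq_leq_size.
    rewrite map_inj_in_uniq; first by apply: filter_uniq; exact: enum_uniq.
    move=> c d.
    rewrite !(mem_filter a) !mem_enum => /andP[_ cS] /andP[_ dS] E.
    by apply/eqP; apply: contraT => /(S2 c d cS dS); rewrite /ne_sw E ltnn.
  move=> _ /mapP[c + ->]; rewrite (mem_filter a) mem_enum mem_iota => /andP[ac cS]; exact: H.
have cols (p q : nat) (a : pred cell) :
    (forall c, c \in S -> a c -> p <= col c < p + q)%N -> (count a (enum S) <= q)%N.
  move=> H; rewrite -size_filter -(size_iota p q) -(size_map (fun c : cell => col c)).
  apply: uniq_leq_size.
    rewrite map_inj_in_uniq; first by apply: filter_uniq; exact: enum_uniq.
    move=> c d.
    rewrite !(mem_filter a) !mem_enum => /andP[_ cS] /andP[_ dS] E.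
    by apply/eqP; apply: contraT => /(S2 c d cS dS); rewrite /ne_sw E ltnn !andbF.
  move=> _ /mapP[c + ->]; rewrite (mem_filter a) mem_enum mem_iota => /andP[ac cS]; exact: H.
rewrite /ferrers_rn big_seq_cond cardE; elim/big_rec: _ => [|i0 z /andP[] + _ IH].
  rewrite -(count_predT (enum S)); apply: (rows 1%N) => c /S1[_ c1 _] _.
  by rewrite -/(nF lam); have := row_lt c; lia.
rewrite mem_index_iota => /andP[i0p i0n]; rewrite leq_min IH andbT.
rewrite -(count_predC (fun c : cell => row c < i0)%N).
have H1 : (count (fun c : cell => row c < i0)%N (enum S) <= i0 - 1)%N.
  by apply: (rows 1%N) => c /S1[_ c1 _]; lia.
have H2 : (count (predC (fun c : cell => row c < i0)%N) (enum S) <= nth 0 lam i0 - 1)%N.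
  apply: (cols 1%N) => c /S1[cl _ c2] /=; rewrite -leqNgt => /(nth_lam_anti lam_sorted).
  by move: cl; rewrite /in_lam; lia.
by have := nth_lam_gt0 i0n; lia.
Qed.

(** The chain is the antidiagonal [row + col = s + 1] off the first row and column; the terms of the
    minimum place its cells inside the diagram. *)
Lemma strict_chain_exists : exists2 S : {set cell}, strict_chain S & #|S| = ferrers_rn lam.
Proof.
set s := ferrers_rn lam.
have sn : (s <= n.-1)%N by exact: bigmin_leq_id.
have sl i0 : (0 < i0 < n)%N -> (s <= nth 0 lam i0 + i0.+1 - 3)%N.
  by move=> H; apply: (bigmin_leq (fun i0 => nth 0 lam i0 + i0.+1 - 3)%N); rewrite mem_index_iota.
have p1 (t : 'I_s) : (t.+1 < n)%N by have := ltn_ord t; lia.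
have p2 (t : 'I_s) : (s - t < nth 0 lam t.+1)%N.
  by have := sl t.+1 (p1 t); have := ltn_ord t; have := nth_lam_gt0 (p1 t); lia.
have p3 (t : 'I_s) : (s - t < m)%N.
  by apply: leq_trans (p2 t) _; apply: nth_lam_anti.
pose f (t : 'I_s) : cell := (Ordinal (p1 t), Ordinal (p3 t)).
have fI : injective f by move=> t u [] /val_inj.
exists [set f t | t in 'I_s]; last by rewrite card_imset // card_ord.
apply/strict_chainP; split=> [_ /imsetP[t _ ->]|_ _ /imsetP[t _ ->] /imsetP[u _ ->]].
  by split=> //; [exact: p2|rewrite /col /=; have := ltn_ord t; lia].
rewrite (inj_eq fI) /ne_sw /row /col /= -(inj_eq val_inj) /=.
by have := ltn_ord t; have := ltn_ord u; lia.
Qed.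

(* The lattice path through a strict chain S that hugs the north-west border meets every
   diagonal in exactly one cell; on the diagonal of colour e it is this cell. *)
Lemma path_cell_exists (S : {set cell}) (e : 'I_(ncolors lam)) : strict_chain S ->
  exists c : cell, [/\ in_lam c, color c = e, loose c (enum S) &
                      forall f, f \in S -> ~~ nw c f /\ ~~ nw f c].
Proof.
move=> /strict_chainP[S1 S2].
have n0 : (0 < n)%N by [].
have m0 : (0 < m)%N by exact: nth_lam_gt0 n0.
(* The path cell is the first cell of its diagonal that has no cell of [S] strictly south-east of
   it. *)
pose Q (c : cell) := (color c == e) && [forall f in S, ~~ nw c f].
have [c0 Qc0] : exists c, Q c.
  (* The last cell of the diagonal in the [n] by [m] rectangle, in the bottom row or the last
     column, is north-west of nothing. *)
  have [i [j [iN jM ij ijm]]] : exists i j, [/\ i < n, j < m, j + (n.-1 - i) = e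
      & (i == n.-1) || (j == m.-1)]%N.
    have H := ltn_ord e; have ncE : ncolors lam = (n + m).-1 by [].
    case: (ltnP e m) => em; first by exists n.-1, e; rewrite eqxx subnn addn0; split=> //; rewrite ltn_predL.
    exists (m.-1 + n.-1 - e)%N, m.-1; rewrite eqxx orbT; split=> //; lia.
  exists (Ordinal iN, Ordinal jM); rewrite /Q /color /row /col /= ij eqxx /=.
  apply/forall_inP => f _; rewrite /nw /row /col /= -/(row f) -/(col f).
  by have := row_lt f; have := col_lt f; lia.
pose c := [arg min_(c < c0 | Q c) row c].
have [/andP[/eqP ce /forall_inP cS] cmin] : Q c /\ forall d, Q d -> (row c <= row d)%N.
  by rewrite /c; case: arg_minnP.
have cloose : loose c (enum S).
  rewrite /loose; case: posnP => //= c1; case: posnP => //= c2.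
  have i1 : ((row c).-1 < n)%N by have := row_lt c; lia.
  have j1 : ((col c).-1 < m)%N by have := col_lt c; lia.
  have rE : row (Ordinal i1, Ordinal j1) = (row c).-1 by [].
  have kE : col (Ordinal i1, Ordinal j1) = (col c).-1 by [].
  have nQ : ~~ Q (Ordinal i1, Ordinal j1).
    by apply/negP => /cmin; rewrite rE; lia.
  (* By minimality the preceding cell of the diagonal is north-west of some [f] in [S]; as [c] is
     not, [f] shares a row or a column with [c]. *)
  have [f fS fnw] : exists2 f, f \in S & nw (Ordinal i1, Ordinal j1) f.
    move: nQ; rewrite /Q negb_and => /orP[|/forall_inPn[f fS]]; last by rewrite negbK; exists f.
    by move: ce; rewrite /color rE kE => <-; have := row_lt c; lia.
  apply/hasP; exists f; first by rewrite mem_enum.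
  have := cS f fS; by move: fnw; rewrite /nw rE kE; lia.
have cf : row c = 0%N :> nat \/ col c = 0%N :> nat \/ exists f, [/\ f \in S, row c <= row f & col c <= col f]%N.
  case/or3P: cloose => [/eqP|/eqP|/hasP[f]]; [by left|by right;left|].
  rewrite mem_enum => fS H; right; right; exists f; by split=> //; move: H => /orP[]/andP[/eqP]; lia.
exists c; split=> //.
  case: cf => [c1|[c2|[f [fS f1 f2]]]].
  - by rewrite /in_lam c1; exact: col_lt.
  - by rewrite /in_lam c2; apply: nth_lam_gt0; exact: row_lt.
  - by have [fl _ _] := S1 f fS; apply: in_lamW fl.
move=> g gS; split; first exact: cS.
case: cf => [c1|[c2|[f [fS f1 f2]]]]; [by rewrite /nw c1|by rewrite /nw c2 andbF|].
case: (eqVneq g f) => [->|gf]; first by rewrite /nw; lia.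
by have := S2 g f gS fS gf; rewrite /nw /ne_sw; lia.
Qed.

Lemma path_cellP : exists pc : {set cell} -> 'I_(ncolors lam) -> cell,
  forall S e, strict_chain S ->
   [/\ in_lam (pc S e), color (pc S e) = e, loose (pc S e) (enum S) &
       forall f, f \in S -> ~~ nw (pc S e) f /\ ~~ nw f (pc S e)].
Proof.
have n0 : (0 < n)%N by [].
have m0 : (0 < m)%N by exact: nth_lam_gt0 n0.
suff /boolp.choice[g gP] : forall p : {set cell} * 'I_(ncolors lam), exists c : cell, strict_chain p.1 ->
   [/\ in_lam c, color c = p.2, loose c (enum p.1) &
       forall f, f \in p.1 -> ~~ nw c f /\ ~~ nw f c].
  by exists (fun S e => g (S, e)) => S e; exact: (gP (S, e)).
move=> [S e] /=; case: (boolP (strict_chain S)) => [/(path_cell_exists e) [c cP]|_].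
  by exists c.
by exists (Ordinal n0, Ordinal m0).
Qed.

End Chains.

(** * Monomials of the fibre ring *)

Section Monomials.
Variable lam : seq nat.
Local Notation n := (nF lam).
Local Notation m := (lam1 lam).
Local Notation cell := (cell lam).
Local Notation ncolors := (ncolors lam).
Hypothesis lam_n0 : (0 < size lam)%N.
Hypothesis lam_sorted : sorted geq lam.
Hypothesis lam_pos : all (fun l => 0 < l)%N lam.
Variable K : fieldType.
Local Notation A := {mpoly K[n + m]}.

Definition varx (i : 'I_n) : A := 'X_(lshift m i).
Definition vary (j : 'I_m) : A := 'X_(rshift n j).
Local Notation cellv := (cellv varx vary).
Local Notation diag := (diag varx vary).
Local Notation Fgen := (@Fgen lam K A varx vary).
Local Notation mulgen := (@mulgen lam K A varx vary _).
Local Notation chaingen := (@chaingen lam K A varx vary).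

Definition word_mnm (s : seq cell) : 'X_{1.. n + m} :=
  (\sum_(c <- s) (U_(lshift m c.1) + U_(rshift n c.2)))%MM.

Lemma word_mnmE s : 'X_[word_mnm s] = \prod_(c <- s) cellv c.
Proof.
rewrite /word_mnm; elim: s => [|c s IH]; first by rewrite !big_nil mpolyX0.
by rewrite !big_cons !mpolyXD IH.
Qed.

Lemma word_mnm_row s (i : 'I_n) : word_mnm s (lshift m i) = count (fun c : cell => row c == i) s.
Proof.
rewrite /word_mnm; elim: s => [|c s IH]; first by rewrite big_nil mnm0E.
by rewrite big_cons !mnmDE IH !mnm1E /= (inj_eq (@lshift_inj _ _)) eq_rlshift addn0.
Qed.

Lemma word_mnm_col s (j : 'I_m) : word_mnm s (rshift n j) = count (fun c : cell => col c == j) s.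
Proof.
rewrite /word_mnm; elim: s => [|c s IH]; first by rewrite big_nil mnm0E.
by rewrite big_cons !mnmDE IH !mnm1E /= (inj_eq (@rshift_inj _ _)) eq_lrshift add0n.
Qed.

Lemma word_mnm_perm s s' : antichain s -> antichain s' -> word_mnm s = word_mnm s' -> perm_eq s s'.
Proof.
move=> as_ as' E; apply: antichain_perm => // i.
  case: (ltnP i n) => iN; last first.
    by rewrite !(eq_count (a2 := pred0)) ?count_pred0 // => c; apply/negbTE/eqP => ci; have := row_lt c; rewrite ci ltnNge iN.
  by rewrite -!(word_mnm_row _ (Ordinal iN)) E.
case: (ltnP i m) => iN; last first.
  by rewrite !(eq_count (a2 := pred0)) ?count_pred0 // => c; apply/negbTE/eqP => ci; have := col_lt c; rewrite ci ltnNge iN.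
by rewrite -!(word_mnm_col _ (Ordinal iN)) E.
Qed.

(** Each pair is read in two ways: as a product of diagonals and chain cells, and as a monomial on
    the lattice path of the chain. Exponents are capped by [d] to keep the set finite. *)
Definition chain_pairs (d : nat) : {set {set cell} * {ffun 'I_ncolors -> 'I_d.+1}} :=
  [set p : {set cell} * {ffun 'I_ncolors -> 'I_d.+1} | strict_chain p.1 && (#|p.1| + \sum_e p.2 e == d)%N].

(** Path words have no north-west pair, so their monomials determine them, and their support
    determines the chain. This bounds the dimension of [F_d] from below by the number of pairs. *)
Lemma chain_pairs_monomials d : exists mm : {set cell} * {ffun 'I_ncolors -> 'I_d.+1} -> 'X_{1.. n + m},
  {in chain_pairs d &, injective mm} /\ forall p, p \in chain_pairs d -> Fgen d 'X_[mm p].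
Proof.
have [pc pcP] := path_cellP lam_n0 lam_sorted lam_pos.
exists (fun p : {set cell} * {ffun 'I_ncolors -> 'I_d.+1} =>
  word_mnm (path_word pc p.1 (fun e => p.2 e))); split.
  move=> [S a] [S' a']; rewrite !inE /= => /andP[Sc _] /andP[Sc' _].
  move/(word_mnm_perm (path_word_antichain pcP Sc) (path_word_antichain pcP Sc')) => E.
  have SS' : S = S'.
    apply/eqP; rewrite eqEsubset.
    rewrite (path_word_sub pcP Sc' Sc (a := fun e => a' e) (a' := fun e => a e)) => [|c]; last first.
      by rewrite (perm_mem E).
    by rewrite (path_word_sub pcP Sc Sc' (a := fun e => a e) (a' := fun e => a' e)) // => c;
      rewrite (perm_mem E).
  subst S'; congr (_, _); apply/ffunP => e; apply: val_inj => /=.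
  have := permP E (pred1 (pc S e)).
  have [_ ce _ _] := pcP S e Sc.
  have oe : Ordinal (color_lt (pc S e)) = e by apply: val_inj.
  by rewrite !(count_path_word pcP) // oe eqxx => /addnI.
move=> [S a]; rewrite inE /= => /andP[Sc /eqP Sd].
exists (path_word pc S (fun e => a e)); split; last exact: word_mnmE.
  rewrite size_cat -cardE size_flatten /shape -map_comp sumnE big_map big_enum -[RHS]Sd.
  by congr (_ + _)%N; apply: eq_bigr => e _ /=; rewrite size_nseq.
apply/allP => c /mem_path_word[cS|[e ->]].
  by case/strict_chainP: Sc => /(_ c cS)[].
by have [] := pcP S e Sc.
Qed.

(** The cap [h] on the chain length is separate from the degree [d]: the lower bound comes from
    [h = s] in degree [s + 1], where the pairs with a chain of length [s + 1] are lost. *)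
Definition chainmon (I : finType) (v : I -> A) (h d : nat) (p : A) : Prop :=
  exists S (a : I -> nat), [/\ strict_chain S, (#|S| <= h)%N, (#|S| + \sum_e a e)%N = d &
    p = (\prod_e v e ^+ a e) * \prod_(c in S) cellv c].

(** The flag covers two cases in one predicate, so that openness is shown once: generation by [v]
    and strict chains, and, with [false], the reduction condition that [v] alone generates degree
    [k]. *)
Definition genby (chains : bool) (I : finType) (v : I -> A) (k : nat) : Prop := forall b, Fgen k b ->
  span (fun p => (0 < k)%N /\ mulgen v k.-1 p \/ chains /\ chaingen k p) b.

Lemma chainmon_mul (I : finType) (v : I -> A) (h d : nat) e p :
  chainmon v h d p -> chainmon v h d.+1 (v e * p).
Proof.
move=> [S [a [Sc Sh Sd ->]]]; exists S, (fun f => (f == e) + a f)%N; split=> //.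
  by rewrite big_split /= -big_mkcond /= big_pred1_eq -Sd addnCA add1n.
rewrite mulrA; congr (_ * _); under [RHS]eq_bigr do rewrite exprD.
rewrite big_split /=; congr (_ * _); rewrite (bigD1 e) //= eqxx expr1 big1 ?mulr1 // => f /negbTE ->.
by rewrite expr0.
Qed.

Lemma genby_span (I : finType) (v : I -> A) (d : nat) :
  (forall k, (k <= d)%N -> genby true v k) -> forall b, Fgen d b -> span (chainmon v d d) b.
Proof.
move=> vd; have chain k p : chaingen k p -> span (chainmon v k k) p.
  move=> [S [Sc Sk ->]]; apply: span_mem; exists S, (fun=> 0%N); split=> //.
  - by rewrite Sk.
  - by rewrite big1 ?addn0.
  by rewrite (big1 _ _ _ (fun e _ => expr0 (v e))) mul1r.
elim: d vd => [|d IH] vk b Fb; have := vk _ (leqnn _) b Fb; apply: span_sub => p [[d0]|[_]] //; try exact: chain.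
move=> [e [b' [Fb' ->]]].
have : span (chainmon v d d) b' by apply: IH => // k kd; apply/vk/ltnW.
elim=> [|a u w Vu _ IHw]; first by rewrite mulr0; exact: span0.
rewrite mulrDr -scalerAr; apply: spanZD => //.
have [S [a' [Sc Sh Sd ->]]] := chainmon_mul e Vu.
by exists S, a'; split=> //; exact: leqW.
Qed.

Lemma genby_diag k : genby true (fun e : 'I_ncolors => diag e) k.
Proof.
move=> b [s [<- sl ->]]; apply: span_sub (straightening lam_sorted varx vary sl) => p H.
by apply: span_mem; case: H; [left|right].
Qed.

Lemma Fgen_split d e b : Fgen (d + e) b -> exists b1 b2, [/\ Fgen d b1, Fgen e b2 & b = b1 * b2].
Proof.
move=> [s [sz sl ->]]; exists (\prod_(c <- take d s) cellv c), (\prod_(c <- drop d s) cellv c).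
move: sl; rewrite -{1}(cat_take_drop d s) all_cat => /andP[s1 s2]; split.
- by exists (take d s); split=> //; rewrite size_takel // sz leq_addr.
- by exists (drop d s); split=> //; rewrite size_drop sz addKn.
- by rewrite -big_cat cat_take_drop.
Qed.

Lemma Fgen_mul d e b1 b2 : Fgen d b1 -> Fgen e b2 -> Fgen (d + e) (b1 * b2).
Proof.
move=> [s1 [<- l1 ->]] [s2 [<- l2 ->]]; exists (s1 ++ s2).
by rewrite size_cat all_cat l1 l2 big_cat.
Qed.

Lemma mulgen_up (I : finType) (v : I -> A) r d :
  (forall b, Fgen r.+1 b -> span (mulgen v r) b) -> (r <= d)%N ->
  forall b, Fgen d.+1 b -> span (mulgen v d) b.
Proof.
move=> vr rd b; rewrite -(subnKC rd) -addSn => /Fgen_split[b1 [b2 [F1 F2 ->]]].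
have := vr b1 F1; elim=> [|a u w [e [b' [Fb' ->]]] _ IH]; first by rewrite mul0r; exact: span0.
rewrite mulrDl -scalerAl; apply: spanZD => //; exists e, (b' * b2); split; last by rewrite mulrA.
exact: Fgen_mul.
Qed.

Definition words (k : nat) : finType := {t : k.-tuple cell | all (@in_lam lam) t}.
Definition wordv k (t : words k) : A := \prod_(c <- val t) cellv c.

Lemma Fgen_wordv k (t : words k) : Fgen k (wordv t).
Proof. by exists (val t); split=> //; [exact: size_tuple|exact: valP t]. Qed.

Lemma wordv_Fgen k b : Fgen k b -> exists t : words k, b = wordv t.
Proof.
move=> [s [sz sl ->]]; have tP : size s == k by apply/eqP.
by exists (exist _ (Tuple tP) sl).
Qed.

(** An instance of [span_open]: the products of the [v e] with words move along the line towards
    [w], the strict chains stay fixed, and the direction of motion lies in the span of the words of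
    degree [k]. *)
Lemma genby_open (chains : bool) (I : finType) (v w : I -> A) (k : nat) :
  (forall e, span (Fgen 1) (v e)) -> (forall e, span (Fgen 1) (w e)) -> genby chains v k ->
  exists2 p : {poly K}, p.[0] != 0 & forall t, p.[t] != 0 -> genby chains (fun e => v e + t *: (w e - v e)) k.
Proof.
move=> v1 w1; case: k => [|k] vk.
  exists 1; first by rewrite hornerC oner_neq0.
  move=> t _ b /vk; apply: span_sub => p [[]//|c].
  by apply: span_mem; right.
pose T : finType := ((I * words k) + {set cell})%type.
pose g0 (i : T) : A := match i with
  | inl (e, t) => v e * wordv t
  | inr Z => if [&& chains, strict_chain Z & #|Z| == k.+1] then \prod_(c in Z) cellv c else 0 end.
pose h (i : T) : A := match i with inl (e, t) => (w e - v e) * wordv t | inr _ => 0 end.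
have [||p p0 pP] := @span_open K A (words k.+1) T (@wordv k.+1) g0 h.
- move=> t; have := vk _ (Fgen_wordv t); apply: span_sub => q [[_ [e [b [/wordv_Fgen[u ->] ->]]]]|[ch [S [Sc Sk ->]]]].
    by apply: span_mem; exists (inl (e, u)).
  by apply: span_mem; exists (inr S); rewrite ?in_setT //= ch Sc Sk eqxx.
- case=> [[e t]|S] /=; last exact: span0.
  have : span (Fgen 1) (w e - v e) by exact: spanB.
  elim=> [|a u z Fu _ IH]; first by rewrite mul0r; exact: span0.
  rewrite mulrDl -scalerAl; apply: spanD => //; apply/spanZ/span_mem.
  have /wordv_Fgen[u' ->] : Fgen k.+1 (u * wordv t) by rewrite -[k.+1]add1n; exact: Fgen_mul Fu (Fgen_wordv t).
  by exists u'.
exists p => // t /pP {}pP b /wordv_Fgen[u ->].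
have := pP u; apply: span_sub => q [[[e y]|S] _ ->] /=.
  apply: span_mem; left; split=> //; exists e, (wordv y); split; first exact: Fgen_wordv.
  by rewrite [RHS]mulrDl -scalerAl.
rewrite scaler0 addr0; case: ifP => [/and3P[ch Sc /eqP Sk]|_]; last exact: span0.
by apply: span_mem; right; split=> //; exists S.
Qed.

End Monomials.

(** * Lower bound for reduction numbers *)

Section LowerBound.
Variable lam : seq nat.
Local Notation n := (nF lam).
Local Notation m := (lam1 lam).
Local Notation cell := (cell lam).
Local Notation ncolors := (ncolors lam).
Hypothesis lam_n0 : (0 < size lam)%N.
Hypothesis lam_sorted : sorted geq lam.
Hypothesis lam_pos : all (fun l => 0 < l)%N lam.
Variable K : fieldType.
Hypothesis K_infinite : infinite_field K.
Local Notation A := {mpoly K[n + m]}.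
Local Notation varx := (@varx lam K).
Local Notation vary := (@vary lam K).
Local Notation cellv := (cellv varx vary).
Local Notation diag := (diag varx vary).
Local Notation Fgen := (@Fgen lam K A varx vary).
Local Notation mulgen := (@mulgen lam K A varx vary _).
Local Notation chaingen := (@chaingen lam K A varx vary).
Local Notation chainmon := (@chainmon lam K 'I_ncolors).
Local Notation D := (fun e : 'I_ncolors => diag e).

Lemma diag_Fgen e : span (Fgen 1) (diag e).
Proof.
apply: span_sum => c /andP[cl _]; apply: span_mem; exists [:: c].
by rewrite /= cl big_seq1.
Qed.

Definition pair_val d (v : 'I_ncolors -> A) (p : {set cell} * {ffun 'I_ncolors -> 'I_d.+1}) : A :=
  (\prod_e v e ^+ p.2 e) * \prod_(c in p.1) cellv c.

Lemma chainmon_fam (v : 'I_ncolors -> A) h d p : chainmon v h d p ->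
  fam [set q in chain_pairs lam d | (#|q.1| <= h)%N] (pair_val v) p.
Proof.
move=> [S [a [Sc Sh Sd ->]]]; exists (S, [ffun e => inord (a e)]).
all: have ad e : (a e <= d)%N by rewrite -Sd (bigD1 e) //= addnCA leq_addr.
  rewrite !inE /= Sc Sh andbT -[X in _ == X]Sd; apply/eqP; congr (_ + _)%N.
  by apply: eq_bigr => e _; rewrite ffunE inordK ?ltnS.
by congr (_ * _); apply: eq_bigr => e _; rewrite ffunE inordK ?ltnS.
Qed.

(* For generic t the elements [diag e + t (w e - diag e)] inherit from the diagonals that F_k
   is generated by strict chains modulo them for k < s, and from w that F_s needs no chain;
   then F_s would be spanned by fewer elements than it has monomials. *)
Lemma reduction_lower (w : 'I_ncolors -> A) (r : nat) :
  (forall e, span (Fgen 1) (w e)) -> (forall b, Fgen r.+1 b -> span (mulgen w r) b) ->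
  (ferrers_rn lam <= r)%N.
Proof.
move=> w1 wr; rewrite leqNgt; apply/negP => rs.
have [s sE] : exists s, ferrers_rn lam = s.+1 by exists (ferrers_rn lam).-1; rewrite (ltn_predK rs).
(* As [r <= s], multiplying up carries the assumption from degree [r + 1] to degree [s + 1]. *)
have ws : genby false w s.+1.
  move=> b Fb; apply: (span_sub _ (mulgen_up wr _ Fb)); last by rewrite -ltnS -sE.
  by move=> p wp; apply: span_mem; left.
have [P P0 Pv] : exists2 P : nat -> {poly K}, (forall k, (P k).[0] != 0) &
    forall k t, (P k).[t] != 0 -> genby true (fun e => D e + t *: (w e - D e)) k.
  suff /boolp.choice[P PP] : forall k, exists p : {poly K}, p.[0] != 0 /\
      forall t, p.[t] != 0 -> genby true (fun e => D e + t *: (w e - D e)) k.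
    by exists P => k; have [] := PP k.
  move=> k; have [p p0 pP] := genby_open (fun e : 'I_ncolors => diag_Fgen e) w1 (genby_diag lam_sorted (K:=K) (k:=k)).
  by exists p.
have [Q Q0 Qv] := genby_open w1 (fun e : 'I_ncolors => diag_Fgen e) ws.
(* [Q] uses the parameter of the line starting at [w]; [t -> 1 - t] converts it to the line starting
   at the diagonals. *)
pose Q' := Q \Po (1 - 'X).
have Q'0 : Q' != 0.
  by apply: contraNneq Q0 => Q'0; have := congr1 (horner^~ 1) Q'0; rewrite /Q' horner_comp !hornerE subrr => ->.
have PN0 k : P k != 0 by apply: contraNneq (P0 k) => ->; rewrite horner0.
have : \prod_(k < s.+1) P k * Q' != 0.
  by rewrite mulf_neq0 //; apply/prodf_neq0 => k _.
case/(infinite_nonroot K_infinite) => t.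
rewrite hornerM mulf_eq0 negb_or horner_prod => /andP[/prodf_neq0 Pt Qt].
pose v e := D e + t *: (w e - D e).
have vk k : (k <= s)%N -> genby true v k.
  by move=> ks; apply: Pv; apply: (Pt (Ordinal (ks : (k < s.+1)%N))).
have vs : genby false v s.+1.
  have := Qv (1 - t); rewrite /Q' horner_comp !hornerE in Qt => /(_ Qt).
  suff -> : (fun e => w e + (1 - t) *: (D e - w e)) = v by [].
  by apply: boolp.funext => e; rewrite /v scalerBl scale1r !scalerBr; ring.
pose B := [set p in chain_pairs lam s.+1 | (#|p.1| <= s)%N].
have [mm [mm_inj mmF]] := chain_pairs_monomials lam_n0 lam_sorted lam_pos K s.+1.
have : (#|chain_pairs lam s.+1| <= #|B|)%N.
  apply: (mpolyX_span_card (g := @pair_val s.+1 v) mm_inj) => p /mmF /vs.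
  apply: span_sub => q [[_ [e [b [Fb ->]]]]|[]//].
  have := genby_span vk Fb; elim=> [|a u z Vu _ IH]; first by rewrite mulr0; exact: span0.
  rewrite mulrDr -scalerAr; apply: spanZD => //.
  by exact: chainmon_fam (chainmon_mul e Vu).
apply/negP; rewrite -ltnNge; apply: proper_card; apply/properP; split.
  by apply/subsetP => p; rewrite inE => /andP[].
(* A longest chain, of length [s + 1] with all exponents zero, is a pair missing from [B]. *)
have [S Sc Ss] := strict_chain_exists lam_n0 lam_sorted lam_pos.
exists (S, [ffun=> ord0]).
all: rewrite !inE /= Sc Ss sE ?ltnn ?andbF //.
by rewrite big1 ?addn0 ?eqxx // => e _; rewrite ffunE.
Qed.
End LowerBound.

(** * Elimination of superfluous generators *)

Lemma card_compositions (p d : nat) : (0 < p)%N ->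
  #|[set a : {ffun 'I_p -> 'I_d.+1} | (\sum_i a i == d)%N]| = 'C(p.-1 + d, p.-1).
Proof.
case: p => // p _; rewrite -card_ord_partitions /=.
pose f (a : {ffun 'I_p.+1 -> 'I_d.+1}) := [tuple a i | i < p.+1].
have f_inj : injective f.
  by move=> a b /(congr1 (fun t i => tnth t i)) E; apply/ffunP => i;
    have := congr1 (fun g => g i) E; rewrite !tnth_mktuple.
rewrite -(card_imset _ f_inj); apply: eq_card => t; rewrite !inE.
have sumE a : (\sum_(i <- f a) i = \sum_i a i)%N.
  by rewrite big_tuple; apply: eq_bigr => i _; rewrite tnth_mktuple.
apply/imsetP/idP => [[a + ->]|td]; first by rewrite inE sumE.
exists [ffun i => tnth t i].
  by rewrite inE -[X in _ == X](eqP td) big_tuple; apply/eqP/eq_bigr => i _; rewrite ffunE.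
by apply: eq_from_tnth => i; rewrite tnth_mktuple ffunE.
Qed.

Lemma digits_inj (p b : nat) (a a' : 'I_p -> nat) :
  (forall i, a i < b)%N -> (forall i, a' i < b)%N ->
  (\sum_i a i * b ^ i)%N = (\sum_i a' i * b ^ i)%N -> a =1 a'.
Proof.
elim: p a a' => [|p IH] a a' ab a'b; first by move=> _ [].
have b0 : (0 < b)%N by apply: leq_ltn_trans (ab ord0).
have shift (c : 'I_p.+1 -> nat) : (\sum_i c i * b ^ i =
    c ord0 + (\sum_(i < p) c (lift ord0 i) * b ^ i) * b)%N.
  rewrite big_ord_recl expn0 muln1; congr (_ + _)%N; rewrite big_distrl /=.
  by apply: eq_bigr => i _; rewrite /bump /= add1n expnSr mulnA.
rewrite !shift => E.
have E0 : a ord0 = a' ord0.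
  have := congr1 (modn^~ b) E; rewrite /= !(addnC (_ ord0)) !modnMDl !modn_small //.
have : forall i, a (lift ord0 i) = a' (lift ord0 i).
  apply: IH => [i|i|]; rewrite ?ab ?a'b //.
  by move: E; rewrite E0 => /addnI /eqP; rewrite eqn_pmul2r // => /eqP.
move=> Es i; case: (unliftP ord0 i) => [j ->|->] //.
Qed.

(** For [d = H * l] the quotient of ['C(l + d, l)] by ['C(l.-1 + d, l.-1)] is [(l + d) / l], that is
    [H + 1]. *)
Lemma bin_growth (H l q : nat) : (0 < l <= q)%N ->
  (H * 'C(l.-1 + H * l, l.-1) < 'C(q + H * l, q))%N.
Proof.
move=> /andP[l0 lq]; set d := (H * l)%N.
have dC k : 'C(k + d, k) = 'C(k + d, d) by rewrite -(bin_sub (leq_addl k d)) addnK.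
rewrite !dC; apply: leq_trans (leq_bin2l d (leq_add lq (leqnn d))).
have := mul_bin_down (l + d) d; rewrite addnK.
have -> : (l + d).-1 = (l.-1 + d)%N by lia.
have -> : (l + d)%N = (H.+1 * l)%N by rewrite /d; lia.
rewrite [in LHS]mulnAC [RHS]mulnC => /eqP; rewrite eqn_pmul2r // => /eqP <-.
by rewrite ltn_pmul2r // bin_gt0 leq_addl.
Qed.

Section Elimination.
Variable lam : seq nat.
Local Notation n := (nF lam).
Local Notation m := (lam1 lam).
Local Notation cell := (cell lam).
Local Notation ncolors := (ncolors lam).
Hypothesis lam_n0 : (0 < size lam)%N.
Hypothesis lam_sorted : sorted geq lam.
Hypothesis lam_pos : all (fun l => 0 < l)%N lam.
Variable K : fieldType.
Hypothesis K_infinite : infinite_field K.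
Local Notation A := {mpoly K[n + m]}.
Local Notation varx := (@varx lam K).
Local Notation vary := (@vary lam K).
Local Notation Fgen := (@Fgen lam K A varx vary).
Local Notation mulgen := (@mulgen lam K A varx vary _).
Local Notation diag := (diag varx vary).
Local Notation D := (fun e : 'I_ncolors => diag e).

Lemma ncolors_gt0 : (0 < ncolors)%N.
Proof.
have : (0 < nth 0 lam 0)%N by exact: nth_lam_gt0.
by rewrite /ncolors /lam1 /nF; lia.
Qed.

Definition nchains := #|[set S : {set cell} | strict_chain S]|.

Lemma nchains_gt0 : (0 < nchains)%N.
Proof.
apply/card_gt0P; exists set0; rewrite inE; apply/strict_chainP.
by split=> [c|c d]; rewrite inE.
Qed.

(** Adding [#|S|] to the exponent of one fixed colour turns [(S, a)] injectively into a chain and a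
    monomial of degree exactly [d]. *)
Lemma card_chain_pairs d : (#|chain_pairs lam d| <= nchains * 'C(ncolors.-1 + d, ncolors.-1))%N.
Proof.
rewrite -(card_compositions _ ncolors_gt0) -cardsX.
pose o : 'I_ncolors := Ordinal ncolors_gt0.
pose f (p : {set cell} * {ffun 'I_ncolors -> 'I_d.+1}) :=
  (p.1, [ffun e => if e == o then inord (#|p.1| + p.2 e) else p.2 e : 'I_d.+1]).
have bound (S : {set cell}) (a : {ffun 'I_ncolors -> 'I_d.+1}) e :
    (#|S| + \sum_e a e == d -> #|S| + a e < d.+1)%N.
  move/eqP => E; have : (#|S| + a e <= #|S| + \sum_e a e)%N by rewrite leq_add2l (bigD1 e) //= leq_addr.
  by rewrite E ltnS.
rewrite -[X in (X <= _)%N](card_in_imset (f := f)); last first.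
  move=> [S a] [S' a']; rewrite !inE /= => /andP[_ Sa] /andP[_ Sa'] [] SS /ffunP E.
  rewrite -SS in Sa' E *; have Ba e := bound S a e Sa; have Ba' e := bound S a' e Sa'; congr (_, _); apply/ffunP => e; have := E e; rewrite !ffunE.
  case: (eqVneq e o) => [->|//] /(congr1 val); rewrite /= !inordK // => /addnI; exact: val_inj.
apply/subset_leq_card/subsetP => _ /imsetP[[S a] + ->]; rewrite !inE /= => /andP[-> Sd] /=.
rewrite -[X in _ == X](eqP Sd) (bigD1 o) //= ffunE eqxx inordK ?bound //.
rewrite [in X in _ == X](bigD1 o) //= -addnA; apply/eqP; congr (_ + (_ + _))%N.
by apply: eq_bigr => e /negbTE eo; rewrite ffunE eo.
Qed.

(* Congruence modulo the submodule generated by [v] is tracked together with the coefficient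
   of the power of the distinguished element [z]. *)
Section Congruence.
Variables (I : finType) (v : I -> A) (z : A).
Hypothesis z1 : span (Fgen 1) z.
Hypothesis v1 : forall i, span (Fgen 1) (v i).

Definition vmod (k : nat) := span (fun p => exists2 k', k = k'.+1 & mulgen v k' p).
Definition cgr (k : nat) (x : A) (g : K) := span (Fgen k) x /\ vmod k (x - g *: z ^+ k).

Lemma span_FgenM d e x y : span (Fgen d) x -> span (Fgen e) y -> span (Fgen (d + e)) (x * y).
Proof. by apply: span_mul => g h Fg Fh; apply/span_mem/Fgen_mul. Qed.

Lemma vmodM k e x y : vmod k x -> span (Fgen e) y -> vmod (k + e) (x * y).
Proof.
apply: span_mul => g h [k' -> [i [b [Fb ->]]]] Fh; apply: span_mem; exists (k' + e)%N; first by rewrite addSn.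
by exists i, (b * h); rewrite mulrA; split=> //; exact: Fgen_mul.
Qed.

Lemma span_Fgen1 : span (Fgen 0) 1.
Proof. by apply: span_mem; exists [::]; rewrite big_nil. Qed.

Lemma span_FgenX d x k : span (Fgen d) x -> span (Fgen (k * d)) (x ^+ k).
Proof.
move=> Fx; elim: k => [|k IH]; first by rewrite expr0; exact: span_Fgen1.
by rewrite exprS mulSn; exact: span_FgenM.
Qed.

Lemma cgr1 : cgr 0 1 1.
Proof. by split; [exact: span_Fgen1|rewrite expr0 scale1r subrr; exact: span0]. Qed.

Lemma cgrM k k' x x' g g' : cgr k x g -> cgr k' x' g' -> cgr (k + k') (x * x') (g * g').
Proof.
move=> [Fx Zx] [Fx' Zx']; split; first exact: span_FgenM.
have -> : x * x' - (g * g') *: z ^+ (k + k') =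
    (x - g *: z ^+ k) * x' + (x' - g' *: z ^+ k') * (g *: z ^+ k).
  rewrite exprD -!mul_mpolyC rmorphM /=; ring.
apply: spanD; first exact: vmodM.
rewrite (addnC k); apply: vmodM => //; apply: spanZ; rewrite -[X in Fgen X]muln1.
exact: span_FgenX.
Qed.

Lemma cgrX k x g a : cgr k x g -> cgr (a * k) (x ^+ a) (g ^+ a).
Proof.
move=> xg; elim: a => [|a IH]; first exact: cgr1.
by rewrite !exprS mulSn; exact: cgrM.
Qed.

Lemma cgr_prod (J : finType) (w : J -> A) (g : J -> K) (a : J -> nat) :
  (forall j, cgr 1 (w j) (g j)) ->
  cgr (\sum_j a j)%N (\prod_j w j ^+ a j) (\prod_j g j ^+ a j).
Proof.
move=> wg; rewrite (_ : (\sum_j a j)%N = (\sum_j a j * 1)%N); last first.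
  by apply: eq_bigr => j _; rewrite muln1.
elim: (index_enum J) => [|j r IH]; first by rewrite !big_nil; exact: cgr1.
by rewrite !big_cons; apply: cgrM => //; exact: cgrX.
Qed.

End Congruence.

(** Noether normalization. The dimension of [F_d] grows too slowly for [q + 1] independent forms, so
    for the [d] of [bin_growth] the products of degree [d] in the [v j] are linearly dependent. At a
    point where this relation does not vanish, subtracting suitable multiples of [v ord0] from the
    other forms puts a power of [v ord0] in what they generate. *)
Lemma reduce_step (q : nat) (v : 'I_q.+1 -> A) (r : nat) : (ncolors <= q)%N ->
  (forall e, span (Fgen 1) (v e)) -> (forall b, Fgen r.+1 b -> span (mulgen v r) b) ->
  exists (v' : 'I_q -> A) r', (forall e, span (fam setT v) (v' e)) /\
    forall b, Fgen r'.+1 b -> span (mulgen v' r') b.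
Proof.
move=> lq v1 vr; pose d := (nchains * ncolors)%N.
have d0 : (0 < d)%N by rewrite muln_gt0 nchains_gt0 ncolors_gt0.
pose T := [set a : {ffun 'I_q.+1 -> 'I_d.+1} | (\sum_i a i == d)%N].
pose V (a : {ffun 'I_q.+1 -> 'I_d.+1}) := \prod_j v j ^+ a j.
have ltT : (#|chain_pairs lam d| < #|T|)%N.
  apply: leq_ltn_trans (card_chain_pairs d) _; rewrite card_compositions //=.
  by apply: bin_growth; rewrite ncolors_gt0.
have V_span a : a \in T -> span (fam (chain_pairs lam d) (@pair_val lam K d D)) (V a).
  rewrite inE => /eqP ad.
  have : span (Fgen d) (V a).
    rewrite -ad /V; elim: (index_enum _) => [|j s IH]; first by rewrite !big_nil; exact: span_Fgen1.
    rewrite !big_cons; apply: span_FgenM => //; rewrite -[X in Fgen X]muln1.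
    exact: span_FgenX.
  apply: span_sub => b Fb.
  have := genby_span (fun k _ => genby_diag lam_sorted (k:=k)) Fb; apply: span_sub => p.
  by case/chainmon_fam => x; rewrite inE => /andP[xd _] ->; apply: span_mem; exists x.
have [co [a0 a0T co0] coV] := span_dependent V_span ltT.
(* Kronecker substitution [c i = t ^ (d.+1 ^ i)]: distinct monomials go to distinct powers of [t],
   so the relation stays nonzero in one variable. *)
pose kap (a : {ffun 'I_q.+1 -> 'I_d.+1}) := (\sum_i a i * d.+1 ^ i)%N.
have kap_inj : injective kap.
  move=> a b E; apply/ffunP => i; apply: val_inj; move: i.
  by apply: (@digits_inj _ d.+1) => // i; exact: ltn_ord.
pose P : {poly K} := \sum_(a in T) co a *: 'X^(kap a).
have P0 : P != 0.
  apply: contraNneq co0 => /(congr1 (fun p : {poly K} => p`_(kap a0))).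
  rewrite coef0 coef_sum (bigD1 a0) //= coefZ coefXn eqxx mulr1 big1 ?addr0 => [->//|a /andP[_ aa0]].
  by rewrite coefZ coefXn (inj_eq kap_inj) eq_sym (negbTE aa0) mulr0.
have [t tP] := infinite_nonroot K_infinite P0.
pose c (i : 'I_q.+1) := t ^+ (d.+1 ^ i).
have Pt : P.[t] = \sum_(a in T) co a * \prod_j c j ^+ a j.
  rewrite /P horner_sum; apply: eq_bigr => a _; rewrite hornerZ hornerXn; congr (_ * _).
  by rewrite /kap expr_sum; apply: eq_bigr => j _; rewrite /c -exprM mulnC.
(* Since [d] is positive, every monomial of the relation vanishes at [t = 0]; so a nonroot is
   invertible and division by [c ord0] makes sense. *)
have t0 : t != 0.
  apply: contraNneq tP => t0; rewrite Pt big1 // => a; rewrite inE => /eqP ad.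
  have [j aj] : exists j, (0 < a j)%N.
    have : (0 < \sum_i a i)%N by rewrite ad.
    rewrite lt0n sum_nat_eq0 negb_forall => /existsP[j]; rewrite negb_imply -lt0n => /andP[_ aj].
    by exists j.
  have cj0 : c j = 0 by rewrite /c t0 expr0n expn_eq0.
  by rewrite (bigD1 j) //= cj0 expr0n (gtn_eqF aj) mul0r mulr0.
have c00 : c ord0 != 0 by rewrite expf_neq0.
pose v' (i : 'I_q) := v (lift ord0 i) - (c (lift ord0 i) / c ord0) *: v ord0.
have v'v i : span (fam setT v) (v' i).
  by apply: spanB; [|apply: spanZ]; apply: span_mem; eexists.
have v'1 i : span (Fgen 1) (v' i).
  by apply: span_sub (v'v i) => _ [e _ ->].
have cv j : cgr v' (v ord0) 1 (v j) (c j / c ord0).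
  split=> //; rewrite expr1; case: (unliftP ord0 j) => [i ->|->]; last first.
    by rewrite divff // scale1r subrr; exact: span0.
  apply: span_mem; exists 0%N => //; exists i, 1; rewrite mulr1; split=> //.
  by exists [::]; rewrite big_nil.
(* Modulo [v'] each [v j] is [c j / c ord0] times [v ord0], so the relation reads [P.[t] / c ord0 ^+
   d] times [v ord0 ^+ d], with a nonzero scalar. *)
have z_vmod : vmod v' d (v ord0 ^+ d).
  have : vmod v' d (\sum_(a in T) co a *: (V a - (\prod_j (c j / c ord0) ^+ a j) *: v ord0 ^+ d)).
    apply: span_sum => a; rewrite inE => /eqP ad; apply: spanZ.
    by have [_] := cgr_prod (v1 ord0) (fun e => a e) cv; rewrite ad.
  under eq_bigr do rewrite scalerBr scalerA.
  rewrite sumrB coV sub0r -scaler_suml => /spanN; rewrite opprK.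
  set g := \sum_(a in T) _; have gE : g = P.[t] / c ord0 ^+ d.
    rewrite Pt mulr_suml; apply: eq_bigr => a; rewrite inE => /eqP ad; rewrite -mulrA; congr (_ * _).
    under eq_bigr do rewrite expr_div_n; rewrite big_split /=; congr (_ * _).
    have -> : c ord0 ^+ d = c ord0 ^+ (\sum_i a i) by rewrite ad.
    by rewrite expr_sum prodfV.
  have g0 : g != 0 by rewrite gE mulf_neq0 ?invr_eq0 ?expf_neq0.
  by move=> /(spanZ g^-1); rewrite scalerA mulVf // scale1r.
(* Splitting off [d] factors [v e] from degree [d + r] leaves a product congruent to a multiple of
   [v ord0 ^+ d], hence to 0 modulo [v']. *)
have iter k b : Fgen (k + r) b -> span (fun p => exists x g b',
    [/\ cgr v' (v ord0) k x g, Fgen r b' & p = x * b']) b.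
  elim: k b => [|k IH] b Fb.
    by apply: span_mem; exists 1, 1, b; rewrite mul1r; split=> //; exact: cgr1.
  have := mulgen_up vr (leq_addl k r) Fb; apply: span_sub => _ [e [b'' [Fb'' ->]]].
  have := IH _ Fb''; elim=> [|a u w [x [g [b' [xg Fb' ->]]]] _ IHw]; first by rewrite mulr0; exact: span0.
  rewrite mulrDr -scalerAr; apply: spanZD => //.
  exists (v e * x), (c e / c ord0 * g), b'; split=> //; last by rewrite mulrA.
  by rewrite -[k.+1]add1n; apply: cgrM.
exists v', (d + r).-1; split=> // b; rewrite prednK ?addn_gt0 ?d0 // => /iter.
apply: span_sub => _ [x [g [b' [[Fx Zx] Fb' ->]]]].
have Zx' : vmod v' d x.
  by rewrite -(subrK (g *: v ord0 ^+ d) x); apply: spanD => //; exact: spanZ.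
have := vmodM Zx' (span_mem Fb'); apply: span_sub => p [k' kE vp]; apply: span_mem.
by rewrite kE.
Qed.

Lemma reduce_gens (p : nat) (v : 'I_p -> A) (r : nat) :
  (forall e, span (Fgen 1) (v e)) -> (forall b, Fgen r.+1 b -> span (mulgen v r) b) ->
  exists (w : 'I_ncolors -> A) r', (forall e, span (fam setT v) (w e)) /\
    forall b, Fgen r'.+1 b -> span (mulgen w r') b.
Proof.
elim: p v r => [|q IH] v r v1 vr.
  exists (fun=> 0), r; split=> [_|b /vr]; first exact: span0.
  by apply: span_sub => y [[]].
case: (ltnP q ncolors) => lq.
  (* At most [ncolors] generators remain, and zeros pad the family. *)
  exists (fun e => odflt 0 (omap v (insub (e : nat)))), r; split=> [e|b /vr].
    by case: insubP => [i _ _|_] /=; [apply: span_mem; exists i|exact: span0].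
  apply: span_sub => _ [e [b' [Fb' ->]]]; apply: span_mem.
  by exists (widen_ord lq e), b'; split=> //; rewrite /= valK.
have [v' [r' [v'v v'r]]] := reduce_step lq v1 vr.
have v'1 e : span (Fgen 1) (v' e).
  by apply: span_sub (v'v e) => _ [i _ ->].
have [w [r'' [wv' wr]]] := IH v' r' v'1 v'r.
exists w, r''; split=> // e; apply: span_sub (wv' e) => _ [i _ ->]; exact: v'v.
Qed.

End Elimination.

(** * Ideals and leading forms *)

Section IdealGen.
Variable R : comNzRingType.
Implicit Types (G H I J : R -> Prop).

Inductive igen G : R -> Prop :=
| igen0 : igen G 0
| igenMD r x y : G x -> igen G y -> igen G (r * x + y).

Lemma igen_mem G x : G x -> igen G x.
Proof. by move=> Gx; rewrite -[x]mul1r -[_ * _]addr0; apply: igenMD=> //; exact: igen0. Qed.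

Lemma igen_ideal G : is_ideal (igen G).
Proof.
split; first exact: igen0.
- move=> a b; elim=> [|r x y Gx _ IH] Gb; first by rewrite add0r.
  by rewrite -addrA; apply: igenMD=> //; exact: IH.
- move=> r a; elim=> [|s x y Gx _ IH]; first by rewrite mulr0; exact: igen0.
  by rewrite mulrDr mulrA; apply: igenMD.
Qed.

Lemma igen_min G J : is_ideal J -> (forall x, G x -> J x) -> forall x, igen G x -> J x.
Proof. by move=> [J0 JD JM] GJ x; elim=> [//|r u v Gu _ IH]; apply: JD => //; apply/JM/GJ. Qed.

Lemma ideal_sum J (T : eqType) (r : seq T) (F : T -> R) :
  is_ideal J -> (forall i, i \in r -> J (F i)) -> J (\sum_(i <- r) F i).
Proof.
move=> [J0 JD _] JF; rewrite big_seq; elim/big_rec: _ => // i x ir Jx; apply: JD => //; exact: JF.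
Qed.

Lemma ideal_opp J x : is_ideal J -> J x -> J (- x).
Proof. by move=> [_ _ JM] Jx; rewrite -mulN1r; exact: JM. Qed.

Lemma gen_idealP (gs : seq R) f : gen_ideal gs f <-> igen (fun p => p \in gs) f.
Proof.
split=> [[cs ->]|].
  apply: ideal_sum; first exact: igen_ideal.
  move=> i _; have [_ _ JM] := igen_ideal (fun p => p \in gs).
  by apply: JM; apply: igen_mem; exact: mem_nth.
elim=> [|r x y xgs _ [cs ->]].
  by exists [::]; rewrite big1 // => i _; rewrite nth_nil mul0r.
have xi : (index x gs < size gs)%N by rewrite index_mem.
exists (mkseq (fun i => (if i == index x gs then r else 0) + cs`_i) (size gs)).
under [RHS]eq_bigr => i _ do rewrite nth_mkseq // mulrDl.
rewrite big_split /=; congr (_ + _).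
rewrite (bigD1 (Ordinal xi)) //= eqxx nth_index // big1 ?addr0 // => i.
by rewrite -(inj_eq val_inj) /= => /negbTE ->; rewrite mul0r.
Qed.

Lemma ideal_mul_ideal I J : is_ideal I -> is_ideal (ideal_mul I J).
Proof.
move=> [I0 ID IM]; split.
- by exists [::]; rewrite big_nil.
- move=> a b [s [sP ->]] [t [tP ->]]; exists (s ++ t); rewrite big_cat; split=> // p.
  by rewrite mem_cat => /orP[/sP|/tP].
- move=> r a [s [sP ->]]; exists [seq (r * p.1, p.2) | p <- s]; split.
    by move=> _ /mapP[p /sP[p1 p2] ->]; split=> //; exact: IM.
  by rewrite big_map mulr_sumr; apply: eq_bigr => p _; rewrite mulrA.
Qed.

Lemma ideal_mul_mem I J a b : I a -> J b -> ideal_mul I J (a * b).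
Proof. by move=> Ia Jb; exists [:: (a, b)]; rewrite big_seq1; split=> // p; rewrite inE => /eqP ->. Qed.

Lemma ideal_mul_min I J H : is_ideal H -> (forall a b, I a -> J b -> H (a * b)) ->
  forall x, ideal_mul I J x -> H x.
Proof. by move=> HH IJ _ [s [sP ->]]; apply: ideal_sum => // p /sP[p1 p2]; exact: IJ. Qed.

Lemma ideal_pow_ideal I r : is_ideal I -> is_ideal (ideal_pow I r).
Proof. by case: r => [|r] II //=; elim: r => [|r IH]; apply: ideal_mul_ideal. Qed.

Lemma ideal_mul_pow_sub I J r : is_ideal I -> ideal_sub J I -> ideal_sub (ideal_mul J (ideal_pow I r)) (ideal_pow I r.+1).
Proof.
move=> II JI; apply: ideal_mul_min; first exact: ideal_pow_ideal.
by move=> a b Ja Ib; rewrite mulrC; apply: ideal_mul_mem => //; exact: JI.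
Qed.

Lemma reduction_up I J r d : is_ideal I -> is_ideal J -> ideal_sub J I ->
  reduction_at J I r -> (r <= d)%N -> reduction_at J I d.
Proof.
move=> II IJ JI Jr; elim: d => [|d IH]; first by rewrite leqn0 => /eqP <-.
rewrite leq_eqVlt => /orP[/eqP <- //|/IH {}IH] f; split; last exact: ideal_mul_pow_sub.
apply: ideal_mul_min; first exact: ideal_mul_ideal.
move=> a b /IH Ja Ib; move: a Ja; apply: (@ideal_mul_min _ _ (fun a => ideal_mul J (ideal_pow I d.+1) (a * b))).
  have [J0 JD JM] := ideal_mul_ideal (ideal_pow I d.+1) IJ; split.
  - by rewrite mul0r.
  - by move=> a a' H H'; rewrite mulrDl; exact: JD.
  - by move=> r' a H; rewrite -mulrA; exact: JM.
by move=> a a' Ja Ia'; rewrite -mulrA; apply: ideal_mul_mem => //; exact: ideal_mul_mem.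
Qed.

End IdealGen.

Section Leads.
Variable lam : seq nat.
Local Notation n := (nF lam).
Local Notation m := (lam1 lam).
Local Notation cell := (cell lam).
Local Notation ncolors := (ncolors lam).
Variable K : fieldType.
Local Notation A := {mpoly K[n + m]}.
Local Notation varx := (@varx lam K).
Local Notation vary := (@vary lam K).
Local Notation Fgen := (@Fgen lam K A varx vary).
Local Notation mulgen := (@mulgen lam K A varx vary _).
Local Notation diag := (diag varx vary).

(** For [f] in [I^d], generated in degree [2d], this component represents the class of [f] in the
    fibre ring, [I^d] modulo [m I^d] with [m] the irrelevant ideal. *)
Definition lead (d : nat) (f : A) : A := pihomog mdeg (d + d) f.

Lemma leadD d f g : lead d (f + g) = lead d f + lead d g.
Proof. exact: raddfD. Qed.

Lemma lead0 d : lead d 0 = 0.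
Proof. exact: raddf0. Qed.

Lemma word_mnm_deg (s : seq cell) : mdeg (word_mnm s) = (size s + size s)%N.
Proof.
rewrite /word_mnm; elim: s => [|c s IH]; first by rewrite big_nil mdeg0.
by rewrite big_cons !mdegD !mdeg1 IH /=; lia.
Qed.

Lemma lead_mulX d r b : Fgen d b -> lead d (r * b) = r@_0%MM *: b.
Proof.
move=> [s [sd _ ->]]; rewrite -word_mnmE /lead {1}(mpolyE r) mulr_suml raddf_sum /=.
transitivity (\sum_(k <- msupp r) (if k == 0%MM then r@_0%MM *: 'X_[word_mnm s] else 0 : A)).
  apply: eq_bigr => k _; rewrite -scalerAl -mpolyXD linearZ /= pihomogX -[X in X == _]/(mdeg (k + word_mnm s)%MM) mdegD word_mnm_deg sd.
  rewrite -[X in _ == X]add0n eqn_add2r mdeg_eq0; case: eqP => [->|_]; last by rewrite scaler0.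
  by rewrite add0m.
case: (boolP (0%MM \in msupp r)) => r0.
  rewrite (bigD1_seq (0%MM : 'X_{1.. n + m})) ?msupp_uniq //= eqxx big1 ?addr0 // => k /negbTE -> //.
rewrite big_seq big1 => [|k]; first by rewrite (memN_msupp_eq0 r0) scale0r.
by case: eqP => [->|//]; rewrite (negbTE r0).
Qed.

Lemma lead_span d f : igen (Fgen d) f -> span (Fgen d) (lead d f).
Proof.
elim=> [|r x y Fx _ IH]; first by rewrite lead0; exact: span0.
by rewrite leadD lead_mulX //; apply: spanZD.
Qed.

Lemma lead_mul d e f g : igen (Fgen d) f -> igen (Fgen e) g ->
  lead (d + e) (f * g) = lead d f * lead e g.
Proof.
move=> If Ig; elim: If => [|r x y Fx _ IH]; first by rewrite mul0r !lead0 mul0r.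
rewrite mulrDl !leadD mulrDl IH (lead_mulX r Fx); congr (_ + _).
elim: Ig => [|r' x' y' Fx' _ IH']; first by rewrite mulr0 !lead0 mulr0.
rewrite mulrDr !leadD mulrDr IH' (lead_mulX r' Fx'); congr (_ + _).
rewrite mulrACA lead_mulX; last exact: Fgen_mul.
by rewrite (rmorphM (mcoeff 0%MM)) /= -scalerAl -scalerAr scalerA.
Qed.

Lemma lead_Fgen d b : Fgen d b -> lead d b = b.
Proof. by move=> Fb; rewrite -{1}[b]mul1r lead_mulX // mcoeff1 eqxx scale1r. Qed.

Lemma igen_Fgen0 f : igen (Fgen 0) f.
Proof.
have [_ _ JM] := igen_ideal (Fgen 0); rewrite -[f]mulr1; apply/JM/igen_mem.
by exists [::]; rewrite big_nil.
Qed.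

Lemma lead_scale d r f : igen (Fgen d) f -> lead d (r * f) = r@_0%MM *: lead d f.
Proof.
move=> If; rewrite -[d in LHS]add0n lead_mul //; last exact: igen_Fgen0.
have -> : lead 0 r = (r@_0%MM)%:MP.
  have F1 : Fgen 0 1 by exists [::]; rewrite big_nil.
  by have := lead_mulX r F1; rewrite mulr1 -mul_mpolyC mulr1.
by rewrite mul_mpolyC.
Qed.

(** Generators of [m I^d]: the factor [a] has no constant term. *)
Definition mFgen d (p : A) : Prop := exists a b, [/\ a@_0%MM = 0, Fgen d b & p = a * b].

Lemma sub_lead d f : igen (Fgen d) f -> igen (mFgen d) (f - lead d f).
Proof.
elim=> [|r x y Fx _ IH]; first by rewrite lead0 subr0; exact: igen0.
rewrite leadD lead_mulX // opprD addrACA -mul_mpolyC -mulrBl -[_ * x]mul1r; apply: igenMD => //.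
by exists (r - (r@_0%MM)%:MP), x; rewrite mcoeffB mcoeffC eqxx mulr1 subrr.
Qed.

Section Powers.
Variable I : A -> Prop.
Hypothesis IE : forall f, I f <-> igen (Fgen 1) f.

Lemma I_ideal : is_ideal I.
Proof.
have [J0 JD JM] := igen_ideal (Fgen 1); split; first exact/IE.
- by move=> a b /IE Ia /IE Ib; apply/IE/JD.
- by move=> r a /IE Ia; apply/IE/JM.
Qed.

Lemma ideal_powE r f : ideal_pow I r f <-> igen (Fgen r) f.
Proof.
elim: r f => [|r IH] f; first by split=> // _; exact: igen_Fgen0.
split=> /=.
  apply: ideal_mul_min; first exact: igen_ideal.
  move=> a b /IH Ia /IE Ib; move: Ia; apply: (@igen_min _ _ (fun a => igen (Fgen r.+1) (a * b))).
    have [J0 JD JM] := igen_ideal (Fgen r.+1); split.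
    - by rewrite mul0r.
    - by move=> u v H H'; rewrite mulrDl; exact: JD.
    - by move=> u v H; rewrite -mulrA; exact: JM.
  move=> x Fx; move: Ib; apply: (@igen_min _ _ (fun b => igen (Fgen r.+1) (x * b))).
    have [J0 JD JM] := igen_ideal (Fgen r.+1); split.
    - by rewrite mulr0.
    - by move=> u v H H'; rewrite mulrDr; exact: JD.
    - by move=> u v H; rewrite mulrCA; exact: JM.
  by move=> y Fy; rewrite -addn1; apply/igen_mem/Fgen_mul.
apply: igen_min; first by apply/ideal_mul_ideal/ideal_pow_ideal/I_ideal.
move=> x; rewrite -addn1 => /Fgen_split[b1 [b2 [F1 F2 ->]]].
by apply: ideal_mul_mem; [apply/IH/igen_mem|apply/IE/igen_mem].
Qed.

Definition lead1 (J : A -> Prop) (p : A) : Prop := exists2 j, J j & p = lead 1 j.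
Definition mulset (L : A -> Prop) (r : nat) (p : A) : Prop :=
  exists v b, [/\ L v, Fgen r b & p = v * b].

(** Leading forms are multiplicative on powers of [I], so the equation [I^(r+1) = J I^r] passes to
    the fibre ring. *)
Lemma reduction_lead (J : A -> Prop) r : ideal_sub J I -> reduction_at J I r ->
  forall b, Fgen r.+1 b -> span (mulset (lead1 J) r) b.
Proof.
move=> JI Jr b Fb; have [s [sP bE]] := (Jr b).1 ((ideal_powE r.+1 b).2 (igen_mem Fb)).
rewrite -(lead_Fgen Fb) bE /lead raddf_sum; apply: span_sum_mem => p /sP[Jp Ip].
have := @lead_mul 1 r p.1 p.2 ((IE _).1 (JI _ Jp)) ((ideal_powE _ _).1 Ip).
rewrite add1n => E; suff : span (mulset (lead1 J) r) (lead r.+1 (p.1 * p.2)) by [].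
rewrite E.
have := lead_span ((ideal_powE _ _).1 Ip); elim=> [|a x y Fx _ IH]; first by rewrite mulr0; exact: span0.
rewrite mulrDr -scalerAr; apply: spanZD => //; exists (lead 1 p.1), x; split=> //.
by exists p.1.
Qed.

(** There are finitely many words of degree [r + 1], and each needs only finitely many elements of
    [L]. *)
Lemma mulset_finite (L : A -> Prop) r : (forall b, Fgen r.+1 b -> span (mulset L r) b) ->
  exists vs : seq A, (forall v, v \in vs -> L v) /\
    forall b, Fgen r.+1 b -> span (mulset (fun v => v \in vs) r) b.
Proof.
move=> LF.
have mono (u1 u2 : seq A) b : {subset u1 <= u2} ->
   span (mulset (fun v => v \in u1) r) b -> span (mulset (fun v => v \in u2) r) b.
  move=> u12; apply: span_sub => _ [v [c [vu Fc ->]]]; apply: span_mem; exists v, c; split=> //; exact: u12.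
have one b : span (mulset L r) b -> exists vs : seq A, (forall v, v \in vs -> L v) /\
    span (mulset (fun v => v \in vs) r) b.
  elim=> [|a _ y [v [c [Lv Fc ->]]] _ [vs [vsL vsy]]]; first by exists [::]; split=> //; exact: span0.
  exists (v :: vs); split=> [u|]; first by rewrite inE => /orP[/eqP ->|/vsL].
  apply: spanZD; first by exists v, c; rewrite mem_head.
  by apply: mono vsy => u uv; rewrite inE uv orbT.
have many (ws : seq (words lam r.+1)) : exists vs : seq A, (forall v, v \in vs -> L v) /\
    forall t, t \in ws -> span (mulset (fun v => v \in vs) r) (wordv K t).
  elim: ws => [|t ws [vs [vsL vsP]]]; first by exists [::].
  have [us [usL usP]] := one _ (LF _ (Fgen_wordv K t)).
  exists (us ++ vs); split=> [v|u].
    by rewrite mem_cat => /orP[/usL|/vsL].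
  rewrite inE => /orP[/eqP ->|/vsP uP].
    by apply: mono usP => v vu; rewrite mem_cat vu.
  by apply: mono uP => v vu; rewrite mem_cat vu orbT.
have [vs [vsL vsP]] := many (enum (words lam r.+1)).
exists vs; split=> // b /wordv_Fgen[t ->]; apply: vsP; exact: mem_enum.
Qed.

Section Numbers.
Hypothesis lam_n0 : (0 < size lam)%N.
Hypothesis lam_sorted : sorted geq lam.
Hypothesis lam_pos : all (fun l => 0 < l)%N lam.
Hypothesis K_infinite : infinite_field K.

Lemma reduction_lower_ideal (J : A -> Prop) (w : 'I_ncolors -> A) r :
  ideal_sub J I -> (forall e, span (Fgen 1) (w e)) ->
  (forall f, J f -> span (fam setT w) (lead 1 f)) ->
  reduction_at J I r -> (ferrers_rn lam <= r)%N.
Proof.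
move=> JI w1 Jw Jr; apply: (reduction_lower lam_n0 lam_sorted lam_pos K_infinite w1) => b Fb.
have := reduction_lead JI Jr Fb; apply: span_sub => _ [v [c [[j /Jw Jj ->] Fc ->]]].
elim: Jj => [|a x y [e _ ->] _ IH]; first by rewrite mul0r; exact: span0.
by rewrite mulrDl -scalerAl; apply: spanZD => //; exists e, c.
Qed.

Section Jlambda.
Variable J : A -> Prop.
Hypothesis JE : forall f, J f <-> igen (fun p => exists e : 'I_ncolors, p = diag e) f.

Lemma J_ideal : is_ideal J.
Proof.
have [J0 JD JM] := igen_ideal (fun p => exists e : 'I_ncolors, p = diag e); split; first exact/JE.
- by move=> a b /JE Ja /JE Jb; apply/JE/JD.
- by move=> r a /JE Ja; apply/JE/JM.
Qed.

Lemma span_igen d f : span (Fgen d) f -> igen (Fgen d) f.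
Proof.
elim=> [|a x y Fx _ IH]; first exact: igen0.
by rewrite -mul_mpolyC; apply: igenMD.
Qed.

Lemma J_sub : ideal_sub J I.
Proof.
move=> f /JE; apply: igen_min; first exact: I_ideal.
by move=> _ [e ->]; apply/IE/span_igen/diag_Fgen.
Qed.

Lemma J_reduction : reduction_at J I (ferrers_rn lam).
Proof.
move=> f; split; last by apply: ideal_mul_pow_sub; [exact: I_ideal|exact: J_sub].
move/ideal_powE; apply: igen_min; first exact: (ideal_mul_ideal _ J_ideal).
move=> b Fb; have [J0 JD JM] := ideal_mul_ideal (ideal_pow I (ferrers_rn lam)) J_ideal.
have := genby_diag lam_sorted Fb; elim=> [//|a p y [[_ [e [c [Fc ->]]]]|[_ [S [Sc Sk _]]]] _ IH]; last first.
  by have := strict_chain_card lam_n0 lam_sorted lam_pos Sc; rewrite Sk ltnn.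
rewrite -mul_mpolyC; apply/JD/IH/JM/ideal_mul_mem; last exact/ideal_powE/igen_mem.
by apply/JE/igen_mem; exists e.
Qed.

Lemma J_reduction_number : reduction_number_wrt J I (ferrers_rn lam).
Proof.
split; first exact: J_reduction.
move=> r; apply: (reduction_lower_ideal (w := fun e => diag e)) => [|e|f /JE].
- exact: J_sub.
- exact: diag_Fgen.
elim=> [|a _ y [e ->] _ IH]; first by rewrite lead0; exact: span0.
rewrite leadD lead_scale; last exact/span_igen/diag_Fgen.
have -> : lead 1 (diag e) = diag e.
  rewrite /diag /lead raddf_sum; apply: eq_bigr => c /andP[cl _]; apply: lead_Fgen.
  by exists [:: c]; rewrite /= cl big_seq1.
by apply: spanZD => //; exists e.
Qed.

End Jlambda.

(* If J is a reduction and the leading forms w_e span a reduction of the fibre ring, then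
   lifts of the w_e together with mJ still form a reduction; minimality forces equality. *)
Lemma minimal_reduction_lead (J : A -> Prop) : is_minimal_reduction J I ->
  exists w : 'I_ncolors -> A, (forall e, span (Fgen 1) (w e)) /\
    forall f, J f -> span (fam setT w) (lead 1 f).
Proof.
move=> [[IJ [JI [r Jr]]] Jmin].
have [vs [vsL vsP]] := mulset_finite (reduction_lead JI Jr).
pose v (i : 'I_(size vs)) := vs`_i.
have vL i : lead1 J (v i) by apply/vsL/mem_nth.
have v1 i : span (Fgen 1) (v i).
  by have [j /JI/IE Ij ->] := vL i; exact: lead_span.
have vr b : Fgen r.+1 b -> span (mulgen v r) b.
  move=> /vsP; apply: span_sub => _ [u [c [uvs Fc ->]]]; apply: span_mem.
  have ui : (index u vs < size vs)%N by rewrite index_mem.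
  by exists (Ordinal ui), c; rewrite /v /= nth_index.
have [w [rho [wv wr]]] := reduce_gens lam_n0 lam_sorted lam_pos K_infinite v1 vr.
have w1 e : span (Fgen 1) (w e) by apply: span_sub (wv e) => _ [i _ ->].
have [J0 JD JM] := IJ.
have /boolp.choice[j jP] : forall e, exists j, J j /\ w e = lead 1 j.
  move=> e; have := wv e; elim=> [|a _ y [i _ ->] _ [j' [Jj' ->]]]; first by exists 0; rewrite lead0.
  have [j Jj ->] := vL i; exists (a%:MP * j + j'); split; first by apply: JD => //; exact: JM.
  rewrite leadD lead_scale; first by rewrite mcoeffC eqxx mulr1.
  exact/IE/JI.
pose G p := (exists e, p = j e) \/ (exists a j', [/\ a@_0%MM = 0, J j' & p = a * j']).
have GJ p : G p -> J p.
  by move=> [[e ->]|[a [j' [_ Jj' ->]]]]; [have [] := jP e|exact: JM].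
have J'J : ideal_sub (igen G) J by apply: igen_min.
have J'I : ideal_sub (igen G) I by move=> f /J'J/JI.
exists w; split=> // f Jf.
have {Jf} : igen G f.
  apply: Jmin Jf => //; first exact: igen_ideal.
  split; first exact: igen_ideal.
  split=> //; exists (maxn r rho); set d := maxn r rho.
  have Jd : reduction_at J I d by apply: (reduction_up _ _ _ Jr) => //; [exact: I_ideal|exact: leq_maxl].
  have [P0 PD PM] := ideal_mul_ideal (ideal_pow I d) (igen_ideal G).
  move=> g; split; last by apply: ideal_mul_pow_sub => //; exact: I_ideal.
  move/ideal_powE; apply: igen_min; first exact: (ideal_mul_ideal _ (igen_ideal G)).
  move=> b Fb.
  (* Nakayama by hand: [b] agrees with some [h] of [J' I^d] up to [m I^(d+1)], which equals
     [m J I^d] and so lies in [J' I^d], because [J'] contains [m J]. *)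
  have [h [Ph hb]] : exists h, ideal_mul (igen G) (ideal_pow I d) h /\ lead d.+1 h = b.
    have := mulgen_up wr (leq_maxr r rho) Fb.
    elim=> [|a _ y [e [c [Fc ->]]] _ [h [Ph <-]]]; first by exists 0; rewrite lead0.
    exists (a%:MP * (j e * c) + h); split.
      apply/PD/Ph/PM/ideal_mul_mem; last exact/ideal_powE/igen_mem.
      by apply: igen_mem; left; exists e.
    have [Je ->] := jP e; rewrite leadD -add1n lead_scale.
      by rewrite mcoeffC eqxx mulr1 lead_mul ?(lead_Fgen Fc) //; [exact/IE/JI|exact: igen_mem].
    rewrite mulrC; have [_ _ IM] := igen_ideal (Fgen (1 + d)).
    apply/ideal_powE; rewrite add1n; apply: ideal_mul_mem; [exact/ideal_powE/igen_mem|exact: JI].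
  have Ih : igen (Fgen d.+1) h.
    by apply/ideal_powE; apply: (ideal_mul_pow_sub I_ideal J'I).
  rewrite -(subKr h b); apply: (PD) => //; apply: ideal_opp; first exact: (ideal_mul_ideal _ (igen_ideal G)).
  have := sub_lead Ih; rewrite hb; apply: igen_min; first exact: (ideal_mul_ideal _ (igen_ideal G)).
  move=> _ [a [c [a0 Fc ->]]].
  have := (Jd c).1 ((ideal_powE _ _).2 (igen_mem Fc)).
  apply: (@ideal_mul_min _ _ _ (fun c => ideal_mul (igen G) (ideal_pow I d) (a * c))).
    split; first by rewrite mulr0.
    - by move=> u u' H H'; rewrite mulrDr; exact: PD.
    - by move=> u u' H; rewrite mulrCA; exact: PM.
  move=> u u' Ju Iu'; rewrite mulrA; apply: ideal_mul_mem => //.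
  by apply: igen_mem; right; exists a, u.
elim=> [|a p y Gp _ IH]; first by rewrite lead0; exact: span0.
rewrite leadD lead_scale; last exact/IE/JI/GJ.
case: Gp => [[e ->]|[c [j' [c0 Jj' ->]]]].
  by have [_ <-] := jP e; apply: spanZD => //; exists e.
rewrite lead_scale ?c0 ?scale0r ?scaler0 ?add0r //; exact/IE/JI.
Qed.

End Numbers.
End Powers.
End Leads.

(** * Residue fields *)

Section ResidueField.
Import Quotient.
Local Open Scope quotient_scope.
Variable R : comNzRingType.

Lemma field_of_invertible (Q : comNzRingType) : (forall x : Q, x != 0 -> exists y, y * x = 1) ->
  exists (F : fieldType) (f : {rmorphism Q -> F}), injective f.
Proof.
move=> Qinv.
have /boolp.choice[inv0 inv0P] : forall x : Q, exists y, x != 0 -> y * x = 1.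
  move=> x; case: (boolP (x == 0)) => [_|/Qinv[y yx]]; first by exists 0.
  by exists y.
pose inv (x : Q) := if x == 0 then 0 else inv0 x.
have mulVf x : x != 0 -> inv x * x = 1 by rewrite /inv => x0; rewrite (negbTE x0) inv0P.
have inv00 : inv 0 = 0 by rewrite /inv eqxx.
pose varx := GRing.ComNzRing_isField.Build Q mulVf inv00.
pose F : fieldType := HB.pack (GRing.ComNzRing.sort Q) varx.
by exists F, (idfun : {rmorphism Q -> F}); exact: inj_id.
Qed.

Lemma maximal_residue_field (N : R -> Prop) : is_ideal N -> ~ N 1 ->
  (forall x, ~ N x -> exists u r, N u /\ 1 = u + r * x) ->
  exists (F : fieldType) (f : {rmorphism R -> F}), forall a, N a -> f a = 0.
Proof.
move=> IN N1 Nmax; have [N0 ND NM] := IN.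
pose P : pred R := fun a => boolp.asbool (N a).
have PE a : (a \in P) = boolp.asbool (N a) by [].
have Pid : idealr_closed P.
  split; rewrite ?PE; first exact/boolp.asboolP.
    by apply/negP => /boolp.asboolP.
  move=> a x y /boolp.asboolP Nx /boolp.asboolP Ny; apply/boolp.asboolP/ND/Ny; exact: NM.
pose I : idealr R := HB.pack P (isIdealr.Build R P Pid).
have piE a b : N (a - b) -> \pi_({ideal_quot I}) a = \pi_({ideal_quot I}) b.
  by move=> Nab; apply/eqP; rewrite eqmodE /= /Quotient.equiv; exact/boolp.asboolP.
have [|F [f f_inj]] := @field_of_invertible ({ideal_quot I} : comNzRingType).
  elim/quotW => x x0.
  have /Nmax[u [r [Nu E]]] : ~ N x.
    by move=> Nx; case/eqP: x0; rewrite (piE x 0) ?subr0 ?rmorph0.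
  have rx1 : N (r * x - 1) by rewrite E opprD addrCA subrr addr0; exact: ideal_opp.
  by exists (\pi_({ideal_quot I}) r); have := piE _ _ rx1; rewrite rmorphM rmorph1.
by exists F, (f \o \pi_({ideal_quot I})) => a Na /=; rewrite (piE a 0) ?subr0 ?rmorph0.
Qed.

Lemma residue_field (C : R -> Prop) : is_ideal C -> ~ C 1 ->
  exists (F : fieldType) (f : {rmorphism R -> F}), forall a, C a -> f a = 0.
Proof.
move=> IC C1; have [C0 CD CM] := IC.
(* [Zorn_bigcup] also asks about the empty chain, whose union is empty; joining [C] makes it stand
   for [C] itself. *)
pose U (X : R -> Prop) a := X a \/ C a.
pose P (X : R -> Prop) := is_ideal (U X) /\ ~ U X 1.
have [Fs FP Fchain|A [[IA A1] Amax]] := @classical_sets.Zorn_bigcup R P.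
  split; last first.
    by move=> [[X FX X1]|//]; have [_ H] := FP X FX; apply: H; left.
  split; first by right.
  - move=> a b [[X FX Xa]|Ca] [[Y FY Yb]|Cb].
    + have [Z [FZ Za Zb]] : exists Z, [/\ Fs Z, Z a & Z b].
        case: (Fchain X Y FX FY) => H; first by exists Y; split=> //; exact: H.
        by exists X; split=> //; exact: H.
      have [[_ ZD _] _] := FP Z FZ.
      by case: (ZD a b (or_introl Za) (or_introl Zb)) => H; [left; exists Z|right].
    + have [[_ XD _] _] := FP X FX.
      by case: (XD a b (or_introl Xa) (or_intror Cb)) => H; [left; exists X|right].
    + have [[_ XD _] _] := FP Y FY.
      by case: (XD a b (or_intror Ca) (or_introl Yb)) => H; [left; exists Y|right].
    + by right; exact: CD.
  - move=> r a [[X FX Xa]|Ca]; last by right; exact: CM.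
    have [[_ _ XM] _] := FP X FX.
    by case: (XM r a (or_introl Xa)) => H; [left; exists X|right].
have [|F [f fP]] := maximal_residue_field IA A1; last by exists F, f => a Ca; apply: fP; right.
move=> x xA; apply: boolp.contrapT => H.
pose B a := exists u r, U A u /\ a = u + r * x.
have [A0 AD AM] := IA.
have BU a : U A a -> B a by move=> Ua; exists a, 0; rewrite mul0r addr0.
have UB a : U B a -> B a by case=> // Ca; apply: BU; right.
apply: (Amax B).
  split=> [a Aa|BA]; first by apply: BU; left.
  by apply: xA; left; apply: BA; exists 0, 1; rewrite add0r mul1r.
split; last by move=> /UB[u [r [Uu E]]]; apply: H; exists u, r.
split; first by left; exact: BU.
- move=> a b /UB[u [r [Uu ->]]] /UB[u' [r' [Uu' ->]]]; left; exists (u + u'), (r + r').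
  by split; [exact: AD|rewrite mulrDl addrACA].
- move=> r a /UB[u [r' [Uu ->]]]; left; exists (r * u), (r * r').
  by split; [exact: AM|rewrite mulrDr mulrA].
Qed.
End ResidueField.

(** Take [S] minimal such that [J] and the [D i] with [i] in [S] generate every [D e], and [e0] in
    [S]. Modulo [J1], generated by [J] and the rest of [S], each [D e] is a multiple [b e] of
    [D e0]. The conductor of [D e0] into [J1] is proper by minimality; in a residue field above it,
    [e] receives the value [f (b e)], and [e0] the value 1. *)
Lemma residue_functional (R : comNzRingType) (l : nat) (D : 'I_l -> R) (J : R -> Prop) :
  is_ideal J -> ~ (forall e, J (D e)) ->
  exists (F : fieldType) (f : {rmorphism R -> F}) (c : 'I_l -> F), (exists g, c g != 0) /\
    forall a : 'I_l -> R, J (\sum_e a e * D e) -> \sum_e f (a e) * c e = 0.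
Proof.
move=> IJ JD.
pose GS (S : {set 'I_l}) p := J p \/ exists2 i, i \in S & p = D i.
pose Q (S : {set 'I_l}) := boolp.asbool (forall e, igen (GS S) (D e)).
have QT : Q setT by apply/boolp.asboolP => e; apply: igen_mem; right; exists e.
have [S QS Smin] := arg_minnP (fun S : {set 'I_l} => #|S|) QT.
have {}QS e : igen (GS S) (D e) by move/boolp.asboolP: QS; apply.
case: (set_0Vmem S) => [S0|[e0 e0S]].
  case: JD => e; have := QS e; apply: igen_min => // x [//|[i]].
  by rewrite S0 inE.
pose J1 := igen (GS (S :\ e0)).
have IJ1 : is_ideal J1 := igen_ideal _.
have [J10 J1D J1M] := IJ1.
have decomp x : igen (GS S) x -> exists b, J1 (x - b * D e0).
  apply: (@igen_min _ _ (fun x => exists b, J1 (x - b * D e0))).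
    split; first by exists 0; rewrite mul0r subr0.
    - move=> a b [r Ha] [s Hb]; exists (r + s); rewrite mulrDl opprD addrACA; exact: J1D.
    - move=> r a [s Ha]; exists (r * s); rewrite -mulrA -mulrBr; exact: J1M.
  move=> y [Jy|[i iS ->]]; first by exists 0; rewrite mul0r subr0; apply: igen_mem; left.
  case: (eqVneq i e0) => [->|ie0]; first by exists 1; rewrite mul1r subrr.
  by exists 0; rewrite mul0r subr0; apply: igen_mem; right; exists i; rewrite // !inE ie0.
have De0 : ~ J1 (D e0).
  move=> H; have : Q (S :\ e0).
    apply/boolp.asboolP => e; have [b Hb] := decomp _ (QS e).
    by rewrite -(subrK (b * D e0) (D e)); apply: J1D => //; exact: J1M.
  by move/Smin; rewrite [#|S|](cardsD1 e0) e0S add1n ltnn.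
pose C a := J1 (a * D e0).
have [||F [f fC]] := @residue_field R C.
- split; rewrite /C ?mul0r //.
  + by move=> a b Ha Hb; rewrite mulrDl; exact: J1D.
  + by move=> r a Ha; rewrite -mulrA; exact: J1M.
- by rewrite /C mul1r.
have /boolp.choice[b bP] : forall e, exists b, J1 (D e - b * D e0) by move=> e; exact: decomp.
exists F, f, (fun e => f (b e)); split.
  exists e0; have : C (1 - b e0) by rewrite /C mulrBl mul1r.
  by move/fC/eqP; rewrite rmorphB rmorph1 subr_eq0 => /eqP <-; exact: oner_neq0.
move=> a Ja; under eq_bigr do rewrite -rmorphM.
rewrite -rmorph_sum; apply: fC; rewrite /C mulr_suml.
have -> : \sum_e a e * b e * D e0 = \sum_e a e * D e - \sum_e a e * (D e - b e * D e0).
  by rewrite -sumrB; apply: eq_bigr => e _; ring.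
apply: J1D; first by apply: igen_mem; left.
by apply: ideal_opp => //; apply: ideal_sum => // e _; exact: J1M.
Qed.

(* Cayley-Hamilton: the w_a form a nonzero vector killed by the matrix of the relations
   expressing the g * w_a through the w_b with coefficients in J. *)
Lemma integral_det (R : idomainType) (M l : nat) (w : 'I_M -> R) (D : 'I_l -> R) (J : R -> Prop) g :
  (exists a, w a != 0) ->
  (forall a, ideal_mul J (igen (fun p => exists b, p = w b)) (g * w a)) ->
  (forall f, J f -> exists c : 'I_l -> R, f = \sum_e c e * D e) -> is_ideal J ->
  exists C : 'I_M -> 'I_M -> 'I_l -> R,
    (forall a b, J (\sum_e C a b e * D e)) /\
    \det (\matrix_(a, b) (g *+ (a == b) - \sum_e C a b e * D e)) = 0.
Proof.
move=> [a0 wa0] gw JD IJ; have [J0 JDD JM] := IJ.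
have row a : exists j : 'I_M -> R, (forall b, J (j b)) /\ g * w a = \sum_b j b * w b.
  have := gw a; apply: (@ideal_mul_min _ _ _ (fun x => exists j : 'I_M -> R, (forall b, J (j b)) /\ x = \sum_b j b * w b)).
    split; first by exists (fun=> 0); split=> //; rewrite big1 // => b _; rewrite mul0r.
    - move=> x y [j [Jj ->]] [k [Jk ->]]; exists (fun b => j b + k b); split=> [b|]; first exact: JDD.
      by rewrite -big_split; apply: eq_bigr => b _; rewrite mulrDl.
    - move=> r x [j [Jj ->]]; exists (fun b => r * j b); split=> [b|]; first exact: JM.
      by rewrite mulr_sumr; apply: eq_bigr => b _; rewrite mulrA.
  move=> u v Ju; elim=> [|r _ y [b ->] _ [j [Jj E]]].
    by exists (fun=> 0); split=> //; rewrite mulr0 big1 // => b _; rewrite mul0r.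
  exists (fun b' => (if b' == b then r * u else 0) + j b'); split=> [b'|].
    by apply: JDD => //; case: eqP => // _; exact: JM.
  under eq_bigr do rewrite mulrDl.
  rewrite big_split /= -E mulrDr (bigD1 b) //= eqxx big1 ?addr0 => [|b' /negbTE ->]; last by rewrite mul0r.
  by rewrite mulrA [u * r]mulrC.
have /boolp.choice[j jP] := row.
have /boolp.choice[C CP] : forall ab : 'I_M * 'I_M, exists c : 'I_l -> R, j ab.1 ab.2 = \sum_e c e * D e.
  by move=> [a b] /=; apply: JD; have [+ _] := jP a; apply.
exists (fun a b => C (a, b)); split=> [a b|].
  by have := CP (a, b) => /= <-; have [+ _] := jP a; apply.
set X := \matrix_(_, _) _.
have Xw : X *m (\col_a w a) = 0.
  apply/matrixP=> a k; rewrite !mxE.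
  under eq_bigr do rewrite !mxE mulrBl.
  rewrite sumrB (bigD1 a) //= eqxx mulr1n [X in _ + X - _]big1 ?addr0 => [|b ba]; last first.
    by rewrite eq_sym (negbTE ba) mulr0n mul0r.
  have [_ ->] := jP a; apply/eqP; rewrite subr_eq0; apply/eqP/eq_bigr => b _.
  by have /= <- := CP (a, b).
have : (\adj X *m X) *m (\col_a w a) = 0 by rewrite -mulmxA Xw mulmx0.
rewrite mul_adj_mx mul_scalar_mx => /matrixP /(_ a0 0) /eqP; rewrite !mxE mulf_eq0 (negbTE wa0) orbF.
by move/eqP.
Qed.

(** * Degeneration at a residue field *)

Lemma mlead_eq (F : fieldType) (N : nat) (g : {mpoly F[N]}) (u : 'X_{1.. N}) :
  g@_u != 0 -> (forall m, g@_m != 0 -> (m <= u)%O) -> g != 0 /\ mlead g = u.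
Proof.
move=> gu gle; have g0 : g != 0 by apply: contraNneq gu => ->; rewrite mcoeff0.
split=> //; apply/le_anti; rewrite gle ?mleadc_eq0 //=.
by rewrite leNgt; apply: contra gu => /mcoeff_gt_mlead ->.
Qed.

(** Products of the [g i] with distinct exponents have distinct leading monomials, so the largest
    one cannot cancel. *)
Lemma leads_alg_independent (F : fieldType) (N k : nat) (g : 'I_k -> {mpoly F[N]}) :
  (forall i, g i != 0) ->
  (forall a b : 'X_{1.. k}, (\sum_i mlead (g i) *+ a i)%MM = (\sum_i mlead (g i) *+ b i)%MM -> a = b) ->
  forall P : {mpoly F[k]}, mmap (@mpolyC N F) g P = 0 -> P = 0.
Proof.
move=> g0 indep P PE; apply/eqP; apply: contraT => P0.
pose G (a : 'X_{1.. k}) := mmap1 g a.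
have G0 a : G a != 0 by apply/prodf_neq0 => i _; rewrite expf_neq0.
have GE a : mlead (G a) = (\sum_i mlead (g i) *+ a i)%MM.
  rewrite /G /mmap1 mlead_prod => [|i _]; last by rewrite expf_neq0.
  by apply: eq_bigr => i _; rewrite mleadX.
have lE a : a \in msupp P -> mlead (P@_a *: G a) = mlead (G a).
  by rewrite mcoeff_msupp => Pa; rewrite mleadZ.
have PS : \sum_(a <- msupp P) P@_a *: G a = 0.
  by rewrite -[RHS]PE /mmap; apply: eq_bigr => a _; rewrite mul_mpolyC.
have [a aP amax] : exists2 a, a \in msupp P & forall b, b \in msupp P -> (mlead (G b) <= mlead (G a))%O.
  have : msupp P != [::] by rewrite msupp_eq0.
  elim: (msupp P) => // a s IH _; case: (eqVneq s [::]) => [->|/IH[b bs bmax]].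
    by exists a; rewrite ?mem_head // => b; rewrite inE => /eqP ->.
  case: (leP (mlead (G a)) (mlead (G b))) => ab.
    exists b; first by rewrite inE bs orbT.
    by move=> c; rewrite inE => /orP[/eqP ->|/bmax].
  exists a; first by rewrite mem_head.
  move=> c; rewrite inE => /orP[/eqP -> //|/bmax cb]; exact: le_trans cb (ltW ab).
move/(congr1 (mcoeff (mlead (G a)))): PS; rewrite mcoeff0 raddf_sum /= (bigD1_seq a) ?msupp_uniq //=.
rewrite [X in _ + X]big_seq_cond big1 ?addr0 => [/eqP|b /andP[bP ba]].
  by rewrite mcoeffZ mulf_eq0 mleadc_eq0 (negbTE (G0 a)) orbF -[_ == 0]negbK -mcoeff_msupp aP.
rewrite mcoeffZ (@mcoeff_gt_mlead _ _ (G b)) ?mulr0 // lt_neqAle amax // andbT.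
by apply: contra ba => /eqP; rewrite !GE => /indep ->.
Qed.

Lemma igen_coeffs (R : comNzRingType) (l : nat) (D : 'I_l -> R) (Q : {set 'I_l}) f :
  igen (fun p => exists2 e, e \in Q & p = D e) f ->
  exists c : 'I_l -> R, (forall e, e \notin Q -> c e = 0) /\ f = \sum_e c e * D e.
Proof.
elim=> [|r _ y [e eQ ->] _ [c [cQ ->]]].
  by exists (fun=> 0); split=> //; rewrite big1 // => e _; rewrite mul0r.
exists (fun e' => (if e' == e then r else 0) + c e'); split=> [e' e'Q|].
  by rewrite cQ // addr0; case: eqP => // E; rewrite E eQ in e'Q.
under [RHS]eq_bigr do rewrite mulrDl.
rewrite big_split /=; congr (_ + _); rewrite (bigD1 e) //= eqxx big1 ?addr0 // => e' /negbTE ->.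
by rewrite mul0r.
Qed.

Section Degeneration.
Variable lam : seq nat.
Local Notation n := (nF lam).
Local Notation m := (lam1 lam).
Local Notation cell := (cell lam).
Local Notation ncolors := (ncolors lam).
Hypothesis lam_sorted : sorted geq lam.
Variable K : fieldType.
Local Notation A := {mpoly K[n + m]}.
Local Notation varx := (@varx lam K).
Local Notation vary := (@vary lam K).
Local Notation diag := (diag varx vary).
Variables (F : fieldType) (f : {rmorphism A -> F}).

Definition unit_row k := [exists i : 'I_n, (i == k :> nat) && (f (varx i) != 0)].
Definition unit_col l := [exists j : 'I_m, (j == l :> nat) && (f (vary j) != 0)].
(** Equivalently, [I] lies in the kernel of [f]; otherwise [I] is locally the unit ideal, a case
    settled directly in [J_basic]. *)
Hypothesis no_unit_cell : forall c : cell, in_lam c -> ~~ (unit_row (row c) && unit_col (col c)).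

Lemma unit_rowE (i : 'I_n) : unit_row i = (f (varx i) != 0).
Proof.
apply/existsP/idP => [[i' /andP[/eqP/val_inj -> //]]|H].
by exists i; rewrite eqxx.
Qed.
Lemma unit_colE (j : 'I_m) : unit_col j = (f (vary j) != 0).
Proof.
apply/existsP/idP => [[j' /andP[/eqP/val_inj -> //]]|H].
by exists j; rewrite eqxx.
Qed.

Definition first_unit_row := find unit_row (iota 0 n).
Definition first_unit_col := find unit_col (iota 0 m).
(** With the first unit row invertible, the [y_l] with [l < unit_width] lie in the localized ideal,
    and symmetrically the [x_k] with [k < unit_height]. If there is no unit row or no unit column,
    the default values make the respective number 0. *)
Definition unit_width := nth 0 lam first_unit_row.
Definition unit_height := find (fun l => l <= first_unit_col)%N lam.

Lemma find_iota (P : pred nat) (N : nat) : let k := find P (iota 0 N) in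
  [/\ (k <= N)%N, (forall i, i < k -> ~~ P i)%N & (k < N)%N -> P k].
Proof.
rewrite /=; set k := find _ _; have kN : (k <= N)%N by rewrite -[X in (_ <= X)%N](size_iota 0) find_size.
split=> // [i ik|kltN].
  by have := before_find 0%N ik; rewrite nth_iota ?add0n; [move=> -> | exact: leq_trans ik kN].
have : has P (iota 0 N) by rewrite has_find size_iota.
by move/(nth_find 0%N); rewrite nth_iota ?add0n.
Qed.

Lemma unit_row_lt k : (k < first_unit_row)%N -> ~~ unit_row k.
Proof. by have [_ H _] := find_iota unit_row n; exact: H. Qed.
Lemma unit_col_lt l : (l < first_unit_col)%N -> ~~ unit_col l.
Proof. by have [_ H _] := find_iota unit_col m; exact: H. Qed.
Lemma unit_row_first : (first_unit_row < n)%N -> unit_row first_unit_row.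
Proof. by have [_ _ H] := find_iota unit_row n; exact: H. Qed.
Lemma unit_col_first : (first_unit_col < m)%N -> unit_col first_unit_col.
Proof. by have [_ _ H] := find_iota unit_col m; exact: H. Qed.

Lemma nth_lam_le k : (nth 0 lam k <= m)%N.
Proof. exact: nth_lam_anti. Qed.

Lemma nth_lam_ltn k l : (l < nth 0 lam k)%N -> (k < n)%N.
Proof. by case: (ltnP k n) => // nk; rewrite nth_default. Qed.

Lemma ltn_unit_height k : (k < unit_height)%N = (first_unit_col < nth 0 lam k)%N.
Proof.
case: (ltnP k unit_height) => [kb|bk].
  by have := before_find 0%N kb; rewrite leqNgt => /negbFE ->.
apply/esym/negbTE; rewrite -leqNgt; case: (ltnP unit_height n) => [bn|nb].
  apply: leq_trans (nth_lam_anti lam_sorted bk) _.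
  by have := @nth_find _ 0%N (fun l => l <= first_unit_col)%N lam; rewrite has_find; apply.
by rewrite nth_default //; exact: leq_trans nb bk.
Qed.

Lemma unit_height_le : (unit_height <= first_unit_row)%N.
Proof.
rewrite leqNgt ltn_unit_height; apply/negP => H.
have iN := nth_lam_ltn H; have jM := leq_trans H (nth_lam_le _).
have := @no_unit_cell (Ordinal iN, Ordinal jM) H.
by rewrite /row /col /= unit_row_first ?unit_col_first.
Qed.

Lemma unit_width_le : (unit_width <= first_unit_col)%N.
Proof. by rewrite leqNgt /unit_width -ltn_unit_height -leqNgt unit_height_le. Qed.

Lemma unit_row_col (c : cell) : in_lam c -> unit_row (row c) -> (col c < unit_width)%N.
Proof.
move=> cl ur; case: (ltnP (row c) first_unit_row) => [/unit_row_lt|]; first by rewrite ur.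
by move/(nth_lam_anti lam_sorted); exact: leq_trans.
Qed.

Lemma unit_col_row (c : cell) : in_lam c -> unit_col (col c) -> (row c < unit_height)%N.
Proof.
move=> cl uc; rewrite ltn_unit_height; case: (ltnP (col c) first_unit_col) => [/unit_col_lt|]; first by rewrite uc.
by move=> H; exact: leq_ltn_trans H cl.
Qed.

(** Locally the ideal consists of those variables and a smaller Ferrers ideal, whose cells fill this
    box and involve no unit. *)
Lemma in_box (c : cell) : in_lam c -> (unit_height <= row c)%N -> (unit_width <= col c)%N ->
  (row c < first_unit_row)%N /\ (col c < first_unit_col)%N.
Proof.
move=> cl bc ccc; split; rewrite ltnNge; apply/negP => H.
  by have := leq_trans cl (leq_trans (nth_lam_anti lam_sorted H) ccc); rewrite ltnn.
by move: (leq_ltn_trans H cl); rewrite -ltn_unit_height ltnNge bc.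
Qed.

(* Weight 0 marks the units of the localization, weight 2 the variables that lie in the
   localized Ferrers ideal. *)
Definition wx k := if unit_row k then 0%N else if (k < unit_height)%N then 2 else 1.
Definition wy l := if unit_col l then 0%N else if (l < unit_width)%N then 2 else 1.
Definition wt (c : cell) := (wx (row c) + wy (col c))%N.

(* These cells carry the initial monomials of the diagonals that suffice to generate
   J_lambda after localization. *)
Definition lead_cell (c : cell) := in_lam c &&
  [|| (row c == first_unit_row) && (col c < unit_width), (col c == first_unit_col) && (row c < unit_height) |
      [&& unit_height <= row c, unit_width <= col c & (row c == unit_height) || (col c == unit_width)]]%N.

Lemma wt_ge2 (c : cell) : in_lam c -> (2 <= wt c)%N.
Proof.
move=> cl; have := no_unit_cell cl; have := unit_row_col cl; have := unit_col_row cl.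
rewrite /wt /wx /wy; case: (unit_row _); case: (unit_col _) => //= H1 H2 _.
- by rewrite H2.
- by rewrite H1.
by case: ifP => _; case: ifP.
Qed.

Local Notation B := {mpoly F[n + m]}.
Definition dx (i : 'I_n) : B := if unit_row i then (f (varx i))%:MP else 'X_(lshift m i).
Definition dy (j : 'I_m) : B := if unit_col j then (f (vary j))%:MP else 'X_(rshift n j).
(* Initial form, of weight two, of the diagonal of colour e. *)
Definition ddiag (e : nat) : B :=
  \sum_(c : cell | (in_lam c && (color c == e)) && (wt c == 2%N)) cellv dx dy c.

Definition dmnm (c : cell) : 'X_{1.. n + m} :=
  ((if unit_row (row c) then 0 else U_(lshift m c.1)) +
   (if unit_col (col c) then 0 else U_(rshift n c.2)))%MM.
Definition dcoef (c : cell) : F :=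
  (if unit_row (row c) then f (varx c.1) else 1) * (if unit_col (col c) then f (vary c.2) else 1).

Lemma dcellE c : cellv dx dy c = dcoef c *: 'X_[dmnm c].
Proof.
rewrite /cellv /dx /dy /dcoef /dmnm /row /col mpolyXD -mul_mpolyC rmorphM /= mulrACA.
by congr (_ * _); case: ifP => _; rewrite ?mpolyX0 ?mulr1 ?mul1r.
Qed.

Lemma dcoef_neq0 c : dcoef c != 0.
Proof.
rewrite /dcoef /row /col mulf_neq0 //.
  by case: ifP; rewrite ?oner_neq0 // unit_rowE.
by case: ifP; rewrite ?oner_neq0 // unit_colE.
Qed.

Lemma ltm_U1 (i j : 'I_(n + m)) : (i < j)%N -> (U_(j)%MM < U_(i)%MM :> 'X_{1.. n + m})%O.
Proof.
move=> ij; apply/ltmcP; first by rewrite !mdeg1.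
exists i => [k ki|]; rewrite !mnm1E ?eqxx.
  by rewrite -!(inj_eq val_inj) /= !gtn_eqF // (ltn_trans ki).
by rewrite -(inj_eq val_inj) /= gtn_eqF.
Qed.

Lemma wt_lead (c : cell) : lead_cell c -> wt c = 2%N.
Proof.
case/andP => cl; have b1 := unit_height_le; have b2 := unit_width_le.
case/or3P => [/andP[/eqP ci cc_]|/andP[/eqP cj cb]|/and3P[H1 H2 _]].
- have uc := @unit_col_lt (col c); have ur := unit_row_first.
  rewrite /wt /wx /wy ci ur; last by rewrite -ci row_lt.
  by rewrite (negbTE (uc _)) ?cc_ //; lia.
- have uc := @unit_row_lt (row c); have ur := unit_col_first.
  rewrite /wt /wx /wy cj ur; last by rewrite -cj col_lt.
  by rewrite (negbTE (uc _)) ?cb //; lia.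
have [r1 c1] := in_box cl H1 H2.
by rewrite /wt /wx /wy (negbTE (unit_row_lt r1)) (negbTE (unit_col_lt c1)) !ltnNge H1 H2.
Qed.

(** A lead cell is the first cell of weight two on its diagonal: the others lie to its south-east,
    and earlier variables are larger in the monomial order. *)
Lemma lead_cell_max (q c : cell) : lead_cell q -> in_lam c -> color c = color q -> wt c = 2%N ->
  c != q -> (dmnm c < dmnm q)%O.
Proof.
move=> qq cl cq w2 cNq; have b1 := unit_height_le; have b2 := unit_width_le.
have rq : row c != row q by apply: contra cNq => /eqP H; apply/eqP; exact: cell_color_eq.
have diagE : (col c + row q = col q + row c)%N.
  by move: cq; rewrite /color; have := row_lt c; have := row_lt q; lia.
have := wt_lead qq; case/andP: (qq) => ql H wq2.
have ur := @unit_row_lt (row c); have uc := @unit_col_lt (col c).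
have ur' := @unit_row_lt (row q); have uc' := @unit_col_lt (col q).
have urc := unit_row_col cl; have ucr := unit_col_row cl.
have cbox := in_box cl.
case/or3P: H => [/andP[/eqP ci cc_]|/andP[/eqP cj cb]|/and3P[H1 H2 H3]].
- have uq : unit_row (row q) by rewrite ci unit_row_first // -ci row_lt.
  have nuq : ~~ unit_col (col q) by apply: uc'; lia.
  have [ucr' nuc rlt] : [/\ unit_row (row c), ~~ unit_col (col c) & (row q < row c)%N].
    have nc : ~~ unit_col (col c).
      case: (ltnP (row c) first_unit_row) => ri; first by apply: uc; lia.
      by apply: uc; have := leq_trans cl (nth_lam_anti lam_sorted ri); rewrite -/unit_width; lia.
    have ccl : (col c < unit_width)%N.
      case: (ltnP (row c) first_unit_row) => ri; first by lia.
      by have := leq_trans cl (nth_lam_anti lam_sorted ri).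
    move: w2; rewrite /wt /wx /wy (negbTE nc) ccl.
    case: (boolP (unit_row (row c))) => urr; last by case: ifP.
    have ri : (first_unit_row <= row c)%N by rewrite leqNgt; apply: contraL urr; exact: ur.
    by rewrite ltn_neqAle eq_sym rq ci ri.
  rewrite /dmnm ucr' uq (negbTE nuc) (negbTE nuq) !add0m; apply: ltm_U1 => /=.
  by rewrite -/(col q) -/(col c); lia.
- have uq : unit_col (col q) by rewrite cj unit_col_first // -cj col_lt.
  have nuq : ~~ unit_row (row q) by apply: ur'; lia.
  have [ucc' nuc rlt] : [/\ unit_col (col c), ~~ unit_row (row c) & (row q < row c)%N].
    have ccl : (row c < unit_height)%N.
      case: (ltnP (col c) first_unit_col) => ri; first by lia.
      by rewrite ltn_unit_height; exact: leq_ltn_trans ri cl.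
    have nc : ~~ unit_row (row c) by apply: ur; exact: leq_trans ccl b1.
    move: w2; rewrite /wt /wx /wy (negbTE nc) ccl.
    case: (boolP (unit_col (col c))) => ucc; last by case: ifP.
    have ri : (first_unit_col <= col c)%N by rewrite leqNgt; apply: contraL ucc; exact: uc.
    by rewrite ltn_neqAle eq_sym rq; split=> //; lia.
  rewrite /dmnm ucc' uq (negbTE nuc) (negbTE nuq) !addm0; apply: ltm_U1 => /=.
  by rewrite -/(row q) -/(row c).
have [q1 q2] := in_box ql H1 H2.
have [rlt clt] : (row q < row c)%N /\ (col q < col c)%N.
  suff : ~ (row c < row q)%N by lia.
  move=> rlt; have nr : ~~ unit_row (row c) by apply: ur; lia.
  have nc : ~~ unit_col (col c) by apply: uc; lia.
  move: w2; rewrite /wt /wx /wy (negbTE nr) (negbTE nc).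
  case/orP: H3 => /eqP H3.
    by rewrite -H3 rlt; case: ifP.
  have -> : (col c < unit_width)%N by lia.
  by case: ifP.
have [c1 c2] : (row c < first_unit_row)%N /\ (col c < first_unit_col)%N by apply: cbox; [exact: leq_trans H1 (ltnW rlt)|exact: leq_trans H2 (ltnW clt)].
rewrite /dmnm (negbTE (ur c1)) (negbTE (uc c2)) (negbTE (ur' q1)) (negbTE (uc' q2)).
apply/ltmcP; first by rewrite !mdegD !mdeg1.
have neq (i i' : 'I_(n + m)) : (i < i')%N -> (i' == i) = false.
  by move=> H; apply/negbTE; rewrite -(inj_eq val_inj) /= gtn_eqF.
exists (lshift m q.1) => [k /= kq|]; rewrite !mnmDE !mnm1E.
  have := row_lt q; rewrite -/(row q) in kq => rqn.
  have kc : (k < row c)%N by exact: ltn_trans kq rlt.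
  have kn : (k < n)%N by exact: ltn_trans kq rqn.
  by rewrite !neq //= ltn_addr.
rewrite eqxx !eq_rlshift !addn0 neq //.
Qed.

Lemma mlead_ddiag (q : cell) : lead_cell q ->
  ddiag (color q) != 0 /\ mlead (ddiag (color q)) = dmnm q.
Proof.
move=> qq; have ql : in_lam q by case/andP: qq.
have coefE u : (ddiag (color q))@_u =
    \sum_(c : cell | (in_lam c && (color c == color q)) && (wt c == 2%N)) dcoef c * (dmnm c == u)%:R.
  by rewrite raddf_sum; apply: eq_bigr => c _; rewrite dcellE /= mcoeffZ mcoeffX.
apply: mlead_eq => [|u].
  rewrite coefE (bigD1 q) /= ?ql ?wt_lead ?eqxx // mulr1 big1 ?addr0 ?dcoef_neq0 //.
  move=> c /andP[/andP[/andP[cl /eqP cq] /eqP cw] cNq].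
  by rewrite lt_eqF ?mulr0 //; exact: lead_cell_max.
rewrite coefE; apply: contraR; rewrite -ltNge => qu; apply/eqP; apply: big1 => c.
case/andP=> /andP[cl /eqP cq] /eqP cw; case: (eqVneq c q) => [->|cNq].
  by rewrite lt_eqF ?mulr0.
by rewrite lt_eqF ?mulr0 //; apply: lt_trans qu; exact: lead_cell_max.
Qed.

Lemma dmnm_row (c : cell) (i : 'I_n) :
  dmnm c (lshift m i) = (~~ unit_row (row c) && (row c == i)).
Proof.
rewrite /dmnm mnmDE; case: (unit_row (row c)); case: (unit_col (col c));
  by rewrite /= ?mnm0E ?mnm1E ?eq_rlshift ?(inj_eq (@lshift_inj _ _)) ?addn0.
Qed.

Lemma dmnm_col (c : cell) (j : 'I_m) :
  dmnm c (rshift n j) = (~~ unit_col (col c) && (col c == j)).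
Proof.
rewrite /dmnm mnmDE; case: (unit_row (row c)); case: (unit_col (col c));
  by rewrite /= ?mnm0E ?mnm1E ?eq_lrshift ?(inj_eq (@rshift_inj _ _)) ?addn0.
Qed.

Definition leadQ : {set 'I_ncolors} :=
  [set e : 'I_ncolors | [exists q : cell, lead_cell q && (color q == e)]].

Lemma leadQ_cell_exists : exists qc : 'I_#|leadQ| -> cell,
  forall i, lead_cell (qc i) /\ color (qc i) = enum_val i.
Proof.
suff /boolp.choice[qc qcP] : forall i : 'I_#|leadQ|, exists q, lead_cell q /\ color q = enum_val i.
  by exists qc.
move=> i; have := enum_valP i; rewrite inE => /existsP[q /andP[ql /eqP qe]]; by exists q.
Qed.

(** Triangularity for [dmnm_independent]: every lead cell except the corner of the box owns a
    variable that no other lead monomial contains, so all exponents but one are read off directly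
    and that of the corner is solved for last. *)
Lemma lead_cell_coord (q : cell) : lead_cell q ->
  (exists u, dmnm q u = 1%N /\ forall q', lead_cell q' -> q' != q -> dmnm q' u = 0%N) \/
  (row q = unit_height /\ col q = unit_width /\ exists u, dmnm q u = 1%N).
Proof.
move=> qq; have b1 := unit_height_le; have b2 := unit_width_le.
have neq (q' : cell) : q' != q -> ~ (row q' = row q /\ col q' = col q).
  by move=> /eqP qN [H H']; apply: qN; apply: cell_color_eq => //; rewrite /color H H'.
case/andP: (qq) => ql /or3P[/andP[/eqP qi qc]|/andP[/eqP qj qb]|/and3P[H1 H2 H3]].
- left; exists (rshift n q.2); rewrite dmnm_col unit_col_lt ?eqxx; last by lia.
  split=> // q' /andP[_ H'] /neq Nq; rewrite dmnm_col -/(col q).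
  by case: eqP => [E|]; rewrite ?andbF //; exfalso; lia.
- left; exists (lshift m q.1); rewrite dmnm_row unit_row_lt ?eqxx; last by lia.
  split=> // q' /andP[_ H'] /neq Nq; rewrite dmnm_row -/(row q).
  by case: eqP => [E|]; rewrite ?andbF //; exfalso; lia.
have [q1 q2] := in_box ql H1 H2.
case: (ltngtP unit_height (row q)) H1 => // rb _.
  left; exists (lshift m q.1); rewrite dmnm_row unit_row_lt ?eqxx //.
  split=> // q' /andP[_ H'] /neq Nq; rewrite dmnm_row -/(row q).
  by case: eqP => [E|]; rewrite ?andbF //; exfalso; lia.
case: (ltngtP unit_width (col q)) H2 => // cq _.
  left; exists (rshift n q.2); rewrite dmnm_col unit_col_lt ?eqxx //.
  split=> // q' /andP[_ H'] /neq Nq; rewrite dmnm_col -/(col q).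
  by case: eqP => [E|]; rewrite ?andbF //; exfalso; lia.
by right; split=> //; split=> //; exists (rshift n q.2); rewrite dmnm_col unit_col_lt ?eqxx.
Qed.

Lemma dmnm_independent (qc : 'I_#|leadQ| -> cell) :
  (forall i, lead_cell (qc i) /\ color (qc i) = enum_val i) ->
  forall a b : 'X_{1.. #|leadQ|},
    (\sum_i dmnm (qc i) *+ a i)%MM = (\sum_i dmnm (qc i) *+ b i)%MM -> a = b.
Proof.
move=> qcP a b E.
have coord (a' : 'X_{1.. #|leadQ|}) u : (\sum_i dmnm (qc i) *+ a' i)%MM u = (\sum_i dmnm (qc i) u * a' i)%N.
  by rewrite mnm_sumE; apply: eq_bigr => i _; rewrite mulmnE.
have qinj i i' : i' != i -> qc i' != qc i.
  apply: contra => /eqP H; apply/eqP/enum_val_inj/val_inj => /=.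
  by have [_ <-] := qcP i'; have [_ <-] := qcP i; rewrite H.
have solved i u : dmnm (qc i) u = 1%N ->
    (forall i', i' != i -> dmnm (qc i') u = 0%N \/ a i' = b i') -> a i = b i.
  move=> u1 ui; have := congr1 (fun x : 'X_{1.. n + m} => x u) E; rewrite /= !coord.
  rewrite (bigD1 i) //= [RHS](bigD1 i) //= u1 !mul1n.
  rewrite (eq_bigr (fun i' => dmnm (qc i') u * b i')%N) => [/addIn //|i' /ui[->|->]] //.
have first_ i : ~ (row (qc i) = unit_height /\ col (qc i) = unit_width) -> a i = b i.
  move=> nc; have [ql _] := qcP i; case: (lead_cell_coord ql) => [[u [u1 uq]]|[r [c _]]]; last by case: nc.
  apply: (solved i u) => // i' ii'; left; apply: uq; last exact: qinj.
  by have [] := qcP i'.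
apply/mnmP => i; have [ql _] := qcP i; case: (lead_cell_coord ql) => [[u [u1 uq]]|[r [c [u u1]]]].
  apply: (solved i u) => // i' ii'; left; apply: uq; last exact: qinj.
  by have [] := qcP i'.
apply: (solved i u) => // i' ii'; right; apply: first_ => -[r' c'].
by case/eqP: (qinj _ _ ii'); apply: cell_color_eq; rewrite /color ?r ?c ?r' ?c'.
Qed.

(** Membership in the ideal of the lead diagonals after localization at the kernel of [f]. *)
Definition good (x : A) : Prop := exists d, f d != 0 /\
  igen (fun p => exists2 e : 'I_ncolors, e \in leadQ & p = diag e) (d * x).

Lemma good_ideal : is_ideal good.
Proof.
have [J0 JD JM] := igen_ideal (fun p => exists2 e : 'I_ncolors, e \in leadQ & p = diag e); split.
- by exists 1; rewrite rmorph1 oner_neq0 mulr0.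
- move=> x y [d [d0 Hx]] [e [e0 Hy]]; exists (d * e); rewrite rmorphM mulf_neq0 //; split=> //.
  rewrite mulrDr; apply: JD; first by rewrite mulrAC mulrC; exact: JM.
  by rewrite -mulrA; exact: JM.
- by move=> r x [d [d0 Hx]]; exists d; rewrite mulrCA; split=> //; exact: JM.
Qed.

Lemma diag_leadQ (q : cell) : lead_cell q ->
  exists2 e : 'I_ncolors, e \in leadQ & diag (color q) = diag e.
Proof.
move=> qq; exists (Ordinal (color_lt q)) => //.
by rewrite inE; apply/existsP; exists q; rewrite qq eqxx.
Qed.

(* A Toeplitz system: the diagonals through a row whose leading variable is invertible
   determine the first variables of the other group. *)
Lemma good_system (k : nat) (M : 'M[A]_k) (z : 'I_k -> A) :
  (forall i j : 'I_k, (j < i)%N -> f (M i j) = 0) -> (forall i, f (M i i) != 0) ->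
  (forall i, exists2 q, lead_cell q & \sum_j M i j * z j = diag (color q)) ->
  forall i, good (z i).
Proof.
move=> Mup Mdiag Mz i; exists (\det M); split.
  rewrite -(det_map_mx f) -det_tr det_trig; last first.
    by apply/is_trig_mxP => a b ab; rewrite !mxE Mup.
  by apply/prodf_neq0 => a _; rewrite !mxE.
have -> : \det M * z i = (\adj M *m (M *m \col_j z j)) i 0.
  by rewrite mulmxA mul_adj_mx mul_scalar_mx !mxE.
have [J0 JD JM] := igen_ideal (fun p => exists2 e : 'I_ncolors, e \in leadQ & p = diag e).
rewrite mxE; apply: ideal_sum => [|j _]; first exact: igen_ideal.
apply: JM; have [q qq] := Mz j.
have -> : (M *m \col_j z j) j 0 = \sum_k0 M j k0 * z k0 by rewrite mxE; apply: eq_bigr => j1 _; rewrite mxE.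
by move->; apply: igen_mem; exact: diag_leadQ.
Qed.

Lemma good_y (l : 'I_m) : (l < unit_width)%N -> good (vary l).
Proof.
move=> lcc; have iN : (first_unit_row < n)%N by exact: nth_lam_ltn lcc.
have ccm : (unit_width <= m)%N by exact: nth_lam_le.
pose w (j : 'I_unit_width) : 'I_m := widen_ord ccm j.
(* Row [j] holds the coefficients of the [y_j'] in the diagonal through the cell
   [(first_unit_row, j)]. Below the main diagonal they are sums of [x_k] with [k < first_unit_row],
   which [f] kills; on it stands the unit [x_first_unit_row]. *)
pose M : 'M[A]_unit_width := \matrix_(j, j') \sum_(k < n | (k + j == first_unit_row + j')%N && (j' < nth 0 lam k)%N) varx k.
have -> : l = w (Ordinal lcc) by exact: val_inj.
apply: (good_system (M := M) (z := fun j => vary (w j))).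
- move=> j j' jj'; rewrite mxE rmorph_sum big1 // => k /andP[/eqP kE _].
  by apply/eqP; rewrite -[_ == _]negbK -unit_rowE; apply: unit_row_lt; lia.
- move=> j; rewrite mxE (big_pred1 (Ordinal iN)) => [|k].
    by rewrite -unit_rowE unit_row_first.
  rewrite eqn_add2r /= -(inj_eq val_inj) /=; case: eqP => // ->.
  exact: ltn_ord.
move=> j; pose q : cell := (Ordinal iN, w j).
have qcc : (col q < unit_width)%N := ltn_ord j.
have qq : lead_cell q by rewrite /lead_cell /in_lam [row q]/= eqxx qcc andbT.
exists q => //; rewrite /diag.
have -> : \sum_j' M j j' * vary (w j') =
   \sum_(k < n) \sum_(j' < unit_width | (k + j == first_unit_row + j')%N && (j' < nth 0 lam k)%N) varx k * vary (w j').
  under eq_bigr do rewrite mxE mulr_suml big_mkcond.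
  by rewrite exchange_big; apply: eq_bigr => k _; rewrite -big_mkcond.
have -> : \sum_(c : cell | in_lam c && (color c == color q)) cellv varx vary c =
   \sum_(k < n) \sum_(l < m | ((k + j == first_unit_row + l)%N && (l < nth 0 lam k)%N) && (l < unit_width)%N) varx k * vary l.
  rewrite pair_big_dep /=; apply: eq_bigl => -[k l'] /=.
  have := row_lt q; have := row_lt (k, l'); rewrite /in_lam /color /row /col /= => kn _.
  have jE : (w j : nat) = j by [].
  have bnd : (l' < nth 0 lam k)%N -> (first_unit_row <= k)%N -> (l' < unit_width)%N.
    by move=> H /(nth_lam_anti lam_sorted) H'; exact: leq_trans H H'.
  have := ltn_ord j; lia.
by apply: eq_bigr => k _; rewrite (big_ord_narrow_cond ccm).
Qed.

Lemma good_x (k : 'I_n) : (k < unit_height)%N -> good (varx k).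
Proof.
move=> kb; have jM : (first_unit_col < m)%N by apply: leq_trans (nth_lam_le k); rewrite -ltn_unit_height.
have bbn : (unit_height <= n)%N by exact: find_size.
pose w (j : 'I_unit_height) : 'I_n := widen_ord bbn j.
pose M : 'M[A]_unit_height := \matrix_(j, j') \sum_(l < m | (l + j == first_unit_col + j')%N && (l < nth 0 lam j')%N) vary l.
have -> : k = w (Ordinal kb) by exact: val_inj.
apply: (good_system (M := M) (z := fun j => varx (w j))).
- move=> j j' jj'; rewrite mxE rmorph_sum big1 // => l /andP[/eqP lE _].
  by apply/eqP; rewrite -[_ == _]negbK -unit_colE; apply: unit_col_lt; lia.
- move=> j; rewrite mxE (big_pred1 (Ordinal jM)) => [|l].
    by rewrite -unit_colE unit_col_first.
  rewrite eqn_add2r /= -(inj_eq val_inj) /=; case: eqP => // ->.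
  by rewrite -ltn_unit_height; exact: ltn_ord.
move=> j; pose q : cell := (w j, Ordinal jM).
have qbb : (row q < unit_height)%N := ltn_ord j.
have ql : in_lam q by move: qbb; rewrite ltn_unit_height.
have qq : lead_cell q by rewrite /lead_cell ql [col q]/= eqxx qbb orbT.
exists q => //; rewrite /diag.
have -> : \sum_j' M j j' * varx (w j') =
   \sum_(l < m) \sum_(j' < unit_height | (l + j == first_unit_col + j')%N && (l < nth 0 lam j')%N) vary l * varx (w j').
  under eq_bigr do rewrite mxE mulr_suml big_mkcond.
  by rewrite exchange_big; apply: eq_bigr => l _; rewrite -big_mkcond.
have -> : \sum_(c : cell | in_lam c && (color c == color q)) cellv varx vary c =
   \sum_(l < m) \sum_(k < n | ((l + j == first_unit_col + k)%N && (l < nth 0 lam k)%N) && (k < unit_height)%N) vary l * varx k.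
  rewrite (eq_bigr (fun l : 'I_m => \sum_(k < n) if ((l + j == first_unit_col + k)%N && (l < nth 0 lam k)%N) && (k < unit_height)%N then varx k * vary l else 0)); last first.
    by move=> l _; rewrite big_mkcond; apply: eq_bigr => k' _; case: ifP => // _; rewrite mulrC.
  rewrite exchange_big /= pair_big /= big_mkcond; apply: eq_bigr => -[k' l'] _ /=.
  congr (if _ then _ else _).
  have := row_lt q; have := row_lt (k', l'); rewrite /in_lam /color /row /col /= => kn.
  have jE : (w j : nat) = j by [].
  have bnd : (l' < nth 0 lam k')%N -> (first_unit_col <= l')%N -> (k' < unit_height)%N.
    by move=> H H'; rewrite ltn_unit_height; exact: leq_ltn_trans H' H.
  have := ltn_ord j; lia.
by apply: eq_bigr => l _; rewrite (big_ord_narrow_cond bbn).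
Qed.

(** Cells with row below [unit_height] or column below [unit_width] contain a good variable. Any
    other cell slides back along its diagonal to the top row or left column of the box, hence to a
    lead cell. *)
Lemma good_diag (e : 'I_ncolors) : good (diag e).
Proof.
have [J0 JD JM] := good_ideal.
case: (boolP (e \in leadQ)) => eQ.
  exists 1; rewrite rmorph1 oner_neq0 mul1r; split=> //.
  by apply: igen_mem; exists e.
rewrite /diag big_mkcond; apply: ideal_sum => [|c _]; first exact: good_ideal.
case: ifP => // /andP[cl /eqP ce].
case: (ltnP (row c) unit_height) => rb; first by rewrite /cellv mulrC; apply/JM/good_x.
case: (ltnP (col c) unit_width) => rc; first by apply/JM/good_y.
have [r1 c1] := in_box cl rb rc.
(* [s] is the smaller of the distances to the top row and to the left column of the box. *)
have [s [s1 s2 s3]] : exists s, [/\ s <= row c - unit_height, s <= col c - unit_width &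
    (row c - s == unit_height) || (col c - s == unit_width)]%N.
  case: (leqP (row c - unit_height) (col c - unit_width)) => H.
    by exists (row c - unit_height)%N; rewrite leqnn subKn ?eqxx.
  by exists (col c - unit_width)%N; rewrite leqnn (ltnW H) subKn ?eqxx ?orbT.
have i1 : (row c - s < n)%N by have := row_lt c; lia.
have j1 : (col c - s < m)%N by have := col_lt c; lia.
pose q : cell := (Ordinal i1, Ordinal j1).
case/negP: eQ; rewrite inE; apply/existsP; exists q.
have rE : row q = (row c - s)%N by [].
have cE : col q = (col c - s)%N by [].
have ql : in_lam q by apply: (in_lamW lam_sorted _ _ cl); lia.
apply/andP; split; last by apply/eqP; rewrite -ce /color rE cE; have := row_lt c; clear -s1 s2 rb rc; lia.
rewrite /lead_cell ql rE cE; apply/or3P/Or33/and3P; split=> //; clear -s1 s2 rb rc; lia.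
Qed.

(** The coefficients [be] are chosen before [V] and [h]: the same ones must serve the functional
    [c], with values in [F], and the initial forms [ddiag], with values in [B]. *)
Lemma linear_reduction (e : 'I_ncolors) : exists be : 'I_#|leadQ| -> F,
  forall (V : lmodType F) (h : 'I_ncolors -> V),
    (forall a : 'I_ncolors -> A, \sum_e a e * diag e = 0 -> \sum_e f (a e) *: h e = 0) ->
    h e = \sum_i be i *: h (enum_val i).
Proof.
have [d [d0 /igen_coeffs[a [aQ aE]]]] := good_diag e.
exists (fun i => f (a (enum_val i)) / f d) => V h hlin.
have := hlin (fun e' => (if e' == e then d else 0) - a e').
have -> : \sum_e' ((if e' == e then d else 0) - a e') * diag e' = 0.
  under eq_bigr do rewrite mulrBl.
  rewrite sumrB -aE (bigD1 e) //= eqxx big1 ?addr0 ?subrr // => e' /negbTE ->.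
  by rewrite mul0r.
move=> /(_ erefl); under eq_bigr do rewrite rmorphB scalerBl.
rewrite sumrB (bigD1 e) //= eqxx [X in _ + X - _]big1 ?addr0 => [|e' /negbTE ->]; last first.
  by rewrite rmorph0 scale0r.
move/eqP; rewrite subr_eq0 => /eqP E.
rewrite -[h e]scale1r -(mulVf d0) -scalerA E scaler_sumr.
rewrite (bigID (mem leadQ)) /= [X in _ + X]big1 ?addr0 => [|e' /aQ ->]; last first.
  by rewrite rmorph0 scale0r scaler0.
rewrite big_enum_val /=.
by apply: eq_bigr => i _; rewrite scalerA mulrC.
Qed.

End Degeneration.

(** * Minimality of [J_lambda] at all residue fields *)

Section Assembly.
Variable lam : seq nat.
Local Notation n := (nF lam).
Local Notation m := (lam1 lam).
Local Notation cell := (cell lam).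
Local Notation ncolors := (ncolors lam).
Hypothesis lam_sorted : sorted geq lam.
Variable K : fieldType.
Local Notation A := {mpoly K[n + m]}.
Local Notation varx := (@varx lam K).
Local Notation vary := (@vary lam K).
Local Notation diag := (diag varx vary).

Lemma mpoly_rmorph_eq (N : nat) (S : nzRingType) (g h : {rmorphism {mpoly K[N]} -> S}) :
  (forall a, g a%:MP = h a%:MP) -> (forall i, g 'X_i = h 'X_i) -> g =1 h.
Proof.
move=> gc gx p; rewrite (mpolyE p) !rmorph_sum; apply: eq_bigr => u _.
rewrite -mul_mpolyC !rmorphM /= gc mpolyXE_id !rmorph_prod; congr (_ * _).
by apply: eq_bigr => i _; rewrite !rmorphXn /= gx.
Qed.

Section Residue.
Variables (F : fieldType) (f : {rmorphism A -> F}).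
Hypothesis no_unit_cell : forall c : cell, in_lam c -> ~~ (unit_row f (row c) && unit_col f (col c)).
Local Notation B := {mpoly F[n + m]}.

(* Variables vanishing in the residue field are scaled by powers of 'X so that every
   diagonal becomes divisible by 'X^2. *)
Lemma degeneration : exists (Phi : {rmorphism A -> {poly B}}) (G : nat -> {poly B}),
  [/\ forall r, (Phi r).[0] = (f r)%:MP, forall e, Phi (diag e) = 'X^2 * G e &
      forall e, (G e).[0] = ddiag f e].
Proof.
pose h (v : 'I_(n + m)) : {poly B} := match split v with
  | inl i => 'X^(wx f i) * (dx f i)%:P
  | inr j => 'X^(wy f j) * (dy f j)%:P end.
pose base : {rmorphism K -> {poly B}} := (@polyC B \o @mpolyC (n + m) F \o f \o @mpolyC (n + m) K).
pose Phi : {rmorphism A -> {poly B}} := mmap base h.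
pose G e : {poly B} := \sum_(c : cell | in_lam c && (color c == e)) 'X^(wt f c - 2) * (cellv (dx f) (dy f) c)%:P.
have PhiX v : Phi 'X_v = h v by rewrite /Phi /= mmapX mmap1U.
have Phix i : Phi (varx i) = 'X^(wx f i) * (dx f i)%:P.
  by rewrite /varx PhiX /h -[lshift m i]/(unsplit (inl i)) unsplitK.
have Phiy j : Phi (vary j) = 'X^(wy f j) * (dy f j)%:P.
  by rewrite /vary PhiX /h -[rshift n j]/(unsplit (inr j)) unsplitK.
exists Phi, G; split.
- pose ev : {rmorphism A -> B} := (horner_eval (0 : B) \o Phi).
  pose fc : {rmorphism A -> B} := (@mpolyC (n + m) F \o f).
  move=> r; apply: (@mpoly_rmorph_eq _ _ ev fc) => [a|v] /=.
    by rewrite /Phi /= mmapC /= /horner_eval hornerC.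
  rewrite -[Phi 'X_v]/(Phi _) -{1}(splitK v) -{2}(splitK v) /horner_eval.
  case: (split v) => i /=.
    rewrite -/(varx i) Phix hornerM hornerXn hornerC /wx /dx unit_rowE.
    case: (eqVneq (f (varx i)) 0) => /= [->|_]; first by rewrite rmorph0; case: ifP; rewrite expr0n mul0r.
    by rewrite expr0n mul1r.
  rewrite -/(vary i) Phiy hornerM hornerXn hornerC /wy /dy unit_colE.
  case: (eqVneq (f (vary i)) 0) => /= [->|_]; first by rewrite rmorph0; case: ifP; rewrite expr0n mul0r.
  by rewrite expr0n mul1r.
- move=> e; rewrite /diag rmorph_sum mulr_sumr; apply: eq_bigr => c /andP[cl _].
  rewrite rmorphM Phix Phiy mulrACA -exprD -polyCM mulrA -exprD subnKC //.
  exact: wt_ge2.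
- move=> e; rewrite /G horner_sum /ddiag [RHS]big_mkcondr; apply: eq_bigr => c /andP[cl _].
  rewrite hornerM hornerXn hornerC expr0n subn_eq0 eqn_leq (wt_ge2 lam_sorted no_unit_cell cl) andbT.
  by case: ifP; rewrite ?mul1r ?mul0r.
Qed.

(** Under the degeneration the determinant is divisible by the power [2 * M] of ['X]; dividing and
    setting ['X] to 0 gives the same determinant in the initial forms. Independence lifts it to an
    identity in the linear polynomials [T e]. Evaluation at [c] turns [T e] into [c e], kills the
    [C] terms and leaves [c g ^+ M = 0]. *)
Lemma residue_relation (M : nat) (C : 'I_M -> 'I_M -> 'I_ncolors -> A) (g : 'I_ncolors) (c : 'I_ncolors -> F) :
  (forall a : 'I_ncolors -> A, \sum_e a e * diag e = 0 -> \sum_e f (a e) * c e = 0) ->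
  (forall a b, \sum_e f (C a b e) * c e = 0) ->
  \det (\matrix_(a, b) (diag g *+ (a == b) - \sum_e C a b e * diag e)) = 0 -> c g = 0.
Proof.
move=> clin cC detC; have [Phi [G [Phi0 PhiD G0]]] := degeneration.
have det0 : \det (\matrix_(a < M, b < M) (ddiag f g *+ (a == b) - \sum_e (f (C a b e))%:MP * ddiag f e)) = 0.
  have detG : \det (\matrix_(a < M, b < M) (G g *+ (a == b) - \sum_e Phi (C a b e) * G e)) = 0.
    have X2 : ('X^2 : {poly B}) ^+ M != 0 by rewrite -exprM; apply/monic_neq0/monicXn.
    apply: (mulfI X2); rewrite mulr0 -detZ -[RHS](rmorph0 Phi) -detC -det_map_mx; congr (\det _).
    apply/matrixP => a b; rewrite !mxE rmorphB rmorphMn /= PhiD rmorph_sum mulrBr mulrnAr mulr_sumr.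
    by congr (_ - _); apply: eq_bigr => e _; rewrite rmorphM /= PhiD mulrCA.
  transitivity (horner_eval 0 (\det (\matrix_(a < M, b < M) (G g *+ (a == b) - \sum_e Phi (C a b e) * G e)))).
    rewrite -det_map_mx; congr (\det _); apply/matrixP => a b; rewrite !mxE rmorphB rmorphMn rmorph_sum /=.
    by rewrite /horner_eval G0; congr (_ - _); apply: eq_bigr => e _; rewrite hornerM Phi0 G0.
  by rewrite detG rmorph0.
have /boolp.choice[be beP] := linear_reduction lam_sorted f.
have cE (e : 'I_ncolors) : c e = \sum_i be e i * c (enum_val i) := beP e F^o c clin.
have dlin (a : 'I_ncolors -> A) : \sum_e a e * diag e = 0 -> \sum_e f (a e) *: ddiag f e = 0.
  move=> aD; have : Phi (\sum_e a e * diag e) = 0 by rewrite aD rmorph0.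
  rewrite rmorph_sum (eq_bigr (fun e => 'X^2 * (Phi (a e) * G e))) => [|e _]; last first.
    by rewrite rmorphM /= PhiD mulrCA.
  rewrite -mulr_sumr => /eqP; rewrite mulf_eq0 (negbTE (monic_neq0 (monicXn _ 2))) /= => /eqP.
  move/(congr1 (horner_eval 0)); rewrite rmorph_sum rmorph0 => E; rewrite -[RHS]E.
  by apply: eq_bigr => e _; rewrite rmorphM /= /horner_eval Phi0 G0 mul_mpolyC.
have dE (e : 'I_ncolors) : ddiag f e = \sum_i be e i *: ddiag f (enum_val i) := beP e B (fun e => ddiag f e) dlin.
have [qc qcP] := leadQ_cell_exists f.
pose gq (i : 'I_#|leadQ f|) : B := ddiag f (enum_val i).
have gqP i : gq i != 0 /\ mlead (gq i) = dmnm f (qc i).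
  by rewrite /gq; have [ql <-] := qcP i; exact: mlead_ddiag.
have gq_indep := leads_alg_independent (fun i => (gqP i).1).
pose T (e : 'I_ncolors) : {mpoly F[#|leadQ f|]} := \sum_i be e i *: 'X_i.
have TE e : mmap (@mpolyC (n + m) F) gq (T e) = ddiag f e.
  rewrite /T rmorph_sum dE; apply: eq_bigr => i _.
  by rewrite /= mmapZ mmapX mmap1U mul_mpolyC.
have detT : \det (\matrix_(a < M, b < M) (T g *+ (a == b) - \sum_e (f (C a b e))%:MP * T e)) = 0.
  apply: gq_indep => [a b E|]; first apply: (dmnm_independent lam_sorted no_unit_cell qcP).
    rewrite (eq_bigr (fun i => mlead (gq i) *+ a i)%MM) => [|i _]; last by rewrite (gqP i).2.
    by rewrite E; apply: eq_bigr => i _; rewrite (gqP i).2.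
  rewrite -det_map_mx -[RHS]det0; congr (\det _); apply/matrixP => a b.
  rewrite !mxE rmorphB rmorphMn /= TE rmorph_sum; congr (_ - _); apply: eq_bigr => e _.
  by rewrite rmorphM /= mmapC TE.
pose ev := meval (fun i : 'I_#|leadQ f| => c (enum_val i)).
have evT e : ev (T e) = c e.
  by rewrite /ev /T rmorph_sum cE; apply: eq_bigr => i _; rewrite /= mevalZ mevalXU.
have : ev (\det (\matrix_(a < M, b < M) (T g *+ (a == b) - \sum_e (f (C a b e))%:MP * T e))) = 0.
  by rewrite detT /ev rmorph0.
rewrite /ev -det_map_mx (_ : map_mx _ _ = (c g)%:M); last first.
  apply/matrixP => a b; rewrite !mxE rmorphB rmorphMn /= -/ev evT /ev rmorph_sum.
  rewrite [X in _ - X](_ : _ = 0) ?subr0 // -[RHS](cC a b).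
  by apply: eq_bigr => e _; rewrite rmorphM /= mevalC -/ev evT.
by rewrite det_scalar => /eqP; rewrite expf_eq0 => /andP[_ /eqP].
Qed.

End Residue.

Hypothesis lam_n0 : (0 < size lam)%N.
Hypothesis lam_pos : all (fun l => 0 < l)%N lam.
Local Notation Fgen := (@Fgen lam K A varx vary).
Variables I J : A -> Prop.
Hypothesis IE : forall f, I f <-> igen (Fgen 1) f.
Hypothesis JE : forall f, J f <-> igen (fun p => exists e : 'I_ncolors, p = diag e) f.

Lemma J_coeffs f : J f -> exists c : 'I_ncolors -> A, f = \sum_e c e * diag e.
Proof.
move/JE => Jf; have [|c [_ ->]] := @igen_coeffs _ _ (fun e : 'I_ncolors => diag e) setT f; last by exists c.
have [J0 JD JM] := igen_ideal (fun p => exists2 e : 'I_ncolors, e \in setT & p = diag e).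
by move: Jf; apply: igen_min => // _ [e ->]; apply: igen_mem; exists e.
Qed.

Lemma J_basic (J' : A -> Prop) r : is_ideal J' -> ideal_sub J' J -> reduction_at J' I r ->
  ideal_sub J J'.
Proof.
move=> IJ' J'J J'r; have [J'0 J'D J'M] := IJ'.
suff JD e : J' (diag (e : 'I_ncolors)).
  by move=> x /J_coeffs[c ->]; apply: ideal_sum => // e _; exact: J'M.
move: e; apply: boolp.contrapT => notJ'.
have [F [f [c [[g cg0] cP]]]] := residue_functional (D := fun e : 'I_ncolors => diag e) IJ' notJ'.
case/eqP: cg0.
(* If a generator [u] is invertible in the residue field, then [u ^+ r.+1] lies in [J'], so the
   functional kills its product with [diag g], and [c g = 0] follows at once. *)
case: (pickP (fun q : cell => in_lam q && (unit_row f (row q) && unit_col f (col q)))) => [q|nounit].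
  case/and3P=> ql ur uc; pose u := varx q.1 * vary q.2.
  have Fu : f u ^+ r.+1 != 0.
    by rewrite expf_neq0 // rmorphM mulf_neq0 // -?unit_rowE -?unit_colE.
  have J'u : J' (u ^+ r.+1).
    have : ideal_mul J' (ideal_pow I r) (u ^+ r.+1).
      apply/J'r/(ideal_powE IE)/igen_mem; exists (nseq r.+1 q).
      by rewrite size_nseq all_nseq ql orbT big_nseq -iter_mulr_1; split.
    by apply: ideal_mul_min => // a b Ja _; rewrite mulrC; exact: J'M.
  have := cP (fun e => if e == g then u ^+ r.+1 else 0).
  rewrite (bigD1 g) //= eqxx big1 ?addr0 => [|e /negbTE ->]; last by rewrite mul0r.
  rewrite mulrC => /(_ (J'M _ _ J'u)); rewrite (bigD1 g) //= eqxx big1 ?addr0 => [|e /negbTE ->]; last first.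
    by rewrite rmorph0 mul0r.
  by move/eqP; rewrite rmorphXn mulf_eq0 (negbTE Fu) => /eqP.
have no_unit (q : cell) : in_lam q -> ~~ (unit_row f (row q) && unit_col f (col q)).
  by move=> ql; apply/negP => H; have := nounit q; rewrite ql H.
have n0 : (0 < n)%N by [].
have m0 : (0 < m)%N by exact: nth_lam_gt0 n0.
pose q0 : cell := (Ordinal n0, Ordinal m0).
have q0l : in_lam q0 by [].
(* The words of degree [r] generate [I^r], and [diag g] maps [I^r] into [J' I^r]; the power of the
   corner cell [q0] is a nonzero word, as [integral_det] demands. *)
pose w (a : 'I_#|words lam r|) := wordv K (enum_val a).
have Ig : I (diag g).
  by apply: (J_sub IE JE); apply/JE/igen_mem; exists g.
have [|a|f' /J'J/J_coeffs //|C [CJ Cdet]] := @integral_det _ _ _ w (fun e : 'I_ncolors => diag e) J' (diag g) _ _ _ IJ'.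
- have tP : size (nseq r q0) == r by rewrite size_nseq.
  have tl : all (@in_lam lam) (Tuple tP) by rewrite /= all_nseq q0l orbT.
  exists (enum_rank (exist _ (Tuple tP) tl : words lam r)).
  by rewrite /w enum_rankK /wordv -word_mnmE -msupp_eq0 msuppX.
- have : ideal_mul J' (ideal_pow I r) (diag g * w a).
    apply/J'r; rewrite /= mulrC; apply: ideal_mul_mem => //.
    by apply/(ideal_powE IE)/igen_mem; exact: Fgen_wordv.
  apply: ideal_mul_min; first exact: ideal_mul_ideal.
  move=> x y Jx /(ideal_powE IE) Iy; apply: ideal_mul_mem => //.
  move: Iy; apply: igen_min; first exact: igen_ideal.
  by move=> _ /wordv_Fgen[t ->]; apply: igen_mem; exists (enum_rank t); rewrite /w enum_rankK.
by apply: (residue_relation no_unit _ (fun a b => cP _ (CJ a b)) Cdet) => a aD; apply: cP; rewrite aD.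
Qed.

Lemma J_minimal : is_minimal_reduction J I.
Proof.
split; last by move=> J' IJ' J'J [_ [_ [r J'r]]]; exact: J_basic J'r.
split; first exact: J_ideal JE.
split; first by move=> x; apply: (J_sub IE JE).
by exists (ferrers_rn lam); exact: (J_reduction IE lam_n0 lam_sorted lam_pos JE).
Qed.

End Assembly.

(** * Transport to iterated polynomial rings *)

Lemma poly_rmorph_eq (R S : nzRingType) (g h : {rmorphism {poly R} -> S}) :
  (forall a, g a%:P = h a%:P) -> g 'X = h 'X -> g =1 h.
Proof.
move=> gc gx p; rewrite -(coefK p) poly_def !rmorph_sum; apply: eq_bigr => i _.
by rewrite -mul_polyC !rmorphM !rmorphXn /= gc gx.
Qed.

Lemma iterated_poly_iso (K : fieldType) (k : nat) :
  exists (phi : {rmorphism Defs.mpoly K k -> {mpoly K[k]}})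
         (psi : {rmorphism {mpoly K[k]} -> Defs.mpoly K k}),
    [/\ cancel phi psi, cancel psi phi & forall i : 'I_k, phi (mvar K k i) = 'X_i].
Proof.
elim: k => [|k [phi [psi [phiK psiK phiX]]]].
  exists (@mpolyC 0 K : {rmorphism K -> {mpoly K[0]}}), (mcoeff 0%MM : {rmorphism {mpoly K[0]} -> K}).
  by split=> [||[]//]; [exact: mpolyCK|exact: mpolyKC].
pose phi' : {rmorphism {poly Defs.mpoly K k} -> {mpoly K[k.+1]}} :=
  horner_eval ('X_ord_max : {mpoly K[k.+1]}) \o map_poly (@mwiden k K \o phi).
pose psi' : {rmorphism {mpoly K[k.+1]} -> {poly Defs.mpoly K k}} :=
  mmap (@polyC (Defs.mpoly K k) \o psi \o @mpolyC k K : {rmorphism K -> {poly Defs.mpoly K k}})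
    (fun i : 'I_k.+1 => mvar K k.+1 i : {poly Defs.mpoly K k}).
have phiC c : phi' c%:P = mwiden (phi c).
  by rewrite /phi' /= /horner_eval map_polyC hornerC.
have phiXmax : phi' 'X = 'X_ord_max.
  by rewrite /phi' /= /horner_eval map_polyX hornerX.
have mvarS i : mvar K k.+1 i = (if i == k then 'X else (mvar K k i)%:P) :> {poly Defs.mpoly K k} by [].
have phivar (i : 'I_k.+1) : phi' (mvar K k.+1 i) = 'X_i.
  rewrite mvarS; case: eqP => [ik|/eqP ik].
    by rewrite phiXmax; congr 'X_(_); apply: val_inj.
  have ik' : (i < k)%N by rewrite ltn_neqAle ik -ltnS ltn_ord.
  rewrite phiC (phiX (Ordinal ik')) mwidenX mnmwiden1.
  by congr 'X_[U_(_)]; apply: val_inj.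
have psivar (i : 'I_k.+1) : psi' 'X_i = mvar K k.+1 i by rewrite /psi' /= mmapX mmap1U.
have psiC a : psi' a%:MP = (psi a%:MP)%:P by rewrite /psi' /= mmapC.
exists phi', psi'; split=> //.
- have widen q : psi' (mwiden q) = (psi q)%:P.
    apply: (@mpoly_rmorph_eq K k _ (psi' \o @mwiden k K) (@polyC _ \o psi)) => [a|i] /=.
      by rewrite mwidenC psiC.
    rewrite mwidenX mnmwiden1 psivar mvarS /= ltn_eqF ?ltn_ord //.
    by rewrite -[mvar K k i]phiK phiX.
  apply: (@poly_rmorph_eq _ _ (psi' \o phi') idfun) => [a|] /=.
    transitivity (psi' (mwiden (phi a))); first by congr (psi' _); exact: phiC.
    by rewrite widen phiK.
  transitivity (psi' 'X_ord_max); first by congr (psi' _); exact: phiXmax.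
  by rewrite psivar mvarS /= eqxx.
- apply: (@mpoly_rmorph_eq K k.+1 _ (phi' \o psi') idfun) => [a|i] /=.
    rewrite psiC; transitivity (mwiden (phi (psi a%:MP))); first exact: phiC.
    by rewrite psiK mwidenC.
  by rewrite psivar; exact: phivar.
Qed.

Section Transport.
Variables (R S : comNzRingType) (phi : {rmorphism R -> S}) (psi : {rmorphism S -> R}).
Hypotheses (phiK : cancel phi psi) (psiK : cancel psi phi).

(** The image of [P] under [phi], written as a preimage under the inverse to avoid an
    existential. *)
Definition pull (P : R -> Prop) : S -> Prop := fun s => P (psi s).

Lemma pull_ideal P : is_ideal P -> is_ideal (pull P).
Proof.
move=> [P0 PD PM]; split; rewrite /pull ?rmorph0 //.
- by move=> a b; rewrite rmorphD; exact: PD.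
- by move=> r a; rewrite rmorphM; exact: PM.
Qed.

Lemma pull_mul P Q : ideal_mul (pull P) (pull Q) = pull (ideal_mul P Q).
Proof.
apply: boolp.funext => s; apply: boolp.propext; split=> -[t [tP E]].
  exists [seq (psi p.1, psi p.2) | p <- t]; split; first by move=> _ /mapP[p /tP[p1 p2] ->].
  by rewrite E rmorph_sum big_map; apply: eq_bigr => p _; rewrite rmorphM.
exists [seq (phi p.1, phi p.2) | p <- t]; split.
  by move=> _ /mapP[p /tP[p1 p2] ->]; rewrite /pull /= !phiK.
by rewrite -[s]psiK E rmorph_sum big_map; apply: eq_bigr => p _; rewrite rmorphM.
Qed.

Lemma pull_pow P r : ideal_pow (pull P) r = pull (ideal_pow P r).
Proof. by elim: r => [//|r IH] /=; rewrite IH pull_mul. Qed.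

Lemma pull_sub P Q : ideal_sub (pull P) (pull Q) <-> ideal_sub P Q.
Proof. by split=> [H x Px|H x]; [rewrite -(phiK x); apply: H; rewrite /pull phiK|exact: H]. Qed.

Lemma pull_reduction_at J I r : reduction_at (pull J) (pull I) r <-> reduction_at J I r.
Proof.
rewrite /reduction_at pull_pow pull_pow pull_mul /ideal_eq /pull.
by split=> H x; [rewrite -(phiK x)|]; exact: H.
Qed.

Lemma pull_reduction_number J I r : reduction_number_wrt (pull J) (pull I) r <-> reduction_number_wrt J I r.
Proof.
by split=> -[/pull_reduction_at H H']; split=> // r' /pull_reduction_at; exact: H'.
Qed.

Lemma pull_reduction J I : is_ideal J -> is_reduction J I -> is_reduction (pull J) (pull I).
Proof.
move=> IJ [_ [JI [r Jr]]]; split; first exact: pull_ideal.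
by split; [exact/pull_sub|exists r; exact/pull_reduction_at].
Qed.

Lemma igen_pull G s : igen G (psi s) -> igen (pull G) s.
Proof.
rewrite -{2}(psiK s); elim=> [|r x y Gx _ IH]; first by rewrite rmorph0; exact: igen0.
by rewrite rmorphD rmorphM; apply: igenMD => //; rewrite /pull phiK.
Qed.

Lemma pull_igen G s : igen (pull G) s -> igen G (psi s).
Proof.
elim=> [|r x y Gx _ IH]; first by rewrite rmorph0; exact: igen0.
by rewrite rmorphD rmorphM; exact: igenMD.
Qed.

End Transport.

Lemma pullK (R S : comNzRingType) (phi : {rmorphism R -> S}) (psi : {rmorphism S -> R}) (P : R -> Prop) :
  cancel phi psi -> pull phi (pull psi P) = P.
Proof. by move=> phiK; apply: boolp.funext => x; rewrite /pull phiK. Qed.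

Lemma pull_minimal (R S : comNzRingType) (phi : {rmorphism R -> S}) (psi : {rmorphism S -> R})
    (J I : R -> Prop) : cancel phi psi -> cancel psi phi ->
  is_minimal_reduction J I -> is_minimal_reduction (pull psi J) (pull psi I).
Proof.
move=> phiK psiK [JI Jmin]; have IJ := JI.1.
split; first exact: (pull_reduction phiK psiK).
move=> J' IJ' J'J J'I; apply/(pull_sub psiK _ _); rewrite (pullK J phiK).
apply: Jmin; first exact: pull_ideal.
- by apply/(pull_sub phiK _ _); rewrite (pullK J' psiK).
- by have := pull_reduction psiK phiK IJ' J'I; rewrite (pullK I phiK).
Qed.

Lemma igen_ext (R : comNzRingType) (G H : R -> Prop) x :
  (forall y, G y <-> H y) -> igen G x <-> igen H x.
Proof.
by move=> GH; split; elim=> [|r y z /GH Gy _ IH]; [exact: igen0|exact: igenMD|exact: igen0|exact: igenMD].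
Qed.

(** * The Ferrers ideal and its diagonals in the two polynomial rings *)

Section Comparison.
Variables (K : fieldType) (lam : seq nat).
Local Notation n := (nF lam).
Local Notation m := (lam1 lam).
Local Notation cell := (cell lam).
Local Notation varx := (@varx lam K).
Local Notation vary := (@vary lam K).
Hypothesis lam_n0 : (0 < size lam)%N.
Hypothesis lam_sorted : sorted geq lam.
Hypothesis lam_pos : all (fun l => 0 < l)%N lam.
Variables (phi : {rmorphism FRing K lam -> {mpoly K[n + m]}}).
Variables (psi : {rmorphism {mpoly K[n + m]} -> FRing K lam}).
Hypotheses (phiK : cancel phi psi) (psiK : cancel psi phi).
Hypothesis phiX : forall i : 'I_(n + m), phi (mvar K (n + m) i) = 'X_i.

Lemma phi_xv (i : 'I_n) : phi (xv K lam i) = varx i.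
Proof. exact: (phiX (lshift m i)). Qed.

Lemma phi_yv (j : 'I_m) : phi (yv K lam j) = vary j.
Proof. exact: (phiX (rshift n j)). Qed.

Lemma pull_gen (gs : seq (FRing K lam)) (G : {mpoly K[n + m]} -> Prop) :
  (forall t, psi t \in gs <-> G t) -> forall s, pull psi (gen_ideal gs) s <-> igen G s.
Proof.
move=> GE s; rewrite /pull gen_idealP -(igen_ext s GE).
by split; [exact: (igen_pull phiK psiK)|exact: pull_igen].
Qed.

Lemma pull_ferrers s : pull psi (ferrers_ideal K lam) s <-> igen (Fgen varx vary 1) s.
Proof.
apply: pull_gen => t; split=> [/allpairsPdep[i [j []]]|[w [sz wl ->]]].
  rewrite !mem_iota /= !add0n => iN jl E.
  have jm : (j < m)%N by apply: leq_trans jl (nth_lam_le lam_sorted _).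
  exists [:: ((Ordinal iN, Ordinal jm) : cell)]; rewrite /= /in_lam /row /col /= jl big_seq1; split=> //.
  by rewrite -[t]psiK E rmorphM /cellv -(phi_xv (Ordinal iN)) -(phi_yv (Ordinal jm)).
case: w sz wl => [|c [|]] //= _ /andP[cl _]; rewrite big_seq1; apply/allpairsPdep; exists (row c), (col c).
rewrite !mem_iota !add0n /= row_lt; split=> //.
by rewrite /cellv -phi_xv -phi_yv -rmorphM phiK.
Qed.

Lemma diag_rows e : diag varx vary e =
  \sum_(r < n) \sum_(l < m | (l < nth 0 lam r)%N && (l + (n.-1 - r) == e)%N) varx r * vary l.
Proof. by rewrite pair_big_dep. Qed.

Lemma phi_diagD k : phi (diagD K lam k) = diag varx vary (k + n.-1).
Proof.
rewrite diag_rows /diagD rmorph_sum big_mkcond; apply: eq_bigr => r _.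
have rn := ltn_ord r; case: ifP => kr.
  have jm : (k + r < m)%N by apply: leq_trans kr (nth_lam_le lam_sorted _).
  rewrite (big_pred1 (Ordinal jm)) => [|l].
    by rewrite rmorphM phi_xv -(phi_yv (Ordinal jm)).
  rewrite /= -(inj_eq val_inj) /=; apply/andP/eqP => [[_ /eqP]|->]; first by lia.
  by rewrite kr; split=> //; lia.
rewrite big_pred0 // => l; apply/negbTE/negP => /andP[ll /eqP E].
by have lE : l = (k + r)%N :> nat by [lia]; rewrite -lE ll in kr.
Qed.

Lemma phi_diagE k : (k < n)%N -> phi (diagE K lam k) = diag varx vary (n.-1 - k).
Proof.
move=> kn; rewrite diag_rows /diagE rmorph_sum /=.
(* Reindexing by the row [r = k + i]; rows [r < k] are truncated to 0 by [h] and then excluded by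
   the side condition of [reindex_onto]. *)
pose h (r : 'I_n) : 'I_n := Ordinal (leq_ltn_trans (leq_subr k r) (ltn_ord r)).
rewrite (reindex_onto h (fun i => insubd i (k + i)%N)) /=; last first.
  move=> i /andP[kin _]; apply: val_inj; rewrite /= insubdK ?addKn //.
rewrite big_mkcond; apply: eq_bigr => r _; have rn := ltn_ord r.
case: (leqP k r) => kr; last first.
  rewrite (_ : (_ && _) = false).
    rewrite big_pred0 // => l; apply/negbTE/negP => /andP[_ /eqP]; lia.
  apply/negbTE/negP => /andP[/andP[H _] /eqP/(congr1 val)].
  by rewrite /= insubdK //=; lia.
rewrite subnKC // rn (_ : insubd (h r) (r : nat) = r); last by apply: val_inj; rewrite insubdK.
rewrite eqxx andbT /=; case: ifP => rl.
  have jm : (r - k < m)%N by apply: leq_trans rl (nth_lam_le lam_sorted _).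
  rewrite (big_pred1 (Ordinal jm)) => [|l].
    by rewrite rmorphM phi_xv -(phi_yv (Ordinal jm)).
  rewrite /= -(inj_eq val_inj) /=; apply/andP/eqP => [[_ /eqP]|->]; first by lia.
  by rewrite rl; split=> //; lia.
rewrite big_pred0 // => l; apply/negbTE/negP => /andP[ll /eqP E].
by have lE : l = (r - k)%N :> nat by [lia]; rewrite -lE ll in rl.
Qed.

Lemma pull_J_lambda s : pull psi (J_lambda K lam) s <->
  igen (fun p => exists e : 'I_(ncolors lam), p = diag varx vary e) s.
Proof.
have n0 : (0 < n)%N by [].
apply: pull_gen => t; rewrite mem_cat; split=> [|[e ->]].
  case/orP => /mapP[k]; rewrite mem_iota => kb E; rewrite -[t]psiK E.
    have ke : (k + n.-1 < ncolors lam)%N by rewrite /ncolors; lia.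
    by exists (Ordinal ke); exact: phi_diagD.
  have ke : (n.-1 - k < ncolors lam)%N.
    by rewrite /ncolors; have := nth_lam_gt0 lam_pos n0; rewrite -/(lam1 lam); lia.
  exists (Ordinal ke); apply: phi_diagE; lia.
have eb := ltn_ord e; have ncE : ncolors lam = (n + m).-1 by [].
apply/orP; case: (leqP n.-1 e) => ne; [left|right].
  apply/mapP; exists (e - n.-1)%N; first by rewrite mem_iota; lia.
  by rewrite -[RHS]phiK phi_diagD subnK.
apply/mapP; exists (n.-1 - e)%N; first by rewrite mem_iota; lia.
by rewrite -[RHS]phiK phi_diagE ?subKn ?(ltnW ne) //; lia.
Qed.

End Comparison.

Theorem theorem6p7 (K : fieldType) (lam : seq nat) :
  infinite_field K ->
  (0 < size lam)%N ->
  sorted geq lam ->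
  all (fun l => 0 < l)%N lam ->
  reduction_number (ferrers_ideal K lam) (ferrers_rn lam) /\
  is_minimal_reduction (J_lambda K lam) (ferrers_ideal K lam) /\
  reduction_number_wrt (J_lambda K lam) (ferrers_ideal K lam) (ferrers_rn lam).
Proof.
move=> Kinf lam_n0 lam_sorted lam_pos.
have [phi [psi [phiK psiK phiX]]] := iterated_poly_iso K (nF lam + lam1 lam).
have IE := pull_ferrers lam_sorted phiK psiK phiX.
have JE := pull_J_lambda lam_n0 lam_sorted lam_pos phiK psiK phiX.
have Jmin : is_minimal_reduction (J_lambda K lam) (ferrers_ideal K lam).
  have := pull_minimal psiK phiK (J_minimal lam_sorted lam_n0 lam_pos IE JE).
  by rewrite !pullK.
have Jnum : reduction_number_wrt (J_lambda K lam) (ferrers_ideal K lam) (ferrers_rn lam).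
  exact/(pull_reduction_number phiK psiK)/(J_reduction_number IE lam_n0 lam_sorted lam_pos Kinf JE).
split=> //; split; first by exists (J_lambda K lam).
move=> J r Jm [Jr _].
have Jm' := pull_minimal phiK psiK Jm.
have [w [w1 wP]] := minimal_reduction_lead IE lam_n0 lam_sorted lam_pos Kinf Jm'.
apply: (reduction_lower_ideal IE lam_n0 lam_sorted lam_pos Kinf _ w1 wP).
  by case: Jm' => -[_ []].
exact/(pull_reduction_at phiK psiK).
Qed.
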